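(* Let $n\ge1$ and let $B\in\mathcal S(\mathbb C^n,\mathbb C)$ satisfy $\log(1-BB^* )\in L^1(\mathbb T)$. Let $A:\mathbb D\to\mathcal L(\mathbb C^n,\mathbb C^n)$ be an outer function with $B(\zeta)^*B(\zeta)+A(\zeta)^*A(\zeta)=I$ for a.e. $\zeta\in\mathbb T$, and write $B(z)A(z)^{-1}=\sum_{j=0}^\infty c_jz^j$ ($z\in\mathbb D$), with $c_j\in\mathcal L(\mathbb C^n,\mathbb C)$. Let $f$ be holomorphic in a neighborhood of $\overline{\mathbb D}$ with $f(z)=\sum_{j=0}^\infty\hat f(j)z^j$. Then for each integer $k\ge0$ the series $\sum_{j=0}^\infty \hat f(j+k)c_j^*$ converges absolutely, $f\in H(B)$, and $$\|f\|_{H(B)}^2=\sum_{k=0}^\infty|\hat f(k)|^2+\sum_{k=0}^\infty\Big\|\sum_{j=0}^\infty c_j^*\hat f(j+k)\Big\|^2.$$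
   Context: $\mathbb D$ is the open unit disc, $\mathbb T$ the unit circle. $\mathcal S(\mathbb C^n,\mathbb C)$ is the set of holomorphic maps $B=(b_1,\dots,b_n):\mathbb D\to\mathcal L(\mathbb C^n,\mathbb C)$ (row vectors) with $\sup_{z\in\mathbb D}\|B(z)\|\le1$; boundary values on $\mathbb T$ are taken a.e. $H(B)$ is the reproducing kernel Hilbert space of functions on $\mathbb D$ with kernel $K_B(z,\lambda)=\frac{1-B(z)B(\lambda)^*}{1-z\bar\lambda}$. $H^2_{\mathbb C^n}$ is the $\mathbb C^n$-valued Hardy space on $\mathbb D$. A bounded holomorphic $A:\mathbb D\to\mathcal L(\mathbb C^n,\mathbb C^n)$ is outer if $\{Ap: p\text{ a }\mathbb C^n\text{-valued polynomial}\}$ is dense in $H^2_{\mathbb C^n}$ (such $A(z)$ is invertible for every $z\in\mathbb D$). $c_j^*\in\mathbb C^n$ is the adjoint (conjugate transpose) of the row vector $c_j$, and $\|\cdot\|$ is the Euclidean norm on $\mathbb C^n$. *)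

(* Defs.v *)
From HB Require Import structures.
From mathcomp Require Import all_boot all_order all_algebra.
From mathcomp Require Import all_classical all_reals all_analysis.
From mathcomp Require Import complex.
Set Implicit Arguments. Unset Strict Implicit. Unset Printing Implicit Defensive.
Import Order.TTheory GRing.Theory Num.Theory.
Import numFieldNormedType.Exports.
Local Open Scope ring_scope.
Local Open Scope classical_set_scope.

Section Defs.
Variable R : realType.
Local Notation C := R[i].

Definition cabs (z : C) : R := Normc.normc z.

Definition cexpi (t : R) : C := Complex (cos t) (sin t).

Definition cball (a : C) (r : R) : set C := [set z | cabs (z - a) < r].
Definition cdisc : set C := cball 0 1.
Definition cdisc_closure : set C := [set z | cabs z <= 1].

Definition copen (U : set C) : Prop :=
  forall z, U z -> exists2 r : R, 0 < r & cball z r `<=` U.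

Definition holo_on (U : set C) (f : C -> C) : Prop :=
  forall z, U z -> exists d : C, forall e : R, 0 < e ->
    exists2 del : R, 0 < del & forall w, 0 < cabs (w - z) < del ->
      cabs ((f w - f z) / (w - z) - d) < e.

Definition mx_holo_on p q (U : set C) (F : C -> 'M[C]_(p, q)) : Prop :=
  forall i j, holo_on U (fun z => F z i j).

(** squared Euclidean (Frobenius) norm; for row or column vectors this is the
    squared Euclidean norm, i.e. the squared operator norm of a row vector *)
Definition mnorm2 p q (M : 'M[C]_(p, q)) : R :=
  \sum_i \sum_j cabs (M i j) ^+ 2.
Definition mnorm p q (M : 'M[C]_(p, q)) : R := Num.sqrt (mnorm2 M).

Definition adj p q (M : 'M[C]_(p, q)) : 'M[C]_(q, p) :=
  map_mx (fun z => conjc z) M^T.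

Definition mx_series_to p q (u : nat -> 'M[C]_(p, q)) (S : 'M[C]_(p, q)) : Prop :=
  (fun N => mnorm2 (\sum_(k < N) u k - S)) @ \oo --> (0 : R).

Definition c_series_to (u : nat -> C) (S : C) : Prop :=
  (fun N => cabs (\sum_(k < N) u k - S)) @ \oo --> (0 : R).

(** sum of a series of matrices (meaningful when it converges) *)
Definition mx_sum p q (u : nat -> 'M[C]_(p, q)) : 'M[C]_(p, q) :=
  xget 0 [set S | mx_series_to u S].

Definition radial_limit p q (F : C -> 'M[C]_(p, q)) (t : R) (b : 'M[C]_(p, q)) : Prop :=
  (fun r : R => mnorm2 (F (Complex r 0 * cexpi t) - b)) x @[x --> (1 : R)^'-] --> (0 : R).

Definition hardy_coefs n (g : C -> 'cV[C]_n) (a : nat -> 'cV[C]_n) : Prop :=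
  (forall z, cdisc z -> mx_series_to (fun k => z ^+ k *: a k) (g z)) /\
  cvgn (series (fun k => mnorm2 (a k))).

Definition in_hardy n (g : C -> 'cV[C]_n) : Prop := exists a, hardy_coefs g a.

Definition peval n (P : 'cV[{poly C}]_n) (z : C) : 'cV[C]_n :=
  map_mx (fun p => p.[z]) P.

Definition outer n (A : C -> 'M[C]_n) : Prop :=
  forall g, in_hardy g -> forall e : R, 0 < e ->
    exists P : 'cV[{poly C}]_n, exists b : nat -> 'cV[C]_n,
      hardy_coefs (fun z => g z - A z *m peval P z) b /\
      forall N, \sum_(k < N) mnorm2 (b k) <= e.

Definition KB n (B : C -> 'rV[C]_n) (z l : C) : C :=
  (1 - (B z *m adj (B l)) 0 0) / (1 - z * conjc l).

(** H(B) as the completion of span{K_B(., l) : l in D} (Moore-Aronszajn).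
    A finite combination sum_i a_i K_B(., l_i) is a list of pairs (a_i, l_i). *)
Definition keval n (B : C -> 'rV[C]_n) (s : seq (C * C)) (z : C) : C :=
  \sum_(x <- s) x.1 * KB B z x.2.

Definition knorm2 n (B : C -> 'rV[C]_n) (s : seq (C * C)) : R :=
  complex.Re (\sum_(x <- s) \sum_(y <- s) x.1 * conjc y.1 * KB B y.2 x.2).

Definition kneg (s : seq (C * C)) : seq (C * C) := [seq (- x.1, x.2) | x <- s].

(** f belongs to H(B) and ||f||_{H(B)}^2 = v : f is the pointwise limit on D of a
    Cauchy sequence of finite kernel combinations whose squared norms tend to v *)
Definition HB_norm2 n (B : C -> 'rV[C]_n) (f : C -> C) (v : R) : Prop :=
  exists s : nat -> seq (C * C),
    (forall m x, x \in s m -> cdisc x.2) /\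
    (forall e : R, 0 < e -> exists N, forall m l, (N <= m)%N -> (N <= l)%N ->
       knorm2 B (s m ++ kneg (s l)) < e) /\
    (forall z, cdisc z -> (fun m => cabs (keval B (s m) z - f z)) @ \oo --> (0 : R)) /\
    (fun m => knorm2 B (s m)) @ \oo --> v.

Definition in_HB n (B : C -> 'rV[C]_n) (f : C -> C) : Prop := exists v, HB_norm2 B f v.

End Defs.

(* Main.v *)
Require Import Defs.
From HB Require Import structures.
From mathcomp Require Import all_boot all_order all_algebra.
From mathcomp Require Import all_classical all_reals all_analysis.
From mathcomp Require Import complex.
From mathcomp Require Import ring lra.
Import Order.TTheory GRing.Theory Num.Theory.
Import numFieldNormedType.Exports.
Local Open Scope ring_scope.
Local Open Scope classical_set_scope.

(**
Put [V = (B; A)], so that [V^* V = I] almost everywhere on the circle and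
multiplication by [V] is isometric on the Hardy space [H^2].  For a finite
combination [s] of kernels of [H(B)], with [q] the corresponding combination of
Szego kernels, there is [w] such that [x_s = (q, 0) - V w] is orthogonal to
[V H^2], has the kernel combination as its scalar component, and has [H^2] norm
equal to the [H(B)] norm of the combination.

Let [F = (f, g)], where [g] has coefficients [- \sum_j c_j^* fh (j + k)].
Since [B = (\sum_j c_j z^j) A], the function [F] is also orthogonal to [V H^2].
Hence for every polynomial [P] the distance from [x_s] to [F] is at most the
norm of [F - (q, 0) - V P], because [x_s - F] is orthogonal to the rest.  This
norm is made small by first choosing [P] with [A P] close to [g], as [A] is
outer, and then [q] close to [f - B P], as Szego kernels span a dense subspace.
So [x_s] tends to [F], and the squared norm of [F] is the right-hand side.

[H^2] inner products are taken as limits, as [r] tends to [1], of means over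
circles of radius [r].  That [A] and [B] are power series follows from outerness:
[A P] is a power series for enough polynomial vectors [P], so [A] times a
nonzero polynomial is one, and linear factors can be divided out.  Only the
geometric decay of [fh] uses Cauchy's theorem, in Goursat's form.
*)

(** The choice of [w] is forced. For a Szego kernel k_l, the projection to H^2 of the adjoint of V
    applied to (k_l, 0) is k_l times the adjoint of B(l). Subtracting V of it leaves the part of
    (k_l, 0) orthogonal to V H^2, and the scalar component of that part is K_B(., l).

    The main obstacle is the orthogonality of F. The row \sum_j c_j z^j is in general unbounded, so
    it cannot simply be moved from one side of an inner product to the other. Instead f and g are
    truncated together so that every truncated pairing is exactly zero, and the decay of [fh] makes
    the truncation errors uniformly small on the disc.

    A second constraint is that [holo_on] provides only a complex derivative at each point. The
    functions that are paired are therefore kept in the class [nice] of bounded functions with a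
    power series. Boundedness lets uniform approximations pass through the limit of means, and lets
    dominated convergence exploit the almost everywhere convergence of V^* V to the identity. *)

Set Implicit Arguments.
Unset Strict Implicit.
Unset Printing Implicit Defensive.

(** * Modulus, conjugation, real and imaginary parts of complex numbers *)

Section ComplexModulus.
Variable R : realType.
Local Notation C := R[i].
Implicit Types (x y z w : C) (r e : R).

Lemma cabs0 : cabs (0 : C) = 0. Proof. exact: Normc.normc0. Qed.
Lemma cabs1 : cabs (1 : C) = 1. Proof. exact: Normc.normc1. Qed.
Lemma cabsM x y : cabs (x * y) = cabs x * cabs y.
Proof. exact: Normc.normcM. Qed.
Lemma cabsV x : cabs x^-1 = (cabs x)^-1. Proof. exact: Normc.normcV. Qed.
Lemma cabsN x : cabs (- x) = cabs x. Proof. exact: normcN. Qed.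
Lemma cabsD x y : cabs (x + y) <= cabs x + cabs y. Proof. exact: le_normcD. Qed.
Lemma cabs_ge0 x : 0 <= cabs x.
Proof. by case: x => a b; exact: sqrtr_ge0. Qed.
Lemma cabs_eq0 x : cabs x = 0 -> x = 0. Proof. exact: Normc.eq0_normc. Qed.

Lemma cabs_gt0 x : x != 0 -> 0 < cabs x.
Proof.
by move=> x0; rewrite lt_def cabs_ge0 andbT; apply: contra_neq x0 => /cabs_eq0.
Qed.

Lemma cabsC x y : cabs (x - y) = cabs (y - x).
Proof. by rewrite -cabsN opprB. Qed.

Lemma cabsB x y : cabs (x - y) <= cabs x + cabs y.
Proof. by rewrite (le_trans (cabsD _ _))// cabsN. Qed.

Lemma cabs_tri z x y : cabs (x - y) <= cabs (x - z) + cabs (z - y).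
Proof. by rewrite (le_trans _ (cabsD _ _))// addrA subrK. Qed.

Lemma cabsX x n : cabs (x ^+ n) = cabs x ^+ n.
Proof. by elim: n => [|n IH]; rewrite ?expr0 ?cabs1// !exprS cabsM IH. Qed.

Lemma cabs_conj x : cabs (conjc x) = cabs x.
Proof. by case: x => a b; rewrite /cabs/= sqrrN. Qed.

Lemma cabs_real r : 0 <= r -> cabs (Complex r 0) = r.
Proof. by move=> r0; rewrite /cabs/= expr0n/= addr0 sqrtr_sqr ger0_norm. Qed.

Lemma cabs_sqr x : cabs x ^+ 2 = complex.Re x ^+ 2 + complex.Im x ^+ 2.
Proof. by case: x => a b; rewrite /cabs/= sqr_sqrtr// addr_ge0 ?sqr_ge0. Qed.

Lemma Re_le_cabs x : `|complex.Re x| <= cabs x.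
Proof.
case: x => a b; rewrite /cabs/= -sqrtr_sqr ler_sqrt ?lerDl ?sqr_ge0//.
by rewrite addr_ge0 ?sqr_ge0.
Qed.

Lemma Im_le_cabs x : `|complex.Im x| <= cabs x.
Proof.
case: x => a b; rewrite /cabs/= -sqrtr_sqr ler_sqrt ?lerDr ?sqr_ge0//.
by rewrite addr_ge0 ?sqr_ge0.
Qed.

Lemma cabs_le_ReIm x : cabs x <= `|complex.Re x| + `|complex.Im x|.
Proof.
case: x => a b; have h : Complex a b = Complex a 0 + Complex 0 b.
  by apply/eqP; rewrite eq_complex/= addr0 add0r !eqxx.
rewrite [X in cabs X]h; apply: (le_trans (cabsD _ _)).
by rewrite /cabs/= expr0n/= addr0 add0r !sqrtr_sqr.
Qed.

Lemma mul_conj x : x * conjc x = Complex (cabs x ^+ 2) 0.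
Proof.
by rewrite cabs_sqr; case: x => a b; apply/eqP; rewrite eq_complex/=;
  apply/andP; split; apply/eqP; ring.
Qed.

Lemma cabs_expi (t : R) : cabs (cexpi t) = 1.
Proof. by rewrite /cabs/= cos2Dsin2 sqrtr1. Qed.

Lemma cabs_polar r (t : R) : 0 <= r -> cabs (Complex r 0 * cexpi t) = r.
Proof. by move=> r0; rewrite cabsM cabs_expi mulr1 cabs_real. Qed.

Lemma cabs_sum (I : Type) (s : seq I) (P : pred I) (F : I -> C) :
  cabs (\sum_(i <- s | P i) F i) <= \sum_(i <- s | P i) cabs (F i).
Proof.
elim/big_rec2: _ => [|i a b _ h]; first by rewrite cabs0.
by rewrite (le_trans (cabsD _ _))// lerD2l.
Qed.

Lemma ReD x y : complex.Re (x + y) = complex.Re x + complex.Re y.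
Proof. by case: x y => [a b] [c d]. Qed.
Lemma ImD x y : complex.Im (x + y) = complex.Im x + complex.Im y.
Proof. by case: x y => [a b] [c d]. Qed.
Lemma ReN x : complex.Re (- x) = - complex.Re x.
Proof. by case: x. Qed.
Lemma ImN x : complex.Im (- x) = - complex.Im x.
Proof. by case: x. Qed.
Lemma ReM x y : complex.Re (x * y) =
  complex.Re x * complex.Re y - complex.Im x * complex.Im y.
Proof. by case: x y => [a b] [c d]. Qed.
Lemma ImM x y : complex.Im (x * y) =
  complex.Re x * complex.Im y + complex.Im x * complex.Re y.
Proof. by case: x y => [a b] [c d]. Qed.
Lemma Re_conj x : complex.Re (conjc x) = complex.Re x. Proof. by case: x. Qed.
Lemma Im_conj x : complex.Im (conjc x) = - complex.Im x. Proof. by case: x. Qed.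

Lemma Re_sum (I : Type) (s : seq I) (P : pred I) (F : I -> C) :
  complex.Re (\sum_(i <- s | P i) F i) = \sum_(i <- s | P i) complex.Re (F i).
Proof. by elim/big_rec2: _ => // i a b _ <-; rewrite ReD. Qed.

Lemma Im_sum (I : Type) (s : seq I) (P : pred I) (F : I -> C) :
  complex.Im (\sum_(i <- s | P i) F i) = \sum_(i <- s | P i) complex.Im (F i).
Proof. by elim/big_rec2: _ => // i a b _ <-; rewrite ImD. Qed.

Lemma eqC x y : complex.Re x = complex.Re y -> complex.Im x = complex.Im y -> x = y.
Proof. by case: x y => [a b] [c d] /= -> ->. Qed.

Lemma conjX x n : conjc (x ^+ n) = conjc x ^+ n. Proof. exact: rmorphXn. Qed.
Lemma conjM x y : conjc (x * y) = conjc x * conjc y. Proof. exact: rmorphM. Qed.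
Lemma conjD x y : conjc (x + y) = conjc x + conjc y. Proof. exact: rmorphD. Qed.
Lemma conjB x y : conjc (x - y) = conjc x - conjc y. Proof. exact: rmorphB. Qed.
Lemma conjN x : conjc (- x) = - conjc x. Proof. exact: rmorphN. Qed.
Lemma conj_sum (I : Type) (s : seq I) (P : pred I) (F : I -> C) :
  conjc (\sum_(i <- s | P i) F i) = \sum_(i <- s | P i) conjc (F i).
Proof. exact: rmorph_sum. Qed.

Lemma cexpiD (s t : R) : cexpi (s + t) = cexpi s * cexpi t.
Proof.
by apply: eqC; rewrite /cexpi ?ReM ?ImM/= ?cosD ?sinD// addrC mulrC [X in _ + X]mulrC addrC mulrC.
Qed.

Lemma cexpi0 : cexpi 0 = 1 :> C.
Proof. by rewrite /cexpi cos0 sin0. Qed.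

Lemma cdiscP z : cdisc z <-> cabs z < 1.
Proof. by rewrite /cdisc /cball/= subr0. Qed.

End ComplexModulus.

(** * Convergence of complex sequences and geometric majorants *)

Section Limits.
Variable R : realType.
Local Notation C := R[i].

(** The norm of [R[i]] takes values in [R[i]], so convergence is spelled out with the real modulus
    [cabs]; [cvg_tends] links it to the form used in the definitions of the statement. *)
Definition tends (u : nat -> C) (l : C) : Prop :=
  forall e : R, 0 < e -> exists N, forall m, (N <= m)%N -> cabs (u m - l) < e.

Lemma cvg0P (u : nat -> R) : u @ \oo --> (0 : R) <->
  forall e, 0 < e -> exists N, forall m, (N <= m)%N -> `|u m| < e.
Proof.
split.
  move/cvgr0Pnorm_lt => h e e0; have [N _ hN] := h e e0.
  by exists N => m Nm; exact: hN.
move=> h; apply/cvgr0Pnorm_lt => e e0; have [N hN] := h e e0.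
by exists N => // m /= Nm; exact: hN.
Qed.

Lemma cvg_tends (u : nat -> C) l :
  (fun m => cabs (u m - l)) @ \oo --> (0 : R) <-> tends u l.
Proof.
rewrite cvg0P; split=> h e e0; have [N hN] := h e e0; exists N => m /hN.
  by rewrite ger0_norm// cabs_ge0.
by rewrite ger0_norm// cabs_ge0.
Qed.

Lemma tends_squeeze (u : nat -> C) l (v : nat -> R) :
  (forall m, cabs (u m - l) <= v m) -> v @ \oo --> (0 : R) -> tends u l.
Proof.
move=> uv /cvg0P v0 e e0; have [N hN] := v0 e e0; exists N => m Nm.
by rewrite (le_lt_trans (uv m))// (le_lt_trans (ler_norm _))// hN.
Qed.

Lemma tends_cst (a : C) : tends (fun=> a) a.
Proof. by move=> e e0; exists 0%N => m _; rewrite subrr cabs0. Qed.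

Lemma tends_eq (u v : nat -> C) l : (forall m, u m = v m) -> tends u l -> tends v l.
Proof.
by move=> uv h e e0; have [N hN] := h e e0; exists N => m /hN; rewrite uv.
Qed.

Lemma tendsD (u v : nat -> C) a b : tends u a -> tends v b ->
  tends (fun m => u m + v m) (a + b).
Proof.
move=> hu hv e e0; have e2 : 0 < e / 2 by rewrite divr_gt0.
have [N hN] := hu _ e2; have [M hM] := hv _ e2; exists (maxn N M) => m.
rewrite geq_max => /andP[/hN h1 /hM h2].
by rewrite opprD addrACA (le_lt_trans (cabsD _ _))// (splitr e) ltrD.
Qed.

Lemma tendsZ (k : C) (u : nat -> C) a : tends u a -> tends (fun m => k * u m) (k * a).
Proof.
move=> hu e e0; have k0 : 0 < cabs k + 1 by rewrite ltr_wpDl ?cabs_ge0.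
have [N hN] := hu _ (divr_gt0 e0 k0); exists N => m /hN h.
rewrite -mulrBr cabsM (@le_lt_trans _ _ ((cabs k + 1) * cabs (u m - a)))//.
  by rewrite ler_wpM2r ?cabs_ge0// lerDl.
by rewrite mulrC -ltr_pdivlMr.
Qed.

Lemma tendsN (u : nat -> C) a : tends u a -> tends (fun m => - u m) (- a).
Proof. by move=> /(tendsZ (-1)); rewrite mulN1r; apply: tends_eq => m; rewrite mulN1r. Qed.

Lemma tendsB (u v : nat -> C) a b : tends u a -> tends v b ->
  tends (fun m => u m - v m) (a - b).
Proof. by move=> hu /tendsN; exact: tendsD. Qed.

Lemma tends_conj (u : nat -> C) a : tends u a -> tends (fun m => conjc (u m)) (conjc a).
Proof.
by move=> h e e0; have [N hN] := h e e0; exists N => m /hN; rewrite -rmorphB cabs_conj.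
Qed.

Lemma tends_sum (I : Type) (s : seq I) (u : I -> nat -> C) (a : I -> C) :
  (forall i, tends (u i) (a i)) ->
  tends (fun m => \sum_(i <- s) u i m) (\sum_(i <- s) a i).
Proof.
move=> h; elim: s => [|i s IH].
  by rewrite big_nil; apply: tends_eq (tends_cst 0) => m; rewrite big_nil.
rewrite big_cons; apply: tends_eq (tendsD (h i) IH) => m.
by rewrite big_cons.
Qed.

Lemma tends_bound (u : nat -> C) l : tends u l -> exists M : R, forall m, cabs (u m) <= M.
Proof.
move=> /(_ 1 ltr01)[N hN].
exists (\sum_(i < N) cabs (u i) + (cabs l + 1)) => m.
have S0 : 0 <= \sum_(i < N) cabs (u i) by rewrite sumr_ge0// => i _; exact: cabs_ge0.
case: (leqP N m) => [/hN h|mN].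
  rewrite (@le_trans _ _ (cabs l + 1))//; last by rewrite lerDr.
  by rewrite -[u m](subrK l) (le_trans (cabsD _ _))// addrC lerD2l ltW.
rewrite (bigD1 (Ordinal mN))//= -addrA lerDl addr_ge0//.
  by rewrite sumr_ge0// => i _; exact: cabs_ge0.
by rewrite addr_ge0 ?cabs_ge0.
Qed.

Lemma tends_unique (u : nat -> C) a b : tends u a -> tends u b -> a = b.
Proof.
move=> ha hb; apply/eqP; rewrite -subr_eq0; apply/negPn/negP => ab.
have e0 : 0 < cabs (a - b) / 2 by rewrite divr_gt0// cabs_gt0.
have [N hN] := ha _ e0; have [M hM] := hb _ e0.
have := ltrD (hN _ (leq_maxl N M)) (hM _ (leq_maxr N M)).
rewrite -splitr cabsC => /(le_lt_trans (cabs_tri (u (maxn N M)) a b)).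
by rewrite ltxx.
Qed.

Lemma tends_shift (u : nat -> C) l : tends u l -> tends (fun m => u m.+1) l.
Proof.
by move=> h e e0; have [N hN] := h e e0; exists N => m Nm; apply: hN; exact: leqW.
Qed.

Lemma tends_le (u : nat -> C) l (M : R) : (forall m, cabs (u m) <= M) ->
  tends u l -> cabs l <= M.
Proof.
move=> uM h; rewrite leNgt; apply/negP => Ml.
have [N /(_ N (leqnn _))] := h _ (eq_ind_r is_true Ml (subr_gt0 _ _)).
rewrite ltNge => /negP; apply.
rewrite -[in X in X <= _](subrK (u N) l) lerBlDr (le_trans (cabsD _ _))//.
by rewrite cabsC lerD2l.
Qed.

Lemma tends_Re_le (u : nat -> C) l (M : R) : (forall m, complex.Re (u m) <= M) ->
  tends u l -> complex.Re l <= M.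
Proof.
move=> uM h; rewrite leNgt; apply/negP => Ml.
have [N /(_ N (leqnn _))] := h _ (eq_ind_r is_true Ml (subr_gt0 _ _)).
rewrite ltNge => /negP; apply; rewrite cabsC.
rewrite (le_trans _ (Re_le_cabs _))// (le_trans _ (ler_norm _))//.
by rewrite ReD ReN lerB.
Qed.

Lemma geom_cvg0 (K t : R) : 0 <= t -> t < 1 -> (fun N => K * t ^+ N) @ \oo --> (0 : R).
Proof.
move=> t0 t1; rewrite -[X in _ --> X](mulr0 K); apply: cvgMr.
by apply: cvg_expr; rewrite ger0_norm.
Qed.

Lemma sum_geom_le (t : R) N : 0 <= t -> t < 1 -> \sum_(k < N) t ^+ k <= (1 - t)^-1.
Proof.
move=> t0 t1; have d0 : 0 < 1 - t by rewrite subr_gt0.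
rewrite -[_^-1]mul1r ler_pdivlMr// mulrC -[1 - t]opprB mulNr -subrX1 opprB.
by rewrite gerBl exprn_ge0.
Qed.

(** Each of the [N] terms [t ^+ k] with [k < N] is at least [t ^+ N], so the left side is below a
    partial geometric sum. *)
Lemma mul_geom_le (t : R) N : 0 <= t -> t < 1 -> N%:R * t ^+ N <= (1 - t)^-1.
Proof.
move=> t0 t1; apply: (le_trans _ (@sum_geom_le t N t0 t1)).
rewrite mulr_natl -[X in _ *+ X]card_ord -sumr_const ler_sum// => i _.
by rewrite ler_wiXn2l ?(ltW t1)// ltnW.
Qed.

Lemma mul_geom_cvg0 (K t : R) : 0 <= t -> t < 1 ->
  (fun N => K * (N%:R * t ^+ N)) @ \oo --> (0 : R).
Proof.
(* With [s] halfway between [t] and 1, [t ^+ m] is [(t / s) ^+ m * s ^+ m]: the first factor absorbs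
   [m] and the second tends to zero. *)
move=> t0 t1; pose s := (1 + t) / 2.
have s0 : 0 < s by rewrite /s; lra.
have s1 : s < 1 by rewrite /s; lra.
have q0 : 0 <= t / s by rewrite divr_ge0// ltW.
have q1 : t / s < 1 by rewrite ltr_pdivrMr// mul1r /s; lra.
apply/cvg0P => e e0.
have /cvg0P/(_ e e0)[N hN] := @geom_cvg0 (`|K| * (1 - t / s)^-1) s (ltW s0) s1.
exists N => m /hN; apply: le_lt_trans.
have -> : m%:R * t ^+ m = m%:R * (t / s) ^+ m * s ^+ m.
  by rewrite -mulrA -exprMn divfK// gt_eqF.
have a0 : 0 <= m%:R * (t / s) ^+ m by rewrite mulr_ge0// exprn_ge0.
have b0 : 0 <= s ^+ m by rewrite exprn_ge0// ltW.
have d0 : 0 <= (1 - t / s)^-1 by rewrite invr_ge0 subr_ge0 ltW.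
rewrite (normrM K) (ger0_norm (mulr_ge0 a0 b0)).
rewrite (ger0_norm (mulr_ge0 (mulr_ge0 (normr_ge0 K) d0) b0)).
by rewrite -[leRHS]mulrA ler_wpM2l// ler_wpM2r// mul_geom_le.
Qed.

Lemma cvg_sub0 (u : nat -> R) (l : R) :
  u @ \oo --> l <-> (fun m => u m - l) @ \oo --> (0 : R).
Proof. by split=> h; [apply/subr_cvg0|apply/subr_cvg0]. Qed.

Lemma tends_ReIm (u : nat -> C) l :
  (fun m => complex.Re (u m)) @ \oo --> complex.Re l ->
  (fun m => complex.Im (u m)) @ \oo --> complex.Im l -> tends u l.
Proof.
move=> /cvg_sub0/cvg0P h1 /cvg_sub0/cvg0P h2 e e0.
have e2 : 0 < e / 2 by rewrite divr_gt0.
have [N hN] := h1 _ e2; have [M hM] := h2 _ e2; exists (maxn N M) => m.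
rewrite geq_max => /andP[/hN a1 /hM a2].
by rewrite (le_lt_trans (cabs_le_ReIm _))// ReD ImD ReN ImN (splitr e) ltrD.
Qed.

Lemma tends_Re (u : nat -> C) l : tends u l ->
  (fun m => complex.Re (u m)) @ \oo --> complex.Re l.
Proof.
move=> h; apply/cvg_sub0/cvg0P => e e0; have [N hN] := h e e0.
by exists N => m /hN; apply: le_lt_trans; rewrite -ReN -ReD Re_le_cabs.
Qed.

Lemma geom_dominated_cvg (u : nat -> R) (M t : R) : 0 <= t -> t < 1 ->
  (forall k, `|u k| <= M * t ^+ k) -> cvgn (series u).
Proof.
move=> t0 t1 h; apply: normed_cvg.
apply: (@series_le_cvg _ (fun k => `|u k|) (geometric M t)) => [k|k|k|].
- exact: normr_ge0.
- exact: (le_trans (normr_ge0 _) (h k)).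
- exact: h.
- by apply: is_cvg_geometric_series; rewrite ger0_norm.
Qed.

Lemma geom_series (u : nat -> C) (M t : R) : 0 <= t -> t < 1 ->
  (forall k, cabs (u k) <= M * t ^+ k) ->
  exists S, tends (fun N => \sum_(k < N) u k) S.
Proof.
move=> t0 t1 h.
have c1 := @geom_dominated_cvg (fun k => complex.Re (u k)) M t t0 t1
  (fun k => le_trans (Re_le_cabs _) (h k)).
have c2 := @geom_dominated_cvg (fun k => complex.Im (u k)) M t t0 t1
  (fun k => le_trans (Im_le_cabs _) (h k)).
exists (Complex (limn (series (fun k => complex.Re (u k))))
                (limn (series (fun k => complex.Im (u k))))).
apply: tends_ReIm => /=.
  by apply: cvg_trans c1; apply: near_eq_cvg; near=> N; rewrite Re_sum /series/= big_mkord.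
by apply: cvg_trans c2; apply: near_eq_cvg; near=> N; rewrite Im_sum /series/= big_mkord.
Unshelve. all: by end_near. Qed.

Lemma geom_tail (u : nat -> C) (M t : R) S : 0 <= t -> t < 1 ->
  (forall k, cabs (u k) <= M * t ^+ k) ->
  tends (fun N => \sum_(k < N) u k) S ->
  forall N, cabs (S - \sum_(k < N) u k) <= M * t ^+ N / (1 - t).
Proof.
move=> t0 t1 h hS N.
have M0 : 0 <= M by have := le_trans (cabs_ge0 _) (h 0%N); rewrite expr0 mulr1.
(* The tail from [N] on is itself a limit of finite sums, each below [M * t ^+ N] times a geometric
   sum. *)
have {}hS : tends (fun m => \sum_(k < m) u (N + k)%N) (S - \sum_(k < N) u k).
  have hs : tends (fun m => \sum_(k < N + m) u k) S.
    move=> e e0; have [K hK] := hS e e0; exists K => m Km; apply: hK.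
    exact: leq_trans Km (leq_addl _ _).
  apply: tends_eq (tendsB hs (tends_cst (\sum_(k < N) u k))) => m.
  by rewrite big_split_ord/= addrAC subrr add0r.
apply: tends_le hS => m.
apply: (le_trans (cabs_sum _ _ _)).
apply: (@le_trans _ _ (\sum_(k < m) M * t ^+ N * t ^+ k)).
  by apply: ler_sum => k _; rewrite (le_trans (h _))// exprD mulrA.
by rewrite -mulr_sumr ler_wpM2l ?sum_geom_le// mulr_ge0// exprn_ge0.
Qed.

End Limits.

#[global] Arguments cabs : simpl never.

(** * Continuity of complex-valued functions in epsilon-delta form *)

Section Continuity.
Variables (R : realType) (T : Type) (d : T -> T -> R).
Local Notation C := R[i].
Implicit Types (f g : T -> C) (x : T).

(* [d] need not be a metric: only balls around the base point are used. *)
Definition contd f x : Prop := forall e : R, 0 < e ->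
  exists2 del : R, 0 < del & forall w, d w x < del -> cabs (f w - f x) < e.

Lemma contd_cst (c : C) x : contd (fun=> c) x.
Proof. by move=> e e0; exists 1 => // w _; rewrite subrr cabs0. Qed.

Lemma contdD f g x : contd f x -> contd g x -> contd (fun w => f w + g w) x.
Proof.
move=> hf hg e e0; have e2 : 0 < e / 2 by rewrite divr_gt0.
have [a a0 ha] := hf _ e2; have [b b0 hb] := hg _ e2.
exists (Num.min a b); first by rewrite lt_min a0.
move=> w; rewrite lt_min => /andP[/ha h1 /hb h2].
by rewrite opprD addrACA (le_lt_trans (cabsD _ _))// (splitr e) ltrD.
Qed.

Lemma contd_conj f x : contd f x -> contd (fun w => conjc (f w)) x.
Proof.
move=> hf e e0; have [a a0 ha] := hf _ e0; exists a => // w /ha.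
by rewrite -rmorphB cabs_conj.
Qed.

Lemma contdM f g x : contd f x -> contd g x -> contd (fun w => f w * g w) x.
Proof.
move=> hf hg e e0.
have F0 := cabs_ge0 (f x); have G0 := cabs_ge0 (g x).
(* As [e' <= 1], the product of the two increments is at most [e'], so the three error terms sum to
   at most [e' * (K - 1)]; the extra 1 in [K] gives the strict inequality. *)
pose K := cabs (f x) + cabs (g x) + 2.
have K0 : 0 < K by rewrite /K; lra.
pose e' := Num.min 1 (e / K).
have e'0 : 0 < e' by rewrite lt_min ltr01 divr_gt0.
have e'1 : e' <= 1 by rewrite ge_min lexx.
have e'K : e' * K <= e by rewrite -ler_pdivlMr// ge_min lexx orbT.
have [a a0 ha] := hf _ e'0; have [b b0 hb] := hg _ e'0.
exists (Num.min a b); first by rewrite lt_min a0.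
move=> w; rewrite lt_min => /andP[/ha h1 /hb h2].
have -> : f w * g w - f x * g x =
    (f w - f x) * (g w - g x) + (f w - f x) * g x + f x * (g w - g x) by ring.
apply: (le_lt_trans (cabsD _ _)); rewrite cabsM.
apply: (@le_lt_trans _ _ (cabs (f w - f x) * cabs (g w - g x) +
    cabs (f w - f x) * cabs (g x) + cabs (f x) * cabs (g w - g x))).
  by rewrite lerD2r (le_trans (cabsD _ _))// !cabsM.
have A0 := cabs_ge0 (f w - f x); have B0 := cabs_ge0 (g w - g x).
apply: (lt_le_trans _ e'K).
move: h1 h2 A0 B0; set A := cabs (f w - f x); set B := cabs (g w - g x) => h1 h2 A0 B0.
rewrite /K !mulrDr.
have t1 : A * B <= e' by nra.
have t2 : A * cabs (g x) <= e' * cabs (g x) by rewrite ler_wpM2r// ltW.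
have t3 : cabs (f x) * B <= e' * cabs (f x) by rewrite mulrC ler_wpM2r// ltW.
lra.
Qed.

Lemma contdZ (c : C) f x : contd f x -> contd (fun w => c * f w) x.
Proof. by move=> hf; apply: contdM => //; exact: contd_cst. Qed.

Lemma contdN f x : contd f x -> contd (fun w => - f w) x.
Proof.
move=> hf e e0; have [a a0 ha] := hf _ e0; exists a => // w /ha.
by rewrite -opprD cabsN.
Qed.

Lemma contdX f x n : contd f x -> contd (fun w => f w ^+ n) x.
Proof.
move=> hf; elim: n => [|n IH].
  by move=> e e0; exists 1 => // w _; rewrite !expr0 subrr cabs0.
by move=> e e0; have [a a0 ha] := contdM hf IH e0; exists a => // w /ha; rewrite -!exprS.
Qed.

Lemma contd_sum (I : Type) (s : seq I) (F : I -> T -> C) x :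
  (forall i, contd (F i) x) -> contd (fun w => \sum_(i <- s) F i w) x.
Proof.
move=> h; elim: s => [|i s IH] e e0.
  by exists 1 => // w _; rewrite !big_nil subrr cabs0.
by have [a a0 ha] := contdD (h i) IH e0; exists a => // w /ha; rewrite !big_cons.
Qed.

End Continuity.

(** * Power series on the unit disc: continuity, products, basic examples *)

Section PowerSeries.
Variable R : realType.
Local Notation C := R[i].
Implicit Types (a b : nat -> C) (phi psi : C -> C) (z : C).

Definition ccont phi z := contd (fun w z : C => cabs (w - z)) phi z.

Lemma ccont_id z : ccont id z.
Proof. by move=> e e0; exists e. Qed.

Lemma holo_ccont (U : set C) phi z : holo_on U phi -> U z -> ccont phi z.
Proof.
move=> h /h[d hd] e e0; have [del del0 hdel] := hd 1 ltr01.
have K0 : 0 < cabs d + 1 by rewrite ltr_wpDl ?cabs_ge0.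
exists (Num.min del (e / (cabs d + 1))); first by rewrite lt_min del0 divr_gt0.
move=> w; rewrite lt_min => /andP[w1 w2].
have [->|wz] := eqVneq w z; first by rewrite subrr cabs0.
have wz0 : w - z != 0 by rewrite subr_eq0.
have /hdel h1 : 0 < cabs (w - z) < del by rewrite w1 cabs_gt0.
rewrite -(divfK wz0 (phi w - phi z)) cabsM.
have h2 : cabs ((phi w - phi z) / (w - z)) < cabs d + 1.
  rewrite -[X in cabs X](subrK d) (le_lt_trans (cabsD _ _))// addrC ltrD2l//.
apply: (le_lt_trans (ler_wpM2r (cabs_ge0 _) (ltW h2))).
by rewrite mulrC -ltr_pdivlMr.
Qed.

(** The point [z] is approached along the horizontal segment to its right. This fixes the value of a
    quotient at the point where the divisor vanishes. *)
Lemma ccont_uniq phi psi z : cdisc z -> ccont phi z -> ccont psi z ->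
  (forall w, cdisc w -> w != z -> phi w = psi w) -> phi z = psi z.
Proof.
move=> /cdiscP Dz h1 h2 h; apply/eqP; rewrite -subr_eq0; apply/negPn/negP => n0.
have e0 : 0 < cabs (phi z - psi z) / 2 by rewrite divr_gt0// cabs_gt0.
have [a a0 ha] := h1 _ e0; have [b b0 hb] := h2 _ e0.
pose r := Num.min (Num.min a b) (1 - cabs z) / 2.
have m0 : 0 < Num.min (Num.min a b) (1 - cabs z) by rewrite !lt_min a0 b0/= subr_gt0.
have r0 : 0 < r by rewrite divr_gt0.
have : r < Num.min (Num.min a b) (1 - cabs z) by rewrite /r; lra.
rewrite !lt_min -andbA => /and3P[ra rb rz].
pose w := z + Complex r 0.
have wz : w - z = Complex r 0 by rewrite /w addrAC subrr add0r.
have cwz : cabs (w - z) = r by rewrite wz cabs_real// ltW.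
have Dw : cdisc w.
  apply/cdiscP; rewrite -(subrK z w) (le_lt_trans (cabsD _ _))// cwz; lra.
have neq : w != z by rewrite -subr_eq0; apply: contraTneq r0 => w0; rewrite -cwz w0 cabs0 ltxx.
have A := ha w; have B := hb w; rewrite cwz in A B.
have := ltrD (A ra) (B rb); rewrite -splitr h// => hlt.
have := le_lt_trans (cabs_tri (psi w) (phi z) (psi z)).
by rewrite [cabs (phi z - psi w)]cabsC => /(_ _ hlt); rewrite ltxx.
Qed.

Definition is_ps a phi : Prop := forall z, cdisc z ->
  tends (fun N => \sum_(k < N) a k * z ^+ k) (phi z).

Definition has_ps phi : Prop := exists a, is_ps a phi.

Lemma eq_has_ps phi psi : (forall z, cdisc z -> phi z = psi z) -> has_ps phi -> has_ps psi.
Proof. by move=> h [a ha]; exists a => z Dz; rewrite -h//; exact: ha. Qed.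

(** A radius of convergence at least one, expressed by bounded terms instead of an upper limit; it
    can be checked directly on coefficients that are themselves sums of series. *)
Definition subexp a : Prop := forall r : R, 0 <= r -> r < 1 ->
  exists M : R, forall k, cabs (a k) * r ^+ k <= M.

Lemma tends_terms (u : nat -> C) S : tends (fun N => \sum_(k < N) u k) S -> tends u 0.
Proof.
move=> h; have := tendsB (tends_shift h) h; rewrite subrr.
by apply: tends_eq => m; rewrite big_ord_recr/= addrAC subrr add0r.
Qed.

Lemma ps_subexp a phi : is_ps a phi -> subexp a.
Proof.
move=> h r r0 r1.
have Dr : cdisc (Complex r 0 : C) by apply/cdiscP; rewrite cabs_real.
have [M hM] := tends_bound (tends_terms (u := fun k => a k * Complex r 0 ^+ k) (h _ Dr)); exists M => k.
by have := hM k; rewrite cabsM cabsX cabs_real.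
Qed.

(** If [cabs (a k) * s ^+ k] is bounded at the midpoint [s] of [t] and 1, the terms on [cabs z <= t]
    are dominated by a geometric sequence of ratio [t / s]. *)
Definition ratio (t : R) : R := t / ((1 + t) / 2).

Lemma ratio_ge0 t : 0 <= t -> 0 <= ratio t.
Proof. by move=> t0; rewrite /ratio divr_ge0//; lra. Qed.

Lemma ratio_lt1 t : 0 <= t -> t < 1 -> ratio t < 1.
Proof. by move=> t0 t1; rewrite /ratio ltr_pdivrMr; lra. Qed.

Lemma subexp_geom a t : subexp a -> 0 <= t -> t < 1 ->
  exists2 M : R, 0 <= M & forall z, cabs z <= t -> forall k, cabs (a k * z ^+ k) <= M * ratio t ^+ k.
Proof.
move=> h t0 t1; have s0 : 0 < (1 + t) / 2 by lra.
have [|M hM] := h _ (ltW s0); first by lra.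
exists M.
  by apply: le_trans (hM 0%N); rewrite expr0 mulr1 cabs_ge0.
move=> z zt k; rewrite cabsM cabsX.
apply: (@le_trans _ _ (cabs (a k) * t ^+ k)).
  by rewrite ler_wpM2l ?cabs_ge0// lerXn2r// nnegrE cabs_ge0.
have -> : t ^+ k = ((1 + t) / 2) ^+ k * ratio t ^+ k.
  by rewrite -exprMn /ratio mulrC divfK// gt_eqF.
by rewrite mulrA ler_wpM2r// exprn_ge0// ratio_ge0.
Qed.

Lemma subexp_has_sum a : subexp a -> exists phi, is_ps a phi.
Proof.
move=> h.
have /choice[phi hphi] : forall z, exists S, cdisc z ->
    tends (fun N => \sum_(k < N) a k * z ^+ k) S.
  move=> z; have [/cdiscP Dz|nDz] := pselect (cdisc z); last by exists 0.
  have [M _ hM] := subexp_geom h (cabs_ge0 z) Dz.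
  have [S hS] := geom_series (ratio_ge0 (cabs_ge0 z)) (ratio_lt1 (cabs_ge0 z) Dz) (hM z (lexx _)).
  by exists S.
by exists phi => z; exact: hphi.
Qed.

Lemma ps_tail a phi t : is_ps a phi -> 0 <= t -> t < 1 ->
  exists2 M : R, 0 <= M & forall z, cabs z <= t -> forall N,
    cabs (phi z - \sum_(k < N) a k * z ^+ k) <= M * ratio t ^+ N.
Proof.
move=> h t0 t1; have [M M0 hM] := subexp_geom (ps_subexp h) t0 t1.
have q1 := ratio_lt1 t0 t1; have q0 := ratio_ge0 t0.
exists (M / (1 - ratio t)); first by rewrite divr_ge0// subr_ge0 ltW.
move=> z zt N; rewrite mulrAC.
apply: (geom_tail q0 q1 (hM z zt)); apply: h.
by apply/cdiscP; exact: le_lt_trans t1.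
Qed.

Lemma ps_ccont a phi z : is_ps a phi -> cdisc z -> ccont phi z.
Proof.
move=> h /cdiscP Dz e e0.
(* The radius halfway between [cabs z] and 1 leaves room for a whole neighbourhood of [z] on which
   the tail is uniformly small. *)
pose t := (1 + cabs z) / 2; have z0 := cabs_ge0 z.
have t0 : 0 <= t by rewrite /t; lra.
have t1 : t < 1 by rewrite /t; lra.
have zt : cabs z <= t by rewrite /t; lra.
have [M M0 hM] := ps_tail h t0 t1.
have e3 : 0 < e / 3 by rewrite divr_gt0.
have /cvg0P/(_ _ e3)[N hN] := geom_cvg0 M (ratio_ge0 t0) (ratio_lt1 t0 t1).
have {hN} hN : M * ratio t ^+ N < e / 3 by rewrite (le_lt_trans (ler_norm _))// hN.
have c : ccont (fun w => \sum_(k < N) a k * w ^+ k) z.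
  by apply: contd_sum => k; apply/contdZ/contdX/ccont_id.
have [del del0 hdel] := c _ e3.
exists (Num.min del (t - cabs z)).
  by rewrite lt_min del0 /t; lra.
move=> w; rewrite lt_min => /andP[w1 w2].
have wt : cabs w <= t by rewrite -(subrK z w) (le_trans (cabsD _ _))//; lra.
have /le_lt_trans/(_ hN) A := hM _ wt N; have /le_lt_trans/(_ hN) B := hM _ zt N.
have D := hdel w w1.
set P := fun w : C => \sum_(k < N) a k * w ^+ k in A B D.
have -> : phi w - phi z = (phi w - P w) + (P w - P z) - (phi z - P z) by ring.
apply: (le_lt_trans (cabsB _ _)).
have := cabsD (phi w - P w) (P w - P z).
lra.
Qed.

Lemma is_psD a b phi psi : is_ps a phi -> is_ps b psi ->
  is_ps (fun k => a k + b k) (fun z => phi z + psi z).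
Proof.
move=> ha hb z Dz; apply: tends_eq (tendsD (ha z Dz) (hb z Dz)) => m.
by rewrite -big_split; apply: eq_bigr => k _; rewrite mulrDl.
Qed.

Lemma is_psZ c a phi : is_ps a phi -> is_ps (fun k => c * a k) (fun z => c * phi z).
Proof.
move=> ha z Dz; apply: tends_eq (tendsZ c (ha z Dz)) => m.
by rewrite mulr_sumr; apply: eq_bigr => k _; rewrite mulrA.
Qed.

Definition conv a b (k : nat) : C := \sum_(i < k.+1) a i * b (k - i)%N.

(** Both sides sum [u i * v j] over the triangle [i + j < N], by diagonals on the left and by rows
    on the right. *)
Lemma sum_conv (u v : nat -> C) N :
  \sum_(k < N) conv u v k = \sum_(i < N) u i * \sum_(j < N - i) v j.
Proof.
elim: N => [|N IH]; first by rewrite !big_ord0.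
rewrite big_ord_recr IH /= /conv [X in _ + X]big_ord_recr/= [RHS]big_ord_recr/=.
rewrite addrA subSnn subnn big_ord1; congr (_ + _).
rewrite -big_split; apply: eq_bigr => i _ /=.
by rewrite subSn 1?ltnW// big_ord_recr/= mulrDr.
Qed.

(** Replacing the inner partial sum of row [i] in [sum_conv] by its limit [psi z] costs at most
    [M * t ^+ i * (L * t ^+ (N - i))]. The [N] errors add up to a multiple of [N%:R * t ^+ N], which
    tends to zero. *)
Lemma is_psM a b phi psi : is_ps a phi -> is_ps b psi ->
  is_ps (conv a b) (fun z => phi z * psi z).
Proof.
move=> ha hb z Dz; have /cdiscP z1 := Dz; have z0 := cabs_ge0 z.
have [M M0 hM] := subexp_geom (ps_subexp ha) z0 z1.
have [L L0 hL] := ps_tail hb z0 z1.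
have q1 := ratio_lt1 z0 z1; have q0 := ratio_ge0 z0.
set t := ratio _ in hM hL q1 q0.
pose u k := a k * z ^+ k; pose v k := b k * z ^+ k.
have h1 : tends (fun N => \sum_(i < N) u i * (\sum_(j < N - i) v j - psi z)) 0.
  apply: (tends_squeeze _ (mul_geom_cvg0 (M * L) q0 q1)) => N.
  rewrite subr0 (le_trans (cabs_sum _ _ _))//.
  have -> : M * L * (N%:R * t ^+ N) = \sum_(i < N) M * L * t ^+ N.
    by rewrite sumr_const card_ord -mulr_natl; ring.
  apply: ler_sum => i _; rewrite cabsM cabsC.
  have iN : (i <= N)%N by exact: ltnW.
  have -> : t ^+ N = t ^+ i * t ^+ (N - i) by rewrite -exprD subnKC.
  rewrite mulrACA.
  by apply: ler_pM; rewrite ?cabs_ge0//; [exact: hM|exact: hL].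
have h2 := tendsZ (psi z) (ha z Dz).
have := tendsD h1 h2; rewrite add0r mulrC; apply: tends_eq => N.
rewrite mulr_sumr -big_split/=.
transitivity (\sum_(i < N) u i * \sum_(j < N - i) v j).
  by apply: eq_bigr => i _; rewrite /u; ring.
rewrite -sum_conv; apply: eq_bigr => k _.
rewrite /conv mulr_suml; apply: eq_bigr => i _; rewrite /u /v.
have ik : (i <= k)%N by rewrite -ltnS.
have -> : z ^+ k = z ^+ i * z ^+ (k - i) by rewrite -exprD subnKC.
ring.
Qed.

Lemma has_psD phi psi : has_ps phi -> has_ps psi -> has_ps (fun z => phi z + psi z).
Proof. by move=> [a ha] [b hb]; exists (fun k => a k + b k); exact: is_psD. Qed.

Lemma has_psZ c phi : has_ps phi -> has_ps (fun z => c * phi z).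
Proof. by move=> [a ha]; exists (fun k => c * a k); exact: is_psZ. Qed.

Lemma has_psM phi psi : has_ps phi -> has_ps psi -> has_ps (fun z => phi z * psi z).
Proof. by move=> [a ha] [b hb]; exists (conv a b); exact: is_psM. Qed.

Lemma is_ps_geom (c : C) : cabs c <= 1 -> is_ps (fun k => c ^+ k) (fun z => (1 - c * z)^-1).
Proof.
move=> c1 z /cdiscP z1.
have q1 : cabs (c * z) < 1.
  by rewrite cabsM (le_lt_trans _ z1)// ler_piMl ?cabs_ge0.
have n0 : 1 - c * z != 0.
  by apply: contraTneq q1 => /eqP; rewrite subr_eq0 => /eqP <-; rewrite cabs1 ltxx.
apply: (tends_squeeze _ (geom_cvg0 (cabs (1 - c * z)^-1) (cabs_ge0 _) q1)) => N.
have -> : \sum_(k < N) c ^+ k * z ^+ k = (1 - c * z)^-1 - (1 - c * z)^-1 * (c * z) ^+ N.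
  under eq_bigr do rewrite -exprMn.
  have := subrX1 (c * z) N; set S := \sum_(i < N) _ => hS.
  apply: (mulfI n0); rewrite mulrBr mulrA divff// mul1r -opprB mulNr -hS.
  by rewrite opprB.
by rewrite addrAC subrr add0r cabsN -cabsX -cabsM.
Qed.

Lemma is_ps_mono m : is_ps (fun k => (k == m)%:R) (fun z => z ^+ m).
Proof.
move=> z Dz e e0; exists m.+1 => N mN.
rewrite (bigD1 (Ordinal mN))//= eqxx mul1r big1 ?addr0 ?subrr ?cabs0//.
by move=> i /negPf; rewrite -val_eqE/= => ->; rewrite mul0r.
Qed.

Lemma has_ps_mono m : has_ps (fun z => z ^+ m).
Proof. by exists (fun k => (k == m)%:R); exact: is_ps_mono. Qed.

Lemma has_ps_cst (c : C) : has_ps (fun=> c).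
Proof.
have [a ha] : has_ps (fun z : C => c * z ^+ 0) by apply: has_psZ; exact: has_ps_mono.
by exists a => z Dz; have := ha z Dz; rewrite expr0 mulr1.
Qed.

Lemma has_ps_sum (I : Type) (s : seq I) (F : I -> C -> C) :
  (forall i, has_ps (F i)) -> has_ps (fun z => \sum_(i <- s) F i z).
Proof.
move=> h; elim: s => [|i s IH].
  by apply: eq_has_ps (has_ps_cst 0) => z _; rewrite big_nil.
by apply: eq_has_ps (has_psD (h i) IH) => z _; rewrite big_cons.
Qed.

Lemma has_ps_horner (p : {poly C}) : has_ps (fun z => p.[z]).
Proof.
apply: (@eq_has_ps (fun z => \sum_(i < size p) p`_i * z ^+ i)) => [z _|].
  by rewrite horner_coef.
by apply: has_ps_sum => i; apply: has_psZ; exact: has_ps_mono.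
Qed.

End PowerSeries.

(** * Division of a power series by a polynomial *)

Section Division.
Variable R : realType.
Local Notation C := R[i].
Implicit Types (a : C) (phi H : C -> C).

(** For a root off the open disc, [(z - a)^-1] is a multiple of a geometric series in [a^-1 * z],
    which converges on the whole disc even when [cabs a = 1]. *)
Lemma has_ps_div_linear_out a phi H : 1 <= cabs a -> has_ps H ->
  (forall z, cdisc z -> (z - a) * phi z = H z) -> has_ps phi.
Proof.
move=> a1 hH h.
have a0 : a != 0 by apply: contraTneq a1 => ->; rewrite cabs0 -ltNge ltr01.
have hg : has_ps (fun z => (1 - a^-1 * z)^-1).
  exists (fun k => a^-1 ^+ k); apply: is_ps_geom.
  by rewrite cabsV invf_le1// (lt_le_trans ltr01).
apply: eq_has_ps (has_psZ (- a^-1) (has_psM hg hH)) => z Dz.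
have /cdiscP z1 := Dz.
have za : z - a != 0.
  by rewrite subr_eq0; apply: contraTneq z1 => ->; rewrite -leNgt.
have n0 : 1 - a^-1 * z != 0.
  have -> : 1 - a^-1 * z = - a^-1 * (z - a) by field.
  by rewrite mulf_neq0// oppr_eq0 invr_eq0.
by rewrite -h//; field; rewrite a0/= -opprB oppr_eq0.
Qed.

(* The quotient has coefficients [b k = \sum_j h (k + 1 + j) * a ^+ j]. *)
Lemma has_ps_div_linear_in a phi H : cabs a < 1 -> has_ps H ->
  (forall z, cdisc z -> ccont phi z) ->
  (forall z, cdisc z -> (z - a) * phi z = H z) -> has_ps phi.
Proof.
move=> a1 [h hH] cphi hz; have Da : cdisc a by apply/cdiscP.
have Ha : H a = 0 by rewrite -hz// subrr mul0r.
have A0 := cabs_ge0 a.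
have sub (r : R) : cabs a < r -> r < 1 -> exists2 M : R, 0 <= M & forall k j,
    cabs (h (k.+1 + j)%N * a ^+ j) <= M / r ^+ k.+1 * (cabs a / r) ^+ j.
  move=> ar r1; have r0 : 0 < r by exact: le_lt_trans ar.
  have [M hM] := ps_subexp hH (ltW r0) r1.
  exists M => [|k j]; first by apply: le_trans (hM 0%N); rewrite expr0 mulr1 cabs_ge0.
  rewrite cabsM cabsX expr_div_n mulrA.
  have -> : M / r ^+ k.+1 * cabs a ^+ j / r ^+ j = M / r ^+ (k.+1 + j) * cabs a ^+ j.
    by rewrite exprD invfM; ring.
  by rewrite ler_wpM2r ?exprn_ge0// ler_pdivlMr ?exprn_gt0.
pose r0 := (1 + cabs a) / 2.
have r0a : cabs a < r0 by rewrite /r0; lra.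
have r01 : r0 < 1 by rewrite /r0; lra.
have quo (r : R) : cabs a < r -> 0 <= cabs a / r /\ cabs a / r < 1.
  move=> ar; have r00 : 0 < r by exact: le_lt_trans ar.
  by split; [rewrite divr_ge0// ltW|rewrite ltr_pdivrMr// mul1r].
have /choice[b hb] : forall k, exists S,
    tends (fun N => \sum_(j < N) h (k.+1 + j)%N * a ^+ j) S.
  move=> k; have [M _ hM] := sub _ r0a r01; have [q0 q1] := quo _ r0a.
  exact: (geom_series q0 q1 (hM k)).
(* [recb] and [recb0] say, coefficient by coefficient, that [z - a] times the series of the [b k] is
   the series of [H]; [recb0] is where [H a = 0] enters. *)
have recb k : a * b k.+1 = b k - h k.+1.
  apply: (@tends_unique _ (fun N => \sum_(j < N) h (k.+1 + j.+1)%N * a ^+ j.+1)).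
    apply: tends_eq (tendsZ a (hb k.+1)) => N.
    by rewrite mulr_sumr; apply: eq_bigr => j _; rewrite addSnnS exprS; ring.
  apply: tends_eq (tendsB (tends_shift (hb k)) (tends_cst (h k.+1))) => N.
  by rewrite big_ord_recl/= expr0 mulr1 addn0 addrAC subrr add0r.
have recb0 : a * b 0%N = - h 0%N.
  apply: (@tends_unique _ (fun N => \sum_(j < N) h j.+1 * a ^+ j.+1)).
    apply: tends_eq (tendsZ a (hb 0%N)) => N.
    by rewrite mulr_sumr; apply: eq_bigr => j _; rewrite add1n exprS; ring.
  have := tendsB (tends_shift (hH a Da)) (tends_cst (h 0%N)); rewrite Ha sub0r.
  apply: tends_eq => N.
  by rewrite big_ord_recl/= expr0 mulr1 addrAC subrr add0r.
have subb : subexp b.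
  (* The tail estimate takes a radius above [cabs a], and the bound on [cabs (b k) * r ^+ k] one
     that is at least [r]; [r2] serves both. *)
  move=> r rp r1; pose r2 := Num.max r r0.
  have ar2 : cabs a < r2 by rewrite lt_max r0a orbT.
  have r21 : r2 < 1 by rewrite gt_max r1 r01.
  have r20 : 0 < r2 by exact: le_lt_trans ar2.
  have [M M0 hM] := sub _ ar2 r21; have [q0 q1] := quo _ ar2.
  have D0 : 0 < 1 - cabs a / r2 by rewrite subr_gt0.
  exists (M / r2 / (1 - cabs a / r2)) => k.
  have := geom_tail q0 q1 (hM k) (hb k) 0%N.
  rewrite big_ord0 subr0 expr0 mulr1 => hk.
  apply: (@le_trans _ _ (cabs (b k) * r2 ^+ k)).
    by rewrite ler_wpM2l ?cabs_ge0// lerXn2r ?nnegrE ?(ltW r20)// le_max lexx.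
  apply: (le_trans (ler_wpM2r (exprn_ge0 k (ltW r20)) hk)).
  suff -> : M / r2 ^+ k.+1 / (1 - cabs a / r2) * r2 ^+ k = M / r2 / (1 - cabs a / r2) by [].
  have := lt0r_neq0 (exprn_gt0 k r20); rewrite exprSr; set y := r2 ^+ k => y0.
  by set E := (1 - _)^-1; field; rewrite y0 gt_eqF.
have [psi hpsi] := subexp_has_sum subb.
(* By the recurrences the product telescopes; the leftover [b N * z ^+ N * z] tends to zero, being
   [z] times a term of a convergent series. *)
have part z N : (z - a) * (\sum_(k < N.+1) b k * z ^+ k) =
    \sum_(k < N.+1) h k * z ^+ k + b N * z ^+ N * z.
  elim: N => [|N IH].
    by rewrite !big_ord1 !expr0 !mulr1 mulrBl recb0; ring.
  rewrite big_ord_recr/= mulrDr IH [in RHS]big_ord_recr/= !exprS.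
  have -> : b N = a * b N.+1 + h N.+1 by rewrite recb subrK.
  ring.
have hpsi2 z : cdisc z -> (z - a) * psi z = H z.
  move=> Dz; apply: (@tends_unique _ (fun N => (z - a) * (\sum_(k < N.+1) b k * z ^+ k))).
    exact: tendsZ (tends_shift (hpsi z Dz)).
  have h0 := tendsZ z (tends_terms (u := fun k => b k * z ^+ k) (hpsi z Dz)).
  have := tendsD (tends_shift (hH z Dz)) h0; rewrite mulr0 addr0.
  by apply: tends_eq => N; rewrite part; ring.
have off z : cdisc z -> z != a -> psi z = phi z.
  move=> Dz za; have za0 : z - a != 0 by rewrite subr_eq0.
  by apply: (mulfI za0); rewrite hpsi2// hz.
apply: (@eq_has_ps _ psi); last by exists b.
move=> z Dz; have [->|] := eqVneq z a; last exact: off.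
exact: (ccont_uniq Da (ps_ccont hpsi Da) (cphi a Da) off).
Qed.

(** The field is algebraically closed, so [p] splits into linear factors. They are removed one at a
    time, the remaining product staying inside the dividend; continuity of [phi] settles the roots
    in the disc. *)
Lemma has_ps_div_poly (p : {poly C}) phi : p != 0 ->
  (forall z, cdisc z -> ccont phi z) -> has_ps (fun z => p.[z] * phi z) -> has_ps phi.
Proof.
move=> p0; have [s ps] := closed_field_poly_normal p.
have l0 : lead_coef p != 0 by rewrite lead_coef_eq0.
move=> c hp.
have {hp} : has_ps (fun z => (\prod_(a <- s) ('X - a%:P)).[z] * phi z).
  apply: eq_has_ps (has_psZ (lead_coef p)^-1 hp) => z _.
  have -> : p.[z] = lead_coef p * (\prod_(a <- s) ('X - a%:P)).[z].
    by rewrite {1}ps hornerZ.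
  by rewrite !mulrA mulVf// mul1r.
elim: s {ps} phi c => [|a s IH] phi c.
  by apply: eq_has_ps => z _; rewrite big_nil hornerC mul1r.
move=> h; apply: IH => //.
set psi := fun z => _.
have cpsi z : cdisc z -> ccont psi z.
  move=> Dz; apply: contdM; last exact: c.
  by have [q hq] := has_ps_horner (\prod_(j <- s) ('X - j%:P)); exact: ps_ccont hq Dz.
have e z : cdisc z -> (z - a) * psi z = (\prod_(a <- a :: s) ('X - a%:P)).[z] * phi z.
  by move=> Dz; rewrite big_cons hornerM hornerXsubC mulrA.
have [a1|a1] := ltP (cabs a) 1.
  exact: has_ps_div_linear_in a1 h cpsi e.
exact: has_ps_div_linear_out a1 h e.
Qed.

End Division.

(** * Means over a period and orthogonality of exponentials *)

Section Mean.
Variable R : realType.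
Local Notation C := R[i].
Local Notation mu := (@lebesgue_measure R).
Implicit Types (h g : R -> C).

Definition tcont h : Prop := forall t, contd (fun s t : R => `|s - t|) h t.

Definition rmean (u : R -> R) : R :=
  (2 * pi)^-1 * Rintegral mu `[0, 2 * pi]%classic u.

Definition cmean h : C :=
  Complex (rmean (fun t => complex.Re (h t))) (rmean (fun t => complex.Im (h t))).

Let pi2_gt0 : 0 < 2 * pi :> R.
Proof. by rewrite mulr_gt0// pi_gt0. Qed.

Lemma tcont_real (u : R -> R) h : tcont h ->
  (forall s t, `|u s - u t| <= cabs (h s - h t)) -> continuous u.
Proof.
move=> ch uh t; apply/cvgrPdist_lt => e e0.
have [del del0 hdel] := ch t e e0.
near=> s; rewrite distrC (le_lt_trans (uh _ _))//; apply: hdel.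
near: s; have := @nbhsx_ballx _ _ t _ del0.
by apply: filterS => s /=; rewrite /ball/= distrC.
Unshelve. all: by end_near. Qed.

Lemma tcont_Re h : tcont h -> continuous (fun t => complex.Re (h t)).
Proof. by move=> ch; apply: (tcont_real ch) => s t; rewrite -ReN -ReD Re_le_cabs. Qed.

Lemma tcont_Im h : tcont h -> continuous (fun t => complex.Im (h t)).
Proof. by move=> ch; apply: (tcont_real ch) => s t; rewrite -ImN -ImD Im_le_cabs. Qed.

Lemma cont_integrable (u : R -> R) a b : continuous u ->
  mu.-integrable `[a, b] (EFin \o u).
Proof.
move=> cu; apply: continuous_compact_integrable; first exact: segment_compact.
exact: continuous_subspaceT.
Qed.

Let mI : measurable (`[0, 2 * pi]%classic : set R).
Proof. exact: measurable_itv. Qed.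

Lemma rmeanD (u v : R -> R) : continuous u -> continuous v ->
  rmean (fun t => u t + v t) = rmean u + rmean v.
Proof.
by move=> cu cv; rewrite /rmean RintegralD ?mulrDr//; exact: cont_integrable.
Qed.

Lemma rmeanZ (k : R) (u : R -> R) : continuous u -> rmean (fun t => k * u t) = k * rmean u.
Proof.
by move=> cu; rewrite /rmean RintegralZl// 1?mulrCA//; exact: cont_integrable.
Qed.

Lemma rmean_le (u v : R -> R) : continuous u -> continuous v ->
  (forall t, u t <= v t) -> rmean u <= rmean v.
Proof.
move=> cu cv uv; rewrite /rmean ler_wpM2l ?invr_ge0 ?(ltW pi2_gt0)//.
by apply: le_Rintegral => //; exact: cont_integrable.
Qed.

Lemma rmean_cst (k : R) : rmean (fun=> k) = k.
Proof.
rewrite /rmean Rintegral_cst//= lebesgue_measure_itv/= lte_fin pi2_gt0/=.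
by rewrite oppr0 addr0 mulrCA mulVf ?mulr1// gt_eqF.
Qed.

Lemma cmeanD h g : tcont h -> tcont g -> cmean (fun t => h t + g t) = cmean h + cmean g.
Proof.
move=> ch cg; apply: eqC; rewrite ?ReD ?ImD /=.
  rewrite -rmeanD; [|exact: tcont_Re|exact: tcont_Re].
  by congr rmean; apply/funext => t; rewrite ReD.
rewrite -rmeanD; [|exact: tcont_Im|exact: tcont_Im].
by congr rmean; apply/funext => t; rewrite ImD.
Qed.

Lemma cmeanZ (k : C) h : tcont h -> cmean (fun t => k * h t) = k * cmean h.
Proof.
move=> ch; have c1 := tcont_Re ch; have c2 := tcont_Im ch.
have sc (x : R) u : continuous u -> continuous (fun t : R => x * u t).
  by move=> cu t; apply: cvgMr; exact: cu.
apply: eqC; rewrite ?ReM ?ImM /=.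
  rewrite -!rmeanZ// -mulN1r -rmeanZ; last exact: sc.
  rewrite -rmeanD; [|exact: sc|by apply: (sc); exact: sc].
  by congr rmean; apply/funext => t; rewrite ReM mulN1r.
rewrite -!rmeanZ// -rmeanD; [|exact: sc|exact: sc].
by congr rmean; apply/funext => t; rewrite ImM.
Qed.

Lemma cmean_cst (k : C) : cmean (fun=> k) = k.
Proof. by rewrite /cmean !rmean_cst; case: k. Qed.

Lemma cmeanB h g : tcont h -> tcont g -> cmean (fun t => h t - g t) = cmean h - cmean g.
Proof.
move=> ch cg; rewrite -mulN1r -cmeanZ// -cmeanD//; last by move=> t; exact: contdZ.
by congr cmean; apply/funext => t; rewrite mulN1r.
Qed.

Lemma cmean_conj h : tcont h -> cmean (fun t => conjc (h t)) = conjc (cmean h).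
Proof.
move=> ch; apply: eqC; rewrite ?Re_conj ?Im_conj /=.
  by congr rmean; apply/funext => t; rewrite Re_conj.
rewrite -mulN1r -rmeanZ; last exact: tcont_Im.
by congr rmean; apply/funext => t; rewrite Im_conj mulN1r.
Qed.

Lemma cmean_sum (I : Type) (s : seq I) (F : I -> R -> C) : (forall i, tcont (F i)) ->
  cmean (fun t => \sum_(i <- s) F i t) = \sum_(i <- s) cmean (F i).
Proof.
move=> ch; elim: s => [|i s IH].
  by rewrite big_nil -[RHS]cmean_cst; congr cmean; apply/funext => t; rewrite big_nil.
rewrite big_cons -IH -cmeanD//; last by move=> t; apply: contd_sum => j; exact: ch.
by congr cmean; apply/funext => t; rewrite big_cons.
Qed.

Lemma cmean_Re_le h g : tcont h -> tcont g ->
  (forall t, complex.Re (h t) <= complex.Re (g t)) ->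
  complex.Re (cmean h) <= complex.Re (cmean g).
Proof. by move=> ch cg hg; apply: rmean_le => //; exact: tcont_Re. Qed.

(** The factor 2 comes from bounding the real and imaginary parts separately; every use tolerates a
    constant. *)
Lemma cmean_le h (u : R -> R) : tcont h -> continuous u ->
  (forall t, cabs (h t) <= u t) -> cabs (cmean h) <= 2 * rmean u.
Proof.
move=> ch cu hu; apply: (le_trans (cabs_le_ReIm _)).
have aux (v : R -> R) : continuous v -> (forall t, `|v t| <= u t) -> `|rmean v| <= rmean u.
  move=> cv vu; rewrite ler_norml; apply/andP; split.
    rewrite -mulN1r -rmeanZ//; apply: rmean_le => //.
      by move=> t; apply: cvgMr; exact: cu.
    by move=> t; rewrite mulN1r; have := vu t; rewrite ler_norml => /andP[].
  by apply: rmean_le => // t; exact: le_trans (ler_norm _) (vu t).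
rewrite mulr_natl mulr2n; apply: lerD => /=; apply: aux.
- exact: tcont_Re.
- by move=> t; exact: le_trans (Re_le_cabs _) (hu t).
- exact: tcont_Im.
- by move=> t; exact: le_trans (Im_le_cabs _) (hu t).
Qed.

Lemma cmean_le_cst h (M : R) : tcont h -> (forall t, cabs (h t) <= M) ->
  cabs (cmean h) <= 2 * M.
Proof.
move=> ch hM; rewrite -[M]rmean_cst; apply: cmean_le => //.
by move=> t; exact: cvg_cst.
Qed.

Lemma cexpiX (t : R) n : cexpi t ^+ n = cexpi (n%:R * t).
Proof.
elim: n => [|n IH]; first by rewrite expr0 mul0r cexpi0.
by rewrite exprS IH -cexpiD -[n.+1]addn1 natrD mulrDl mul1r addrC.
Qed.

Lemma tcont_expi : tcont (@cexpi R).
Proof.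
move=> t e e0.
have e2 : 0 < e / 2 by rewrite divr_gt0.
have := (@continuous_cos R t); move/cvgrPdist_lt/(_ _ e2)/nbhs_ballP => [a /= a0 ha].
have := (@continuous_sin R t); move/cvgrPdist_lt/(_ _ e2)/nbhs_ballP => [b /= b0 hb].
exists (Num.min a b); first by rewrite lt_min a0.
move=> s; rewrite lt_min => /andP[sa sb].
apply: (le_lt_trans (cabs_le_ReIm _)); rewrite /= (splitr e) ltrD//.
  by rewrite distrC; apply: ha; rewrite /ball/= distrC.
by rewrite distrC; apply: hb; rewrite /ball/= distrC.
Qed.

Lemma tcont_circle (phi : C -> C) (r : R) : 0 <= r ->
  (forall z, cabs z = r -> ccont phi z) ->
  tcont (fun t => phi (Complex r 0 * cexpi t)).
Proof.
move=> r0 c t e e0; have [d d0 hd] := c _ (cabs_polar t r0) e e0.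
have [b b0 hb] := contdZ (Complex r 0) (tcont_expi t) d0.
by exists b => // s /hb /hd.
Qed.

Lemma rmean_deriv (u F : R -> R) : continuous u ->
  (forall t : R, is_derive t 1 F (u t)) -> F (2 * pi) = F 0 -> rmean u = 0.
Proof.
move=> cu dF F0; rewrite /rmean /Rintegral (@continuous_FTC2 _ u F) //=.
- by rewrite F0 subrr mulr0.
- exact: continuous_subspaceT.
- have cF : continuous F.
    by move=> t; apply: differentiable_continuous; apply/derivable1_diffP; exact: ex_derive.
  split=> [t _||]; first exact: ex_derive.
    by apply: cvg_at_right_filter; exact: cF.
  by apply: cvg_at_left_filter; exact: cF.
- by move=> t _; rewrite derive1E; exact: derive_val.
Qed.

Lemma cos_2pi_nat n : cos (n%:R * (2 * pi)) = 1 :> R.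
Proof.
elim: n => [|n IH]; first by rewrite mul0r cos0.
rewrite -[n.+1]addn1 natrD mulrDl mul1r cosD IH.
by rewrite !mulr_natl cos2pi sin2pi mulr0 subr0 mulr1.
Qed.

Lemma sin_2pi_nat n : sin (n%:R * (2 * pi)) = 0 :> R.
Proof.
elim: n => [|n IH]; first by rewrite mul0r sin0.
by rewrite -[n.+1]addn1 natrD mulrDl mul1r sinD IH cos_2pi_nat mul0r mul1r add0r mulr_natl sin2pi.
Qed.

(** For nonzero [k] the real and imaginary parts have the periodic primitives sin(kt)/k and
    -cos(kt)/k. *)
Lemma cmean_expiX k : cmean (fun t => cexpi t ^+ k) = (k == 0%N)%:R.
Proof.
have [->|k0] := eqVneq k 0%N.
  by rewrite -[RHS]cmean_cst; congr cmean; apply/funext => t; rewrite expr0.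
have kR : (k%:R : R) != 0 by rewrite pnatr_eq0.
under [X in cmean X]funext => t do rewrite cexpiX.
have cc : tcont (fun t => cexpi (k%:R * t) : C).
  by move=> t e e0; have [a a0 ha] := contdX k (tcont_expi t) e0; exists a => // s /ha;
    rewrite !cexpiX.
apply: eqC => /=.
  apply: (@rmean_deriv _ (fun t => k%:R^-1 * sin (k%:R * t))).
  - exact: (tcont_Re cc).
  - move=> t; apply: is_derive_eq; rewrite /= !scaler1 ?scaler0 ?addr0.
    by rewrite -[_ *: _]/(_ * _); field.
  - by rewrite sin_2pi_nat !mulr0 sin0 mulr0.
apply: (@rmean_deriv _ (fun t => - k%:R^-1 * cos (k%:R * t))).
- exact: (tcont_Im cc).
- move=> t; apply: is_derive_eq; rewrite /= !scaler1 ?scaler0 ?addr0.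
  by rewrite -[_ *: _]/(_ * _); field.
- by rewrite cos_2pi_nat mulr0 cos0.
Qed.

(** Dominated convergence for the real and imaginary parts, with the constant [M] as majorant.
    Through it, almost everywhere information on the circle reaches the means. *)
Lemma cmean_dominated (h : nat -> R -> C) (M : R) : (forall m, tcont (h m)) ->
  (forall m t, cabs (h m t) <= M) ->
  {ae mu, forall t, tends (h ^~ t) 0} -> tends (fun m => cmean (h m)) 0.
Proof.
move=> ch hM h0.
have aux (u : nat -> R -> R) : (forall m, continuous (u m)) ->
    (forall m t, `|u m t| <= cabs (h m t)) -> (fun m => rmean (u m)) @ \oo --> (0 : R).
  move=> cu uh.
  have i0 : mu.-integrable `[0, 2 * pi] (EFin \o (fun=> M)).
    by apply: cont_integrable => t; exact: cvg_cst.
  have [||||_ _] := @dominated_convergence _ _ _ mu `[0, 2 * pi]%classic mI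
     (fun m => EFin \o u m) (cst 0%E) (EFin \o (fun=> M)) _ _ _ i0.
  - by move=> m; exact: measurable_int (cont_integrable _ _ (cu m)).
  - exact: measurable_cst.
  - have [N [mN N0 sN]] := h0; exists N; split=> // t /= nt; apply: sN => /= ht; apply: nt => _.
    apply: cvg_EFin; first by near=> m.
    apply/cvg0P => e e0; have [K hK] := ht e e0; exists K => m /hK.
    by rewrite subr0; exact: le_lt_trans (uh m t).
  - by apply: (@aeW _ _ _ mu) => t m _ /=; rewrite lee_fin (le_trans (uh _ _)).
  rewrite integral0 => /fine_cvgP[_ cv].
  rewrite -[X in _ --> X](mulr0 (2 * pi)^-1); apply: cvgMr.
  exact: cv.
apply: tends_ReIm => /=; apply: aux.
- by move=> m; exact: tcont_Re.
- by move=> m t; exact: Re_le_cabs.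
- by move=> m; exact: tcont_Im.
- by move=> m t; exact: Im_le_cabs.
Unshelve. all: by end_near. Qed.

End Mean.

(** * Means over circles inside the disc; Parseval and Bessel *)

Section CircleMean.
Variable R : realType.
Local Notation C := R[i].
Implicit Types (phi psi h g : C -> C) (a : nat -> C) (r : R) (z l : C).

Definition dcont phi : Prop := forall z, cdisc z -> ccont phi z.

Definition cm r phi : C := cmean (fun t => phi (Complex r 0 * cexpi t)).

Lemma dcont_cst (c : C) : dcont (fun=> c).
Proof. by move=> z _; exact: contd_cst. Qed.
Lemma dcontD phi psi : dcont phi -> dcont psi -> dcont (fun z => phi z + psi z).
Proof. by move=> h1 h2 z Dz; apply: contdD; [exact: h1|exact: h2]. Qed.
Lemma dcontN phi : dcont phi -> dcont (fun z => - phi z).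
Proof. by move=> h1 z Dz; apply: contdN; exact: h1. Qed.
Lemma dcontB phi psi : dcont phi -> dcont psi -> dcont (fun z => phi z - psi z).
Proof. by move=> h1 h2; apply: dcontD => //; exact: dcontN. Qed.
Lemma dcontM phi psi : dcont phi -> dcont psi -> dcont (fun z => phi z * psi z).
Proof. by move=> h1 h2 z Dz; apply: contdM; [exact: h1|exact: h2]. Qed.
Lemma dcontZ (c : C) phi : dcont phi -> dcont (fun z => c * phi z).
Proof. by move=> h1 z Dz; apply: contdZ; exact: h1. Qed.
Lemma dcont_conj phi : dcont phi -> dcont (fun z => conjc (phi z)).
Proof. by move=> h1 z Dz; apply: contd_conj; exact: h1. Qed.
Lemma dcont_sum (I : Type) (s : seq I) (F : I -> C -> C) :
  (forall i, dcont (F i)) -> dcont (fun z => \sum_(i <- s) F i z).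
Proof. by move=> h z Dz; apply: contd_sum => i; exact: h. Qed.
Lemma dcontX n : dcont (fun z => z ^+ n).
Proof. by move=> z _; apply: contdX; exact: ccont_id. Qed.
Lemma has_ps_dcont phi : has_ps phi -> dcont phi.
Proof. by move=> [a ha] z Dz; exact: ps_ccont ha Dz. Qed.

Section FixedRadius.
Variable r : R.
Hypotheses (r0 : 0 <= r) (r1 : r < 1).

Lemma circle_disc z : cabs z = r -> cdisc z.
Proof. by move=> zr; apply/cdiscP; rewrite zr. Qed.

Lemma dcont_tcont phi : dcont phi -> tcont (fun t => phi (Complex r 0 * cexpi t)).
Proof. by move=> c; apply: tcont_circle => // z zr; apply: c; exact: circle_disc. Qed.

Lemma polar_disc (t : R) : cdisc (Complex r 0 * cexpi t).
Proof. by apply: circle_disc; exact: cabs_polar. Qed.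

Lemma eq_cm phi psi : (forall z, cdisc z -> phi z = psi z) -> cm r phi = cm r psi.
Proof.
by move=> h; congr cmean; apply/funext => t; apply: h; exact: polar_disc.
Qed.

Lemma cmD phi psi : dcont phi -> dcont psi ->
  cm r (fun z => phi z + psi z) = cm r phi + cm r psi.
Proof. by move=> h1 h2; apply: cmeanD; exact: dcont_tcont. Qed.

Lemma cmB phi psi : dcont phi -> dcont psi ->
  cm r (fun z => phi z - psi z) = cm r phi - cm r psi.
Proof. by move=> h1 h2; apply: cmeanB; exact: dcont_tcont. Qed.

Lemma cmZ (c : C) phi : dcont phi -> cm r (fun z => c * phi z) = c * cm r phi.
Proof. by move=> h1; apply: cmeanZ; exact: dcont_tcont. Qed.

Lemma cm_conj phi : dcont phi -> cm r (fun z => conjc (phi z)) = conjc (cm r phi).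
Proof. by move=> h1; apply: cmean_conj; exact: dcont_tcont. Qed.

Lemma cm_sum (I : Type) (s : seq I) (F : I -> C -> C) : (forall i, dcont (F i)) ->
  cm r (fun z => \sum_(i <- s) F i z) = \sum_(i <- s) cm r (F i).
Proof. by move=> h1; apply: cmean_sum => i; exact: dcont_tcont. Qed.

Lemma cm_Re_le phi psi : dcont phi -> dcont psi ->
  (forall z, cdisc z -> complex.Re (phi z) <= complex.Re (psi z)) ->
  complex.Re (cm r phi) <= complex.Re (cm r psi).
Proof.
move=> h1 h2 h; apply: cmean_Re_le => [||t]; [exact: dcont_tcont..|].
by apply: h; exact: polar_disc.
Qed.

Lemma cm_le phi (M : R) : dcont phi -> (forall z, cabs z = r -> cabs (phi z) <= M) ->
  cabs (cm r phi) <= 2 * M.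
Proof.
move=> h1 h; apply: cmean_le_cst => [|t]; first exact: dcont_tcont.
by apply: h; exact: cabs_polar.
Qed.

Lemma cm_cst (c : C) : cm r (fun=> c) = c.
Proof. exact: cmean_cst. Qed.

Lemma cm_mono j k : cm r (fun z => z ^+ k * conjc (z ^+ j)) =
  (k == j)%:R * Complex r 0 ^+ (2 * k).
Proof.
have cj (t : R) : conjc (Complex r 0 * cexpi t) = Complex r 0 * conjc (cexpi t).
  by rewrite conjM/= oppr0.
have e1 (t : R) : cexpi t * conjc (cexpi t) = 1 :> C.
  by rewrite mul_conj cabs_expi expr1n.
(* For [q <= p] the integrand is a constant times [cexpi t ^+ (p - q)]; the other case is obtained
   by conjugation. *)
have ge p q : (q <= p)%N -> cm r (fun z => z ^+ p * conjc (z ^+ q)) =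
    (p == q)%:R * Complex r 0 ^+ (2 * p).
  move=> qp; rewrite /cm.
  have -> : (fun t => (Complex r 0 * cexpi t) ^+ p * conjc ((Complex r 0 * cexpi t) ^+ q))
      = (fun t => Complex r 0 ^+ (p + q) * cexpi t ^+ (p - q) :> C).
    apply/funext => t; rewrite conjX cj !exprMn.
    have -> : cexpi t ^+ p = cexpi t ^+ (p - q) * cexpi t ^+ q :> C.
      by rewrite -exprD subnK.
    have e2 : cexpi t ^+ q * conjc (cexpi t) ^+ q = 1 :> C by rewrite -exprMn e1 expr1n.
    by rewrite exprD -[RHS]mulr1 -e2; ring.
  rewrite cmeanZ; last by move=> t; apply: contdX; exact: tcont_expi.
  rewrite cmean_expiX subn_eq0.
  have [->|pq] := eqVneq p q; first by rewrite leqnn addnn mul2n mulrC.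
  by rewrite leqNgt ltn_neqAle eq_sym pq qp/= mulr0 mul0r.
have [|kj] := leqP j k; first exact: ge.
have := ge j k (ltnW kj) => /(congr1 (@conjc R)).
rewrite -cm_conj; last by apply: dcontM; [exact: dcontX|apply/dcont_conj/dcontX].
rewrite (gtn_eqF kj) (ltn_eqF kj) !mul0r conjc0.
by move=> <-; apply: eq_cm => z _; rewrite conjM conjcK mulrC.
Qed.

(** The partial sums converge uniformly on the circle of radius [r], and their mean against
    [conjc (z ^+ k)] is constant once they contain the term of index [k]. *)
Lemma cm_coef a phi k : is_ps a phi ->
  cm r (fun z => phi z * conjc (z ^+ k)) = a k * Complex r 0 ^+ (2 * k).
Proof.
move=> ha; have cphi : dcont phi by apply: has_ps_dcont; exists a.
have cX : dcont (fun z => conjc (z ^+ k)) by apply/dcont_conj/dcontX.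
have [M M0 hM] := ps_tail ha r0 r1.
pose S N z := \sum_(i < N) a i * z ^+ i.
have cS N : dcont (S N) by apply: dcont_sum => i; apply/dcontZ/dcontX.
apply: (@tends_unique _ (fun N => cm r (fun z => S N z * conjc (z ^+ k)))).
  apply: (tends_squeeze _ (geom_cvg0 (2 * M) (ratio_ge0 r0) (ratio_lt1 r0 r1))) => N.
  rewrite -cmB; [|exact: dcontM..].
  rewrite -mulrA; apply: cm_le => [|z zr]; first by apply: dcontB; exact: dcontM.
  rewrite -mulrBl cabsM cabs_conj cabsX cabsC.
  apply: (@le_trans _ _ (cabs (phi z - S N z))); last by apply: hM; rewrite zr.
  by rewrite ler_piMr ?cabs_ge0// exprn_ile1 ?cabs_ge0// zr ltW.
move=> e e0; exists k.+1 => N kN.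
rewrite (_ : cm _ _ = a k * Complex r 0 ^+ (2 * k)) ?subrr ?cabs0//.
rewrite (@eq_cm _ (fun z => \sum_(i < N) a i * (z ^+ i * conjc (z ^+ k)))); last first.
  by move=> z _; rewrite /S mulr_suml; apply: eq_bigr => i _; rewrite mulrA.
rewrite cm_sum; last first.
  by move=> i; apply: dcontZ; apply: dcontM => //; exact: dcontX.
rewrite (eq_bigr (fun i : 'I_N => a i * ((i == k :> nat)%:R * Complex r 0 ^+ (2 * i)))).
  rewrite (bigD1 (Ordinal kN))//= eqxx mul1r big1 ?addr0// => i.
  by rewrite -val_eqE/= => /negPf ->; rewrite mul0r mulr0.
move=> i _; rewrite cmZ ?cm_mono//.
by apply: dcontM => //; exact: dcontX.
Qed.

Definition sq phi z : C := phi z * conjc (phi z).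

Lemma dcont_sq phi : dcont phi -> dcont (sq phi).
Proof. by move=> h; apply: dcontM => //; exact: dcont_conj. Qed.

Lemma Re_sq phi z : complex.Re (sq phi z) = cabs (phi z) ^+ 2.
Proof. by rewrite /sq mul_conj. Qed.

Lemma Re_cm_sq_ge0 phi : dcont phi -> 0 <= complex.Re (cm r (sq phi)).
Proof.
move=> c; have := @cm_Re_le (fun=> 0) (sq phi); rewrite cm_cst; apply.
- exact: dcont_cst.
- exact: dcont_sq.
- by move=> z _; rewrite Re_sq sqr_ge0.
Qed.

(** Pythagoras: [phi] and its partial sum [S] share their first [N] coefficients, hence have the
    same mean against [S], so [phi - S] is orthogonal to [S]. *)
Lemma parseval_partial a phi N : is_ps a phi ->
  complex.Re (cm r (sq phi)) = \sum_(k < N) cabs (a k) ^+ 2 * r ^+ (2 * k)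
    + complex.Re (cm r (sq (fun z => phi z - \sum_(k < N) a k * z ^+ k))).
Proof.
move=> ha; have cphi : dcont phi by apply: has_ps_dcont; exists a.
pose S z := \sum_(i < N) a i * z ^+ i.
have cX k : dcont (fun z => conjc (z ^+ k)) by apply/dcont_conj/dcontX.
have cS : dcont S by apply: dcont_sum => i; apply/dcontZ/dcontX.
have cd : dcont (fun z => phi z - S z) by exact: dcontB.
have ccS : dcont (fun z => conjc (S z)) by exact: dcont_conj.
have ortho g b : is_ps b g -> cm r (fun z => g z * conjc (S z)) =
    \sum_(k < N) conjc (a k) * (b k * Complex r 0 ^+ (2 * k)).
  move=> hb; have cg : dcont g by apply: has_ps_dcont; exists b.
  rewrite (@eq_cm _ (fun z => \sum_(k < N) conjc (a k) * (g z * conjc (z ^+ k)))).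
    rewrite cm_sum => [|i]; last by apply: dcontZ; exact: dcontM.
    by apply: eq_bigr => k _; rewrite cmZ ?(cm_coef _ hb)//; exact: dcontM.
  move=> z _; rewrite /S conj_sum mulr_sumr; apply: eq_bigr => k _.
  by rewrite conjM; ring.
(* The truncation is itself a power series, so [ortho] applies to it as well as to [phi]. *)
have psS : is_ps (fun k => (k < N)%N%:R * a k) S.
  move=> z Dz e e0; exists N => K NK.
  rewrite (_ : \sum_(k < K) _ = S z) ?subrr ?cabs0//.
  rewrite /S (big_ord_widen K (fun i => a i * z ^+ i) NK) [RHS]big_mkcond/=.
  by apply: eq_bigr => i _; case: ifP => _; rewrite ?mul1r ?mul0r.
have zero : cm r (fun z => (phi z - S z) * conjc (S z)) = 0.
  rewrite (@eq_cm _ (fun z => phi z * conjc (S z) - S z * conjc (S z))); last first.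
    by move=> z _; rewrite mulrBl.
  rewrite cmB; [|exact: dcontM..].
  rewrite (ortho _ _ ha) (ortho _ _ psS) -sumrB big1// => i _.
  by rewrite ltn_ord mul1r subrr.
rewrite (@eq_cm _ (fun z => phi z * conjc (S z) +
   (conjc ((phi z - S z) * conjc (S z)) + sq (fun z => phi z - S z) z))); last first.
  by move=> z _; rewrite /sq conjM conjcK conjB; ring.
have cz : dcont (fun z => (phi z - S z) * conjc (S z)) by exact: dcontM.
rewrite cmD; [|exact: dcontM|by apply: dcontD; [exact: dcont_conj|exact: dcont_sq]].
rewrite cmD; [|exact: dcont_conj|exact: dcont_sq].
rewrite cm_conj// zero conjc0 add0r ReD (ortho _ _ ha); congr (_ + _).
rewrite Re_sum; apply: eq_bigr => k _.
rewrite mulrA [conjc _ * _]mulrC mul_conj -(rmorphXn (real_complex R)).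
by rewrite ReM/= mul0r subr0.
Qed.

Lemma bessel a phi N : is_ps a phi ->
  \sum_(k < N) cabs (a k) ^+ 2 * r ^+ (2 * k) <= complex.Re (cm r (sq phi)).
Proof.
move=> ha; rewrite (parseval_partial N ha) lerDl Re_cm_sq_ge0//.
apply: dcontB; first by apply: has_ps_dcont; exists a.
by apply: dcont_sum => i; apply/dcontZ/dcontX.
Qed.

(** The remainder in [parseval_partial] is the mean of a squared tail, which decays geometrically in
    [N] on a fixed circle. *)
Lemma parseval_le a phi (S : R) : is_ps a phi ->
  (forall N, \sum_(k < N) cabs (a k) ^+ 2 <= S) -> complex.Re (cm r (sq phi)) <= S.
Proof.
move=> ha hS; have [M M0 hM] := ps_tail ha r0 r1.
have q0 := ratio_ge0 r0; have q1 := ratio_lt1 r0 r1.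
have cphi : dcont phi by apply: has_ps_dcont; exists a.
have hN N : complex.Re (cm r (sq phi)) - S <= 2 * M ^+ 2 * ratio r ^+ N.
  rewrite lerBlDr (parseval_partial N ha) addrC; apply: lerD; last first.
    apply: le_trans (hS N); apply: ler_sum => k _.
    by rewrite ler_piMr ?sqr_ge0// exprn_ile1// ltW.
  apply: (le_trans (ler_norm _)); apply: (le_trans (Re_le_cabs _)).
  rewrite -mulrA; apply: cm_le => [|z zr].
    apply/dcont_sq/dcontB => //.
    by apply: dcont_sum => i; apply/dcontZ/dcontX.
  have h := hM z _ N; rewrite zr lexx in h; have {}h := h isT.
  rewrite /sq cabsM cabs_conj -expr2.
  apply: (@le_trans _ _ ((M * ratio r ^+ N) ^+ 2)).
    by rewrite lerXn2r// nnegrE ?cabs_ge0// mulr_ge0// exprn_ge0.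
  rewrite exprMn ler_wpM2l ?sqr_ge0// expr2 ler_piMr ?exprn_ge0//.
  by rewrite exprn_ile1// ltW.
rewrite leNgt; apply/negP => hlt.
have d0 : 0 < complex.Re (cm r (sq phi)) - S by rewrite subr_gt0.
have /cvg0P/(_ _ d0)[N /(_ N (leqnn _))] := geom_cvg0 (2 * M ^+ 2) q0 q1.
by rewrite ltNge (le_trans (hN N))// ler_norm.
Qed.

End FixedRadius.
End CircleMean.

(** * Limits of means as the radius tends to one; density of Szego kernels *)

Section RadialLimit.
Variable R : realType.
Local Notation C := R[i].
Implicit Types (phi psi h g u : C -> C) (a : nat -> C) (z l : C).

(** Radii 1/2, 2/3, 3/4 and so on: a sequence rather than a continuous radius, since dominated
    convergence is applied along sequences. *)
Definition rr (m : nat) : R := 1 - (m.+2)%:R^-1.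

Lemma rr_ge0 m : 0 <= rr m.
Proof. by rewrite subr_ge0 invf_le1 ?ler1n ?ltr0n. Qed.

Lemma rr_lt1 m : rr m < 1.
Proof. by rewrite ltrBlDr ltrDl invr_gt0 ltr0n. Qed.

Lemma rr_cvg : rr @ \oo --> (1 : R).
Proof.
apply/cvg_sub0/cvg0P => e e0.
have /cvg0P/(_ e e0)[N hN] := @cvg_harmonic R.
exists N => m Nm; have := hN m.+1 (leqW Nm).
by rewrite /rr addrAC subrr add0r normrN.
Qed.

Lemma tends_rrX j : tends (fun m => Complex (rr m) 0 ^+ j) 1.
Proof.
have h0 : tends (fun m => Complex (rr m) 0) 1.
  by apply: tends_ReIm => /=; [exact: rr_cvg|exact: cvg_cst].
move=> e e0; have [d d0 hd] := contdX j (@ccont_id R 1) e0.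
have [N hN] := h0 _ d0; exists N => m /hN /hd.
by rewrite expr1n.
Qed.

Lemma tends_Re_le_ev (v : nat -> C) l (M : R) N :
  (forall m, (N <= m)%N -> complex.Re (v m) <= M) -> tends v l -> complex.Re l <= M.
Proof.
move=> vM h; apply: (@tends_Re_le _ (fun m => v (N + m)%N)).
  by move=> m; apply: vM; exact: leq_addr.
move=> e e0; have [K hK] := h e e0; exists K => m Km; apply: hK.
exact: leq_trans Km (leq_addl _ _).
Qed.

(** A relation and not a function, so that convergence of the means is part of the assertion. When
    [h] is [phi] times the conjugate of [psi], both in the Hardy space, [a] is their inner
    product. *)
Definition LM h (a : C) : Prop := tends (fun m => cm (rr m) h) a.

Lemma eq_LM h g (a : C) : (forall z, cdisc z -> h z = g z) -> LM h a -> LM g a.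
Proof.
move=> hg; apply: tends_eq => m; apply: eq_cm hg; [exact: rr_ge0|exact: rr_lt1].
Qed.

Lemma LM_D h g (a b : C) : dcont h -> dcont g -> LM h a -> LM g b ->
  LM (fun z => h z + g z) (a + b).
Proof.
move=> ch cg ha hb; apply: tends_eq (tendsD ha hb) => m.
by rewrite cmD ?rr_ge0 ?rr_lt1.
Qed.

Lemma LM_Z (c : C) h (a : C) : dcont h -> LM h a -> LM (fun z => c * h z) (c * a).
Proof.
by move=> ch ha; apply: tends_eq (tendsZ c ha) => m; rewrite cmZ ?rr_ge0 ?rr_lt1.
Qed.

Lemma LM_B h g (a b : C) : dcont h -> dcont g -> LM h a -> LM g b ->
  LM (fun z => h z - g z) (a - b).
Proof.
move=> ch cg ha hb; apply: tends_eq (tendsB ha hb) => m.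
by rewrite cmB ?rr_ge0 ?rr_lt1.
Qed.

Lemma LM_conj h (a : C) : dcont h -> LM h a -> LM (fun z => conjc (h z)) (conjc a).
Proof.
by move=> ch ha; apply: tends_eq (tends_conj ha) => m; rewrite cm_conj ?rr_ge0 ?rr_lt1.
Qed.

Lemma LM_sum (I : Type) (s : seq I) (F : I -> C -> C) (a : I -> C) :
  (forall i, dcont (F i)) -> (forall i, LM (F i) (a i)) ->
  LM (fun z => \sum_(i <- s) F i z) (\sum_(i <- s) a i).
Proof.
move=> ch ha; apply: tends_eq (tends_sum s ha) => m.
by rewrite cm_sum ?rr_ge0 ?rr_lt1.
Qed.

(** An exchange of limits: the approximation of [h] is uniform on the whole disc, hence controls the
    means at all radii at once. *)
Lemma LM_near h (a : C) (u : nat -> C -> C) (e : nat -> R) (b : nat -> C) :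
  dcont h -> (forall N, dcont (u N)) ->
  (forall N z, cdisc z -> cabs (h z - u N z) <= e N) -> e @ \oo --> (0 : R) ->
  (forall N, LM (u N) (b N)) -> tends b a -> LM h a.
Proof.
(* [cm_le] loses a factor 2, so the three errors stay below [d / 2], [d / 4] and [d / 4]. *)
move=> ch cu hu /cvg0P e_0 hb ba d d0; have d4 : 0 < d / 4 by rewrite divr_gt0.
have [N1 h1] := e_0 _ d4; have [N2 h2] := ba _ d4.
pose N := maxn N1 N2.
have eN : e N < d / 4 by rewrite (le_lt_trans (ler_norm _))// h1// leq_maxl.
have bN : cabs (b N - a) < d / 4 by rewrite h2// leq_maxr.
have [K hK] := hb N _ d4; exists K => m /hK hm.
have := @cm_le _ _ (rr_ge0 m) (rr_lt1 m) (fun z => h z - u N z) (e N)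
  (dcontB ch (cu N)) (fun z zr => hu N z (circle_disc (rr_lt1 m) zr)).
rewrite cmB ?rr_ge0 ?rr_lt1// => hd.
have -> : cm (rr m) h - a = (cm (rr m) h - cm (rr m) (u N)) +
  ((cm (rr m) (u N) - b N) + (b N - a)) by ring.
apply: (le_lt_trans (cabsD _ _)).
have := cabsD (cm (rr m) (u N) - b N) (b N - a).
lra.
Qed.

Definition dbounded phi : Prop := exists M : R, forall z, cdisc z -> cabs (phi z) <= M.

(** The algebra H^infinity. The power series is a separate requirement because [holo_on] gives only
    pointwise derivatives. *)
Definition nice phi : Prop := dbounded phi /\ has_ps phi.

Lemma nice_dcont phi : nice phi -> dcont phi.
Proof. by move=> [_ /has_ps_dcont]. Qed.

Lemma dboundedD phi psi : dbounded phi -> dbounded psi -> dbounded (fun z => phi z + psi z).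
Proof.
move=> [M hM] [N hN]; exists (M + N) => z Dz.
by rewrite (le_trans (cabsD _ _))// lerD ?hM ?hN.
Qed.

Lemma dboundedM phi psi : dbounded phi -> dbounded psi -> dbounded (fun z => phi z * psi z).
Proof.
move=> [M hM] [N hN]; exists (M * N) => z Dz.
by rewrite cabsM ler_pM ?cabs_ge0 ?hM ?hN.
Qed.

Lemma dbounded_cst (c : C) : dbounded (fun=> c).
Proof. by exists (cabs c). Qed.

Lemma niceD phi psi : nice phi -> nice psi -> nice (fun z => phi z + psi z).
Proof. by move=> [b1 h1] [b2 h2]; split; [exact: dboundedD|exact: has_psD]. Qed.

Lemma niceM phi psi : nice phi -> nice psi -> nice (fun z => phi z * psi z).
Proof. by move=> [b1 h1] [b2 h2]; split; [exact: dboundedM|exact: has_psM]. Qed.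

Lemma nice_cst (c : C) : nice (fun=> c).
Proof. by split; [exact: dbounded_cst|exact: has_ps_cst]. Qed.

Lemma niceZ (c : C) phi : nice phi -> nice (fun z => c * phi z).
Proof. exact: niceM (nice_cst c). Qed.

Lemma eq_nice phi psi : (forall z, cdisc z -> phi z = psi z) -> nice phi -> nice psi.
Proof.
move=> h [[M hM] hp]; split; last exact: eq_has_ps hp.
by exists M => z Dz; rewrite -h// hM.
Qed.

Lemma niceN phi : nice phi -> nice (fun z => - phi z).
Proof. by move=> /(niceZ (-1)); apply: eq_nice => z _; rewrite mulN1r. Qed.

Lemma niceB phi psi : nice phi -> nice psi -> nice (fun z => phi z - psi z).
Proof. by move=> h1 /niceN; exact: niceD. Qed.

Lemma nice_sum (I : Type) (s : seq I) (F : I -> C -> C) :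
  (forall i, nice (F i)) -> nice (fun z => \sum_(i <- s) F i z).
Proof.
move=> h; elim: s => [|i s IH].
  by apply: eq_nice (nice_cst 0) => z _; rewrite big_nil.
by apply: eq_nice (niceD (h i) IH) => z _; rewrite big_cons.
Qed.

Lemma nice_mono m : nice (fun z => z ^+ m).
Proof.
split; last exact: has_ps_mono.
by exists 1 => z /cdiscP z1; rewrite cabsX exprn_ile1 ?cabs_ge0// ltW.
Qed.

Lemma nice_horner (p : {poly C}) : nice (fun z => p.[z]).
Proof.
apply: (@eq_nice (fun z => \sum_(i < size p) p`_i * z ^+ i)) => [z _|].
  by rewrite horner_coef.
by apply: nice_sum => i; apply: niceZ; exact: nice_mono.
Qed.

(* The Szego kernel. *)
Definition sker l z : C := (1 - conjc l * z)^-1.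

Lemma sker_tail l z N : cdisc l -> cdisc z ->
  cabs (sker l z - \sum_(k < N) conjc l ^+ k * z ^+ k) <= (1 - cabs l)^-1 * cabs l ^+ N.
Proof.
move=> Dl Dz; have /cdiscP l1 := Dl; have /cdiscP z1 := Dz.
rewrite mulrC -[cabs l ^+ N]mul1r.
apply: (@geom_tail _ (fun k => conjc l ^+ k * z ^+ k) 1 (cabs l) (sker l z) (cabs_ge0 _) l1) => [k|].
  rewrite mul1r cabsM !cabsX cabs_conj ler_piMr ?exprn_ge0 ?cabs_ge0//.
  by rewrite exprn_ile1 ?cabs_ge0// ltW.
by apply: is_ps_geom Dz; rewrite cabs_conj ltW.
Qed.

Lemma nice_sker l : cdisc l -> nice (sker l).
Proof.
move=> Dl; have /cdiscP l1 := Dl; split.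
  exists (1 - cabs l)^-1 => z Dz.
  by have := sker_tail 0 Dl Dz; rewrite big_ord0 subr0 expr0 mulr1.
by exists (fun k => conjc l ^+ k); apply: is_ps_geom; rewrite cabs_conj ltW.
Qed.

Lemma LM_coef a phi k : is_ps a phi -> LM (fun z => phi z * conjc (z ^+ k)) (a k).
Proof.
move=> ha; rewrite -[X in LM _ X](mulr1 (a k)).
apply: tends_eq (tendsZ (a k) (tends_rrX (2 * k))) => m.
by rewrite (@cm_coef _ _ (rr_ge0 m) (rr_lt1 m) a).
Qed.

(** The kernel is truncated and [LM_coef] evaluates each term; boundedness of [phi] makes the
    truncation error uniform on the disc, as [LM_near] demands. *)
Lemma LM_reproducing phi l : nice phi -> cdisc l ->
  LM (fun z => phi z * conjc (sker l z)) (phi l).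
Proof.
move=> nphi Dl; have [[M hM] [a ha]] := nphi; have /cdiscP l1 := Dl.
have cphi := nice_dcont nphi.
have M0 : 0 <= M by exact: le_trans (cabs_ge0 _) (hM l Dl).
apply: (@LM_near _ _
  (fun N z => \sum_(k < N) l ^+ k * (phi z * conjc (z ^+ k)))
  (fun N => M * (1 - cabs l)^-1 * cabs l ^+ N) (fun N => \sum_(k < N) l ^+ k * a k)).
- by apply: dcontM => //; apply/dcont_conj/nice_dcont/nice_sker.
- move=> N; apply: dcont_sum => i; apply: dcontZ; apply: dcontM => //.
  exact/dcont_conj/dcontX.
- move=> N z Dz.
  have -> : \sum_(k < N) l ^+ k * (phi z * conjc (z ^+ k)) =
      phi z * conjc (\sum_(k < N) conjc l ^+ k * z ^+ k).
    rewrite conj_sum mulr_sumr; apply: eq_bigr => k _.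
    by rewrite conjM !conjX conjcK; ring.
  rewrite -mulrBr cabsM -conjB cabs_conj -mulrA.
  by apply: ler_pM; rewrite ?cabs_ge0 ?hM ?sker_tail.
- exact: geom_cvg0 (cabs_ge0 _) l1.
- move=> N; apply: LM_sum => k.
    by apply: dcontZ; apply: dcontM => //; exact/dcont_conj/dcontX.
  apply: LM_Z; last exact: LM_coef.
  by apply: dcontM => //; exact/dcont_conj/dcontX.
- by apply: tends_eq (ha l Dl) => N; apply: eq_bigr => k _; rewrite mulrC.
Qed.

Lemma cm_sq_real r phi : cm r (sq phi) = Complex (complex.Re (cm r (sq phi))) 0.
Proof.
apply: eqC => //=; rewrite -[RHS]rmean_cst; congr rmean; apply/funext => t.
by rewrite /sq mul_conj.
Qed.

(** By [bessel] and [parseval_le] the means lie between a partial sum damped by powers of the radius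
    and [S]; [N] is chosen first, then the radius close to one. *)
Lemma LM_sq a phi (S : R) : is_ps a phi ->
  series (fun k => cabs (a k) ^+ 2) @ \oo --> S -> LM (sq phi) (Complex S 0).
Proof.
move=> ha hS e e0; have e2 : 0 < e / 2 by rewrite divr_gt0.
have nd : nondecreasing_seq (series (fun k => cabs (a k) ^+ 2)).
  by apply/nondecreasing_series => k _ _; exact: sqr_ge0.
have le N : \sum_(k < N) cabs (a k) ^+ 2 <= S.
  have := nondecreasing_cvgn_le nd (cvgP _ hS) N.
  by rewrite (cvg_lim _ hS)// /series/= big_mkord.
move/cvg_sub0/cvg0P : (hS) => /(_ _ e2)[N /(_ N (leqnn _))].
rewrite /series/= big_mkord => hN.
have : tends (fun m => \sum_(k < N) Complex (cabs (a k) ^+ 2) 0 * Complex (rr m) 0 ^+ (2 * k))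
    (\sum_(k < N) Complex (cabs (a k) ^+ 2) 0 * 1).
  by apply: tends_sum => k; apply/tendsZ/tends_rrX.
move=> /(_ _ e2)[K hK]; exists K => m /hK.
move=> /(le_lt_trans (Re_le_cabs _)).
rewrite ReD ReN !Re_sum => hm.
rewrite cm_sq_real (_ : _ - _ = Complex (complex.Re (cm (rr m) (sq phi)) - S) 0); last first.
  by apply: eqC; rewrite ?ReD ?ImD ?ReN ?ImN/= ?subr0.
have h1 := @parseval_le _ _ (rr_ge0 m) (rr_lt1 m) a phi S ha le.
have h2 := @bessel _ _ (rr_ge0 m) (rr_lt1 m) a phi N ha.
rewrite -cabsN -[X in - X]/(real_complex R _) -(rmorphN (real_complex R)) cabs_real; last by rewrite opprB subr_ge0.
have e1 : \sum_(k < N) complex.Re (Complex (cabs (a k) ^+ 2) 0 * Complex (rr m) 0 ^+ (2 * k))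
   = \sum_(k < N) cabs (a k) ^+ 2 * rr m ^+ (2 * k).
  apply: eq_bigr => k _; rewrite -(rmorphXn (real_complex R)) ReM/=.
  by rewrite mul0r subr0.
have e3 : \sum_(k < N) complex.Re (Complex (cabs (a k) ^+ 2) 0 * (1 : C))
   = \sum_(k < N) cabs (a k) ^+ 2.
  by apply: eq_bigr => k _; rewrite mulr1.
rewrite e1 e3 in hm.
move: hN hm; rewrite !ltr_norml => /andP[a1 a2] /andP[a3 a4].
lra.
Qed.

(** Bessel's inequality bounds the damped partial sum by the square of a bound of [phi]; then the
    radius tends to one with [N] fixed. *)
Lemma nice_coef_bound phi a : nice phi -> is_ps a phi ->
  exists S : R, forall N, \sum_(k < N) cabs (a k) ^+ 2 <= S.
Proof.
move=> nphi ha; have [[M hM] _] := nphi; exists (M ^+ 2) => N.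
have -> : \sum_(k < N) cabs (a k) ^+ 2 =
    complex.Re (\sum_(k < N) Complex (cabs (a k) ^+ 2) 0 * 1).
  by rewrite Re_sum; apply: eq_bigr => k _; rewrite mulr1.
apply: (@tends_Re_le _
  (fun m => \sum_(k < N) Complex (cabs (a k) ^+ 2) 0 * Complex (rr m) 0 ^+ (2 * k))); last first.
  by apply: tends_sum => k; apply/tendsZ/tends_rrX.
move=> m; apply: (@le_trans _ _ (complex.Re (cm (rr m) (sq phi)))).
  rewrite (le_trans _ (@bessel _ _ (rr_ge0 m) (rr_lt1 m) a phi N ha))// Re_sum.
  rewrite le_eqVlt; apply/orP; left; apply/eqP; apply: eq_bigr => k _.
  by rewrite -(rmorphXn (real_complex R)) ReM/= mul0r subr0.
have := @cm_Re_le _ _ (rr_ge0 m) (rr_lt1 m) (sq phi) (fun=> Complex (M ^+ 2) 0)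
  (dcont_sq (nice_dcont nphi)) (@dcont_cst _ _).
rewrite cm_cst/=; apply => z Dz; rewrite Re_sq lerXn2r ?nnegrE ?cabs_ge0 ?hM//.
exact: le_trans (cabs_ge0 _) (hM z Dz).
Qed.

Lemma poly_approx phi (e : R) : nice phi -> 0 < e ->
  exists (a : nat -> C) (N : nat), forall m,
    complex.Re (cm (rr m) (sq (fun z => phi z - \sum_(k < N) a k * z ^+ k))) <= e.
Proof.
move=> nphi e0; have [_ [a ha]] := nphi; have [S hS] := nice_coef_bound nphi ha.
have cv : cvgn (series (fun k => cabs (a k) ^+ 2)).
  apply: nondecreasing_is_cvgn.
    by apply/nondecreasing_series => k _ _; exact: sqr_ge0.
  by exists S => _ [N _ <-]; rewrite /series/= big_mkord.
pose L := limn (series (fun k => cabs (a k) ^+ 2)).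
have hle N : \sum_(k < N) cabs (a k) ^+ 2 <= L.
  have nd : nondecreasing_seq (series (fun k => cabs (a k) ^+ 2)).
    by apply/nondecreasing_series => k _ _; exact: sqr_ge0.
  by have := nondecreasing_cvgn_le nd cv N; rewrite /series/= big_mkord.
move/cvg_sub0/cvg0P : cv => /(_ _ e0)[N /(_ N (leqnn _))].
rewrite -/L /series/= big_mkord => hN; exists a, N => m.
(* The remainder after [N] terms has the coefficients of [phi] with the first [N] erased, so the
   tail sum bounds its mean squares at every radius. *)
pose b k := if (k < N)%N then 0 else a k.
have hb : is_ps b (fun z => phi z - \sum_(k < N) a k * z ^+ k).
  move=> z Dz d d0; have [K hK] := ha z Dz d d0; exists (maxn K N) => n.
  rewrite geq_max => /andP[/hK + Nn]; congr (cabs _ < _).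
  rewrite opprB addrA; congr (_ - _).
  rewrite (big_ord_widen n (fun i => a i * z ^+ i) Nn) [X in _ = _ + X]big_mkcond/= -big_split/=.
  by apply: eq_bigr => i _; rewrite /b; case: ifP; rewrite ?mul0r ?add0r ?addr0.
apply: (@parseval_le _ _ (rr_ge0 m) (rr_lt1 m) b) hb _ => n.
have mono : \sum_(k < n) cabs (b k) ^+ 2 <= \sum_(k < N + n) cabs (b k) ^+ 2.
  rewrite addnC big_split_ord/= lerDl sumr_ge0// => i _; exact: sqr_ge0.
apply: (le_trans mono); have := hle (N + n)%N.
rewrite !big_split_ord/= => h.
rewrite big1 ?add0r; last by move=> i _; rewrite /b ltn_ord cabs0 expr0n.
have -> : \sum_(i < n) cabs (b (N + i)%N) ^+ 2 = \sum_(i < n) cabs (a (N + i)%N) ^+ 2.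
  by apply: eq_bigr => i _; rewrite /b ltnNge leq_addr.
move: hN; rewrite ltr_norml => /andP[hN _]; lra.
Qed.

Definition ksum (s : seq (C * C)) z : C := \sum_(x <- s) x.1 * sker x.2 z.

Definition indisc (s : seq (C * C)) : Prop := forall x, x \in s -> cdisc x.2.

Lemma nice_ksum s : indisc s -> nice (ksum s).
Proof.
rewrite /ksum; elim: s => [|x s IH] h.
  by apply: eq_nice (nice_cst 0) => z _; rewrite big_nil.
have h1 : nice (fun z => x.1 * sker x.2 z).
  by apply: niceZ; apply: nice_sker; apply: h; rewrite inE eqxx.
have h2 : indisc s by move=> y ys; apply: h; rewrite inE ys orbT.
by apply: eq_nice (niceD h1 (IH h2)) => z _; rewrite big_cons.
Qed.

Lemma indisc_cat s1 s2 : indisc s1 -> indisc s2 -> indisc (s1 ++ s2).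
Proof. by move=> h1 h2 x; rewrite mem_cat => /orP[/h1|/h2]. Qed.

Definition kscale (c : C) (s : seq (C * C)) := [seq (c * x.1, x.2) | x <- s].

Lemma indisc_scale c s : indisc s -> indisc (kscale c s).
Proof. by move=> h x /mapP[y ys ->]; exact: (h y). Qed.

Lemma ksum_scale c s z : ksum (kscale c s) z = c * ksum s z.
Proof.
by rewrite /ksum big_map mulr_sumr; apply: eq_bigr => x _ /=; rewrite mulrA.
Qed.

Lemma ksum_cat s1 s2 z : ksum (s1 ++ s2) z = ksum s1 z + ksum s2 z.
Proof. by rewrite /ksum big_cat. Qed.

Definition kapprox phi : Prop := forall e : R, 0 < e -> exists2 s, indisc s &
  forall z, cdisc z -> cabs (phi z - ksum s z) <= e.

Lemma kapproxD phi psi : kapprox phi -> kapprox psi -> kapprox (fun z => phi z + psi z).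
Proof.
move=> h1 h2 e e0; have e2 : 0 < e / 2 by rewrite divr_gt0.
have [s ds hs] := h1 _ e2; have [t dt ht] := h2 _ e2.
exists (s ++ t) => [|z Dz]; first exact: indisc_cat.
by rewrite ksum_cat opprD addrACA (le_trans (cabsD _ _))// (splitr e) lerD ?hs ?ht.
Qed.

Lemma kapproxZ c phi : kapprox phi -> kapprox (fun z => c * phi z).
Proof.
move=> h1 e e0; have K0 : 0 < cabs c + 1 by rewrite ltr_wpDl ?cabs_ge0.
have [s ds hs] := h1 _ (divr_gt0 e0 K0).
exists (kscale c s) => [|z Dz]; first exact: indisc_scale.
rewrite ksum_scale -mulrBr cabsM.
apply: (@le_trans _ _ ((cabs c + 1) * (e / (cabs c + 1)))).
  by apply: ler_pM; rewrite ?cabs_ge0 ?hs// lerDl.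
by rewrite mulrC divfK// gt_eqF.
Qed.

Lemma kapprox_sum (I : Type) (s : seq I) (F : I -> C -> C) :
  (forall i, kapprox (F i)) -> kapprox (fun z => \sum_(i <- s) F i z).
Proof.
move=> h; elim: s => [|i s IH] e e0.
  by exists [::] => // z _; rewrite /ksum !big_nil subrr cabs0 ltW.
have [t dt ht] := kapproxD (h i) IH e0.
by exists t => // z Dz; rewrite big_cons; exact: ht.
Qed.

(* [z ^+ m] is the limit as [r -> 0] of [(sker r - \sum_(k < m) r ^+ k * z ^+ k) / r ^+ m]. *)
Lemma kapprox_mono m : kapprox (fun z => z ^+ m).
Proof.
elim/ltn_ind: m => m IH e e0.
(* [r <= 2^-1] gives [(1 - r)^-1 <= 2], so after division by [r ^+ m] the tail is at most [2 * r],
   hence at most [e / 2]. *)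
pose r : R := Num.min 2^-1 (e / 4).
have r_0 : 0 < r by rewrite lt_min invr_gt0 ltr0n divr_gt0.
have r_1 : r <= 2^-1 by rewrite ge_min lexx.
have r_e : r <= e / 4 by rewrite ge_min lexx orbT.
have Dr : cdisc (Complex r 0 : C) by apply/cdiscP; rewrite cabs_real ?ltW//; lra.
have ar : cabs (Complex r 0) = r by rewrite cabs_real// ltW.
pose c : C := Complex r 0; have c0 : c != 0.
  by apply: contraTneq r_0 => c0; rewrite -ar -/c c0 cabs0 ltxx.
have e2 : 0 < e / 2 by rewrite divr_gt0.
have cc : conjc c = c by rewrite /c/= oppr0.
have : kapprox (fun z => c ^- m * (sker c z + \sum_(k < m) - c ^+ k * z ^+ k)).
  apply/kapproxZ/kapproxD; last by apply: kapprox_sum => k; apply/kapproxZ/IH.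
  move=> d d0; exists [:: (1, c)] => [x|z Dz]; first by rewrite inE => /eqP ->.
  by rewrite /ksum big_seq1 mul1r subrr cabs0 ltW.
move=> /(_ _ e2)[s ds hs]; exists s => // z Dz.
apply: (le_trans (cabs_tri (c ^- m * (sker c z + \sum_(k < m) - c ^+ k * z ^+ k)) _ _)).
rewrite (splitr e); apply: lerD; last exact: hs.
have -> : z ^+ m = c ^- m * (c ^+ m * z ^+ m) by rewrite mulrA mulVf ?mul1r// expf_neq0.
rewrite -mulrBr.
have -> : c ^+ m * z ^+ m - (sker c z + \sum_(k < m) - c ^+ k * z ^+ k) =
   - (sker c z - \sum_(k < m.+1) conjc c ^+ k * z ^+ k).
  rewrite cc big_ord_recr/=; under eq_bigr do rewrite mulNr.
  by rewrite sumrN; ring.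
rewrite cabsM cabsN cabsV cabsX ar.
rewrite mulrC ler_pdivrMr ?exprn_gt0//.
apply: (le_trans (sker_tail m.+1 Dr Dz)); rewrite ar exprS mulrA.
apply: ler_wpM2r; first by rewrite exprn_ge0// ltW.
rewrite mulrC ler_pdivrMr; last by lra.
nra.
Qed.

Lemma cabs_sqrD (x y : C) : cabs (x + y) ^+ 2 <= 2 * cabs x ^+ 2 + 2 * cabs y ^+ 2.
Proof.
apply: (@le_trans _ _ ((cabs x + cabs y) ^+ 2)).
  by rewrite lerXn2r ?nnegrE ?addr_ge0 ?cabs_ge0// cabsD.
rewrite -subr_ge0 (_ : _ - _ = (cabs x - cabs y) ^+ 2) ?sqr_ge0//; ring.
Qed.

(** Taylor polynomials approximate [phi] in mean square, and kernels approximate polynomials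
    uniformly; both estimates hold at all radii simultaneously. *)
Lemma kernel_approx phi (e : R) : nice phi -> 0 < e -> exists2 s, indisc s &
  forall m, complex.Re (cm (rr m) (sq (fun z => phi z - ksum s z))) <= e.
Proof.
move=> nphi e0; have e4 : 0 < e / 4 by rewrite divr_gt0.
have [a [N h1]] := poly_approx nphi e4.
have ka : kapprox (fun z => \sum_(k < N) a k * z ^+ k).
  by apply: kapprox_sum => k; apply/kapproxZ/kapprox_mono.
(* [d] is at most 1 and at most [e / 4], so [2 * (e / 4) + 2 * d ^+ 2 <= e] in the final sum. *)
pose d := Num.min 1 (e / 4); have d0 : 0 < d by rewrite lt_min ltr01.
have d2 : d ^+ 2 <= e / 4.
  have d1 : d <= 1 by rewrite ge_min lexx.
  have de : d <= e / 4 by rewrite ge_min lexx orbT.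
  nra.
have [s ds hs] := ka _ d0; exists s => // m.
have cp : dcont (fun z => \sum_(k < N) a k * z ^+ k).
  by apply: dcont_sum => i; apply/dcontZ/dcontX.
have cd : dcont (fun z => phi z - \sum_(k < N) a k * z ^+ k).
  by apply: dcontB => //; exact: nice_dcont.
have ck : dcont (ksum s) by apply/nice_dcont/nice_ksum.
pose two : C := Complex 2 0.
have cT : dcont (fun z => two * sq (fun z => phi z - \sum_(k < N) a k * z ^+ k) z).
  by apply/dcontZ/dcont_sq.
apply: (@le_trans _ _ (complex.Re (cm (rr m)
   (fun z => two * sq (fun z => phi z - \sum_(k < N) a k * z ^+ k) z + Complex (2 * d ^+ 2) 0)))).
  apply: cm_Re_le; [exact: rr_ge0|exact: rr_lt1| | |].
  - by apply/dcont_sq/dcontB => //; exact: nice_dcont.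
  - by apply: dcontD => //; exact: dcont_cst.
  move=> z Dz; rewrite Re_sq ReD [complex.Re (two * _)]ReM Re_sq /two/= mul0r subr0.
  have -> : phi z - ksum s z = (phi z - \sum_(k < N) a k * z ^+ k) +
     (\sum_(k < N) a k * z ^+ k - ksum s z) by ring.
  apply: (le_trans (cabs_sqrD _ _)); rewrite lerD2l ler_wpM2l//.
  by rewrite lerXn2r ?nnegrE ?cabs_ge0 ?hs// ltW.
rewrite cmD ?rr_ge0 ?rr_lt1//; last exact: dcont_cst.
rewrite cmZ ?rr_ge0 ?rr_lt1//; last exact: dcont_sq.
move: (h1 m); rewrite cm_cst; move: (cm _ _) => x hx.
rewrite ReD ReM/= mul0r subr0; lra.
Qed.

(** Cauchy-Schwarz against the kernel at [l]: the mean square of [u - c * sker l] is nonnegative,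
    and [c = u l * (1 - cabs l ^+ 2)] makes [c * sker l] the projection of [u] onto that kernel. *)
Lemma eval_bound u l (e : R) N : nice u -> cdisc l ->
  (forall m, (N <= m)%N -> complex.Re (cm (rr m) (sq u)) <= e) ->
  cabs (u l) ^+ 2 * (1 - cabs l ^+ 2) <= e.
Proof.
move=> nu Dl hm; have cu := nice_dcont nu.
have nk := nice_sker Dl; have ck := nice_dcont nk.
have /cdiscP l1 := Dl.
pose w : R := 1 - cabs l ^+ 2.
have w0 : 0 < w by rewrite subr_gt0 expr_lt1 ?cabs_ge0.
have kl : sker l l = (Complex w 0)^-1.
  by rewrite /sker mulrC mul_conj; congr (_^-1); apply: eqC; rewrite ?ReD ?ImD ?ReN ?ImN/= ?subr0.
pose c := u l * Complex w 0.
have X := LM_reproducing nu Dl; have Y := LM_reproducing nk Dl.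
have lim := tendsB (tendsD (tendsZ (conjc c) X) (tendsZ c (tends_conj X)))
   (tendsZ (c * conjc c) Y).
suff -> : cabs (u l) ^+ 2 * (1 - cabs l ^+ 2) =
    complex.Re (conjc c * u l + c * conjc (u l) - c * conjc c * sker l l).
  apply: (tends_Re_le_ev (N := N) _ lim) => m /hm; apply: le_trans.
  have r0 := rr_ge0 m; have r1 := rr_lt1 m.
  have cX : dcont (fun z => u z * conjc (sker l z)) by apply: dcontM => //; exact: dcont_conj.
  have := @Re_cm_sq_ge0 _ _ r0 r1 (fun z => u z - c * sker l z)
     (dcontB cu (dcontZ c ck)).
  rewrite (@eq_cm _ _ r0 r1 _ (fun z => sq u z - (conjc c * (u z * conjc (sker l z)) +
     c * conjc (u z * conjc (sker l z)) - c * conjc c * (sker l z * conjc (sker l z))))); last first.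
    by move=> z _; rewrite /sq conjB !conjM conjcK; ring.
  have c1 : dcont (fun z => conjc c * (u z * conjc (sker l z))) by exact: dcontZ.
  have c2 : dcont (fun z => c * conjc (u z * conjc (sker l z))) by apply/dcontZ/dcont_conj.
  have c3 : dcont (fun z => c * conjc c * (sker l z * conjc (sker l z))).
    by apply/dcontZ/dcontM => //; exact: dcont_conj.
  rewrite cmB//; [|exact: dcont_sq|by apply: dcontB => //; exact: dcontD].
  rewrite cmB//; last exact: dcontD.
  rewrite cmD// !cmZ//; [|by apply: dcontM => //; exact: dcont_conj|exact: dcont_conj].
  by rewrite cm_conj// ReD ReN subr_ge0.
have wn : Complex w 0 != 0 :> C.
  by rewrite eq_complex/= eqxx andbT gt_eqF.
rewrite kl /c conjM.
have -> : conjc (Complex w 0) = Complex w 0 :> C by rewrite /= oppr0.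
have -> : conjc (u l) * Complex w 0 * u l + u l * Complex w 0 * conjc (u l) -
   u l * Complex w 0 * (conjc (u l) * Complex w 0) / Complex w 0 =
   (u l * conjc (u l)) * Complex w 0 by field.
by rewrite mul_conj ReM/= mul0r subr0.
Qed.

End RadialLimit.

(** * Integrals over closed intervals *)

Section IntervalIntegral.
Variable R : realType.
Local Notation mu := (@lebesgue_measure R).
Implicit Types (u v : R -> R) (x y z : R).

Definition oint x y u : R := Rintegral mu `[x, y]%classic u.

Lemma itvcc_integrable_sub x y x' y' u : x <= x' -> y' <= y ->
  mu.-integrable `[x, y] (EFin \o u) -> mu.-integrable `[x', y'] (EFin \o u).
Proof.
move=> xx yy; apply: integrableS; [exact: measurable_itv|exact: measurable_itv|].
by apply: subset_itv; rewrite bnd_simp.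
Qed.

Lemma oint_split x y z u : x <= y -> y <= z -> mu.-integrable `[x, z] (EFin \o u) ->
  oint x z u = oint x y u + oint y z u.
Proof.
move=> xy yz iu; have := @Rintegral_itvB _ u (BLeft x) (BRight z) y iu.
rewrite !bnd_simp => /(_ xy yz) h.
rewrite /oint -(Rintegral_itv_obnd_cbnd (r := y)) -?h; first by rewrite addrC subrK.
apply: integrableS iu; [exact: measurable_itv|exact: measurable_itv|].
by apply: subset_itv; rewrite bnd_simp.
Qed.

Lemma oint_cst x y (k : R) : x <= y -> oint x y (fun=> k) = k * (y - x).
Proof.
move=> xy; rewrite /oint Rintegral_cst//= lebesgue_measure_itv/= lte_fin.
by have [//|] := ltP x y; move=> yx; rewrite (le_anti (introT andP (conj xy yx))) subrr.
Qed.

Lemma cst_integrable x y (k : R) : mu.-integrable `[x, y] (EFin \o (fun=> k)).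
Proof. by apply: cont_integrable => t; exact: cvg_cst. Qed.

Lemma itvcc_integrableB x y u v : mu.-integrable `[x, y] (EFin \o u) ->
  mu.-integrable `[x, y] (EFin \o v) ->
  mu.-integrable `[x, y] (EFin \o (fun t => u t - v t)).
Proof.
move=> iu iv; suff : mu.-integrable `[x, y] ((EFin \o u) \- (EFin \o v))%E by [].
exact: integrableB.
Qed.

Lemma oint_near x y u (k M : R) : x <= y -> mu.-integrable `[x, y] (EFin \o u) ->
  (forall t, x <= t <= y -> `|u t - k| <= M) ->
  `|oint x y u - k * (y - x)| <= M * (y - x).
Proof.
move=> xy iu uk.
rewrite -!oint_cst// /oint -RintegralB//; last exact: cst_integrable.
have ib := itvcc_integrableB iu (cst_integrable x y k).
apply: (le_trans (le_normr_Rintegral _ ib)) => //.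
apply: le_Rintegral => //.
- exact: (integrable_abse ib).
- exact: cst_integrable.
Qed.

End IntervalIntegral.

(** * Goursat's theorem for a divergence-free field on a rectangle *)

Section Goursat.
Variable R : realType.
Local Notation mu := (@lebesgue_measure R).
Variables (p q : R -> R -> R) (a b c d : R).
Hypotheses (ab : a < b) (cd : c < d).

(* [p] and [q] are differentiable on the rectangle, with [d_s p + d_t q = 0];
   the derivatives are not assumed continuous. *)
Hypothesis diff : forall s t, a <= s <= b -> c <= t <= d ->
  exists al be ga : R, forall e, 0 < e -> exists2 del : R, 0 < del &
    forall s' t', a <= s' <= b -> c <= t' <= d -> `|s' - s| < del -> `|t' - t| < del ->
      `|p s' t' - p s t - al * (s' - s) - be * (t' - t)| <= e * (`|s' - s| + `|t' - t|) /\
      `|q s' t' - q s t - ga * (s' - s) + al * (t' - t)| <= e * (`|s' - s| + `|t' - t|).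

Lemma within_lipschitz_integrable (u : R -> R) (x y : R) :
  (forall t, x <= t <= y -> exists2 K : R, 0 <= K & exists2 del : R, 0 < del &
    forall s, x <= s <= y -> `|s - t| < del -> `|u s - u t| <= K * `|s - t|) ->
  mu.-integrable `[x, y] (EFin \o u).
Proof.
move=> h; apply: continuous_compact_integrable; first exact: segment_compact.
apply/subspace_continuousP => t /=; rewrite in_itv/= => txy.
have [K K0 [del del0 hd]] := h t txy.
apply/cvgrPdist_lt => e e0.
have K1 : 0 < K + 1 by rewrite ltr_wpDl.
have m0 : 0 < Num.min del (e / (K + 1)) by rewrite lt_min del0 divr_gt0.
have := @nbhsx_ballx _ _ t _ m0; rewrite /within/=; apply: filterS => s.
rewrite /ball/= distrC lt_min => /andP[s1 s2]; rewrite in_itv/= => sxy.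
rewrite distrC (le_lt_trans (hd s sxy s1))//.
apply: (@le_lt_trans _ _ ((K + 1) * `|s - t|)).
  by rewrite ler_wpM2r// lerDl.
by rewrite mulrC -ltr_pdivlMr.
Qed.

Let ip s : a <= s <= b -> mu.-integrable `[c, d] (EFin \o p s).
Proof.
move=> sab; apply: within_lipschitz_integrable => t tcd.
have [al [be [ga h]]] := diff sab tcd; have [del del0 hd] := h 1 ltr01.
exists (`|be| + 1); first by rewrite addr_ge0.
exists del => // t' t'cd tt; have [||+ _] := hd s t' sab t'cd; rewrite ?subrr ?normr0//.
rewrite mulr0 subr0 add0r mul1r mulrDl mul1r => h1.
by rewrite -normrM -[X in `|X| <= _](subrK (be * (t' - t))) (le_trans (ler_normD _ _))// addrC lerD2l.
Qed.

Let iq t : c <= t <= d -> mu.-integrable `[a, b] (EFin \o q^~ t).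
Proof.
move=> tcd; apply: within_lipschitz_integrable => s sab.
have [al [be [ga h]]] := diff sab tcd; have [del del0 hd] := h 1 ltr01.
exists (`|ga| + 1); first by rewrite addr_ge0.
exists del => // s' s'ab ss; have [||_ +] := hd s' t s'ab tcd; rewrite ?subrr ?normr0//.
rewrite mulr0 addr0 addr0 mul1r mulrDl mul1r => h1.
by rewrite -normrM -[X in `|X| <= _](subrK (ga * (s' - s))) (le_trans (ler_normD _ _))// addrC lerD2l.
Qed.

(** The outward flux of the field [(p, q)] through the boundary of the rectangle with sides
    [[x, x']] and [[y, y']]; opposite sides are paired so that each integrand is a difference. *)
Definition flux (x x' y y' : R) : R :=
  oint y y' (fun t => p x' t - p x t) + oint x x' (fun s => q s y' - q s y).

Let ipp x x' y y' : a <= x <= b -> a <= x' <= b -> c <= y -> y' <= d ->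
  mu.-integrable `[y, y'] (EFin \o (fun t => p x' t - p x t)).
Proof.
move=> hx hx' cy yd; apply: (itvcc_integrable_sub cy yd).
by apply: itvcc_integrableB; exact: ip.
Qed.

Let iqq x x' y y' : c <= y <= d -> c <= y' <= d -> a <= x -> x' <= b ->
  mu.-integrable `[x, x'] (EFin \o (fun s => q s y' - q s y)).
Proof.
move=> hy hy' ax xb; apply: (itvcc_integrable_sub ax xb).
by apply: (@itvcc_integrableB _ _ _ (q^~ y') (q^~ y)); exact: iq.
Qed.

(** The contributions of the common side at [m] cancel. *)
Lemma flux_split_s x m x' y y' : a <= x -> x <= m -> m <= x' -> x' <= b ->
  c <= y -> y <= y' -> y' <= d -> flux x x' y y' = flux x m y y' + flux m x' y y'.
Proof.
move=> ax xm mx xb cy yy yd; rewrite /flux.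
rewrite (@oint_split _ x m x')//; last first.
  by apply: iqq => //; apply/andP; split; lra.
rewrite addrACA; congr (_ + _).
rewrite /oint addrC -RintegralD//.
- by apply: eq_Rintegral => t _; rewrite subrKA.
- by apply: ipp => //; apply/andP; split; lra.
- by apply: ipp => //; apply/andP; split; lra.
Qed.

Lemma flux_split_t x x' y m y' : a <= x -> x <= x' -> x' <= b ->
  c <= y -> y <= m -> m <= y' -> y' <= d -> flux x x' y y' = flux x x' y m + flux x x' m y'.
Proof.
move=> ax xx xb cy ym my yd; rewrite /flux.
rewrite (@oint_split _ y m y')//; last first.
  by apply: ipp => //; apply/andP; split; lra.
rewrite addrACA; congr (_ + _).
rewrite /oint [RHS]addrC -RintegralD//.
- by apply: eq_Rintegral => t _; rewrite subrKA.
- by apply: iqq => //; apply/andP; split; lra.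
- by apply: iqq => //; apply/andP; split; lra.
Qed.

Let L : R := b - a.
Let W : R := d - c.
Let L0 : 0 < L. Proof. by rewrite subr_gt0. Qed.
Let W0 : 0 < W. Proof. by rewrite subr_gt0. Qed.
Let h (k : nat) : R := 2^-1 ^+ k.
Let h0 k : 0 < h k. Proof. by rewrite exprn_gt0// invr_gt0. Qed.
Let hS k : h k = 2 * h k.+1.
Proof. by rewrite /h exprS mulrA mulfV ?mul1r// pnatr_eq0. Qed.

Let inrect k (x : R * R) : Prop :=
  a <= x.1 /\ x.1 + L * h k <= b /\ c <= x.2 /\ x.2 + W * h k <= d.

Variable eps : R.
Hypothesis eps0 : 0 < eps.

Let bad k (x : R * R) : bool :=
  eps * (L * h k) * (W * h k) < `|flux x.1 (x.1 + L * h k) x.2 (x.2 + W * h k)|.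

(** The fourth quarter is taken untested: if the other three are not bad, additivity of the flux
    forces it to be bad, as [stepP] shows. *)
Let step k (x : R * R) : R * R :=
  let x' := (x.1 + L * h k.+1, x.2) in
  let y' := (x.1, x.2 + W * h k.+1) in
  if bad k.+1 x then x else if bad k.+1 x' then x' else if bad k.+1 y' then y'
  else (x.1 + L * h k.+1, x.2 + W * h k.+1).

Let stepP k x : inrect k x -> bad k x ->
  [/\ inrect k.+1 (step k x), bad k.+1 (step k x),
      x.1 <= (step k x).1 /\ (step k x).1 + L * h k.+1 <= x.1 + L * h k &
      x.2 <= (step k x).2 /\ (step k x).2 + W * h k.+1 <= x.2 + W * h k].
Proof.
case: x => x y [/= ax [xb [cy yd]]].
have Lh : L * h k = L * h k.+1 + L * h k.+1 by rewrite hS; ring.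
have Wh : W * h k = W * h k.+1 + W * h k.+1 by rewrite hS; ring.
have l0 : 0 < L * h k.+1 by rewrite mulr_gt0.
have w0 : 0 < W * h k.+1 by rewrite mulr_gt0.
rewrite /bad/=; rewrite !Lh !Wh in xb yd *; move=> {Lh Wh}.
move: l0 w0 xb yd; rewrite /step /bad/= /inrect/=.
move: (L * h k.+1) (W * h k.+1) => l w l0 w0 xb yd.
rewrite [x + (l + l)]addrA [y + (w + w)]addrA in xb yd *.
rewrite (@flux_split_s x (x + l) (x + l + l)); try lra.
rewrite (@flux_split_t x (x + l) y (y + w) (y + w + w)); try lra.
rewrite (@flux_split_t (x + l) (x + l + l) y (y + w) (y + w + w)); try lra.
set f1 := flux x _ y _; set f2 := flux x _ (y + w) _.
set f3 := flux (x + l) _ y _; set f4 := flux (x + l) _ (y + w) _ => hbig.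
have [b1|g1] := ltP (eps * l * w) `|f1|; first by split=> //=; repeat apply: conj; lra.
have [b3|g3] := ltP (eps * l * w) `|f3|; first by split=> //=; repeat apply: conj; lra.
have [b2|g2] := ltP (eps * l * w) `|f2|; first by split=> //=; repeat apply: conj; lra.
split=> /=; try (by repeat apply: conj; lra).
have := ler_normD (f1 + f2) (f3 + f4); have := ler_normD f1 f2.
have := ler_normD f3 f4.
have E : eps * (l + l) * (w + w) = 4 * (eps * l * w) by ring.
rewrite -/f4; move: hbig; rewrite E; lra.
Qed.

Let st : nat -> R * R := fix F k := if k is k'.+1 then step k' (F k') else (a, c).

(** Repeated quartering leads to a point of the rectangle. There the affine part of the field has
    zero flux, as the two diagonal derivatives are opposite, and the remainder is too small for the
    flux to exceed [eps] times the area. *)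
Lemma goursat_eps : `|flux a b c d| <= eps * L * W.
Proof.
rewrite leNgt; apply/negP => hbad.
have st0 : inrect 0 (st 0%N) /\ bad 0 (st 0%N).
  rewrite /inrect /bad/= /h expr0 !mulr1 /L /W !subrKC; split; last exact: hbad.
  by rewrite !lexx.
have stP k : inrect k (st k) /\ bad k (st k).
  by elim: k => // k [h1 h2]; have [] := stepP h1 h2.
have mono k : (st k).1 <= (st k.+1).1 /\ (st k.+1).1 + L * h k.+1 <= (st k).1 + L * h k.
  by have [i1 b1] := stP k; have [_ _] := stepP i1 b1.
have mono2 k : (st k).2 <= (st k.+1).2 /\ (st k.+1).2 + W * h k.+1 <= (st k).2 + W * h k.
  by have [i1 b1] := stP k; have [_ _ _] := stepP i1 b1.
have nest (u : nat -> R) (l : R) : 0 < l ->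
    (forall k, u k <= u k.+1 /\ u k.+1 + l * h k.+1 <= u k + l * h k) ->
    exists x, forall k, u k <= x <= u k + l * h k.
  move=> l0 hu.
  have up j k : (j <= k)%N -> u j <= u k.
    elim: k => [|k IH]; first by rewrite leqn0 => /eqP ->.
    rewrite leq_eqVlt => /orP[/eqP ->//|/IH]; move/le_trans; apply; by have [] := hu k.
  have dn j k : (j <= k)%N -> u k + l * h k <= u j + l * h j.
    elim: k => [|k IH]; first by rewrite leqn0 => /eqP ->.
    rewrite leq_eqVlt => /orP[/eqP ->//|/IH]; apply: le_trans; by have [] := hu k.
  have bd j k : u j <= u k + l * h k.
    have [jk|/ltnW kj] := leqP j k.
      by rewrite (le_trans (up j k jk))// lerDl mulr_ge0// ltW.
    by apply: le_trans (dn k j kj); rewrite lerDl mulr_ge0// ltW.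
  exists (sup (range u)) => k; apply/andP; split.
    apply: ub_le_sup; last by exists k.
    by exists (u 0%N + l * h 0%N) => _ [j _ <-].
  by apply: ge_sup; [by exists (u 0%N), 0%N|move=> _ [j _ <-]].
have [x hx] := nest (fun k => (st k).1) L L0 mono.
have [y hy] := nest (fun k => (st k).2) W W0 mono2.
have xab : a <= x <= b.
  by have := hx 0%N; rewrite /= /h expr0 mulr1 /L subrKC.
have ycd : c <= y <= d.
  by have := hy 0%N; rewrite /= /h expr0 mulr1 /W subrKC.
have [al [be [ga hd]]] := diff xab ycd.
(* Chosen so that [4 * e * (l + w) ^+ 2] is [eps] times the area at every scale, while the remainder
   contributes at most [2 * e * (l + w) ^+ 2]. *)
pose e := eps * L * W / (4 * (L + W) ^+ 2).
have LW : 0 < L + W by rewrite addr_gt0.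
have e0 : 0 < e by rewrite divr_gt0// !mulr_gt0// exprn_gt0.
have [del del0 {}hd] := hd e e0.
have [k hk] : exists k, (L + W) * h k < del.
  have hh1 : (2^-1 : R) < 1 by rewrite invf_lt1 ?ltr1n.
  have hh0 : 0 <= (2^-1 : R) by rewrite invr_ge0.
  have /cvg0P/(_ _ del0)[N /(_ N (leqnn _))] := geom_cvg0 (L + W) hh0 hh1.
  by move=> hN; exists N; exact: le_lt_trans (ler_norm _) hN.
have [[ax [xb [cy yd]]] bk] := stP k.
have := hx k; have := hy k; move: ax xb cy yd bk.
rewrite /bad; set X := (st k).1; set Y := (st k).2.
have l0 : 0 < L * h k by rewrite mulr_gt0.
have w0 : 0 < W * h k by rewrite mulr_gt0.
have e_lw : 4 * e * (L * h k + W * h k) ^+ 2 = eps * (L * h k) * (W * h k).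
  rewrite /e -mulrDl exprMn; field.
  by rewrite gt_eqF.
move: hk l0 w0 e_lw; rewrite mulrDl.
set l := L * h k; set w := W * h k => hk l0 w0 e_lw ax xb cy yd bk /andP[y1 y2] /andP[x1 x2].
have rem s t : X <= s <= X + l -> Y <= t <= Y + w ->
    `|p s t - p x y - al * (s - x) - be * (t - y)| <= e * (l + w) /\
    `|q s t - q x y - ga * (s - x) + al * (t - y)| <= e * (l + w).
  move=> /andP[s1 s2] /andP[t1 t2].
  have sx : `|s - x| <= l by rewrite ler_norml; apply/andP; split; lra.
  have ty : `|t - y| <= w by rewrite ler_norml; apply/andP; split; lra.
  have [||||A1 A2] := hd s t; try (by apply/andP; split; lra); try lra.
  have B : e * (`|s - x| + `|t - y|) <= e * (l + w) by rewrite ler_wpM2l ?lerD// ltW.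
  by split; [exact: le_trans A1 B|exact: le_trans A2 B].
have F1 : `|oint Y (Y + w) (fun t => p (X + l) t - p X t) - al * l * (Y + w - Y)|
    <= 2 * (e * (l + w)) * (Y + w - Y).
  apply: oint_near; first by lra.
    by apply: ipp; try lra; apply/andP; split; lra.
  move=> t tY.
  have [|//|r1 _] := rem (X + l) t; first by apply/andP; split; lra.
  have [|//|r2 _] := rem X t; first by apply/andP; split; lra.
  have -> : p (X + l) t - p X t - al * l =
    (p (X + l) t - p x y - al * (X + l - x) - be * (t - y)) -
    (p X t - p x y - al * (X - x) - be * (t - y)) by ring.
  by rewrite (le_trans (ler_normB _ _))//; lra.
have F2 : `|oint X (X + l) (fun s => q s (Y + w) - q s Y) - (- al * w) * (X + l - X)|
    <= 2 * (e * (l + w)) * (X + l - X).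
  apply: oint_near; first by lra.
    by apply: iqq; try lra; apply/andP; split; lra.
  move=> s sX.
  have [//||_ r1] := rem s (Y + w); first by apply/andP; split; lra.
  have [//||_ r2] := rem s Y; first by apply/andP; split; lra.
  have -> : q s (Y + w) - q s Y - - al * w =
    (q s (Y + w) - q x y - ga * (s - x) + al * (Y + w - y)) -
    (q s Y - q x y - ga * (s - x) + al * (Y - y)) by ring.
  by rewrite (le_trans (ler_normB _ _))//; lra.
move: bk; rewrite -e_lw /flux.
set I1 := oint Y _ _ in F1 *; set I2 := oint X _ _ in F2 *.
(* The terms in [al] cancel between the two pairs of sides. *)
have -> : I1 + I2 = (I1 - al * l * (Y + w - Y)) + (I2 - (- al * w) * (X + l - X)) by ring.
move=> /lt_le_trans /(_ (ler_normD _ _)).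
move: F1 F2; set N1 := `|_|; set N2 := `|_| => F1 F2.
have E : 2 * (e * (l + w)) * (Y + w - Y) + 2 * (e * (l + w)) * (X + l - X) =
   2 * (e * (l + w) ^+ 2) by ring.
have pos : 0 < e * (l + w) ^+ 2 by rewrite mulr_gt0// exprn_gt0// addr_gt0.
have -> : 4 * e * (l + w) ^+ 2 = 4 * (e * (l + w) ^+ 2) by ring.
lra.
Qed.

End Goursat.

Lemma goursat (R : realType) (p q : R -> R -> R) (a b c d : R) : a < b -> c < d ->
  (forall s t, a <= s <= b -> c <= t <= d ->
  exists al be ga : R, forall e, 0 < e -> exists2 del : R, 0 < del &
    forall s' t', a <= s' <= b -> c <= t' <= d -> `|s' - s| < del -> `|t' - t| < del ->
      `|p s' t' - p s t - al * (s' - s) - be * (t' - t)| <= e * (`|s' - s| + `|t' - t|) /\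
      `|q s' t' - q s t - ga * (s' - s) + al * (t' - t)| <= e * (`|s' - s| + `|t' - t|)) ->
  flux p q a b c d = 0.
Proof.
move=> ab cd hd; apply/eqP; rewrite -normr_eq0; apply/negPn/negP => n0.
have F0 : 0 < `|flux p q a b c d| by rewrite lt_def n0 normr_ge0.
have L0 : 0 < b - a by rewrite subr_gt0.
have W0 : 0 < d - c by rewrite subr_gt0.
pose e := `|flux p q a b c d| / ((b - a) * (d - c)) / 2.
have e0 : 0 < e by rewrite !divr_gt0// mulr_gt0.
have := goursat_eps ab cd hd e0.
have -> : e * (b - a) * (d - c) = `|flux p q a b c d| / 2.
  by rewrite /e; field; rewrite !gt_eqF.
lra.
Qed.

(** * Complex derivatives and the exponential *)

Section ComplexDerivative.
Variable R : realType.
Local Notation C := R[i].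
Implicit Types (f g : C -> C) (z w d : C).

(** Differentiability without a quotient, so that [w = z] is not a separate case in the chain and
    product rules. *)
Definition cdiff g z d : Prop := forall e : R, 0 < e -> exists2 del : R, 0 < del &
  forall w, cabs (w - z) < del -> cabs (g w - g z - d * (w - z)) <= e * cabs (w - z).

Lemma holo_cdiff (U : set C) f z : holo_on U f -> U z -> exists d, cdiff f z d.
Proof.
move=> h /h[d hd]; exists d => e e0; have [del del0 hdel] := hd e e0.
exists del => // w wz; have [->|nwz] := eqVneq w z.
  by rewrite !subrr mulr0 subrr cabs0 mulr0.
have n0 : w - z != 0 by rewrite subr_eq0.
have {}hdel := hdel w; rewrite cabs_gt0// wz in hdel; have {}hdel := ltW (hdel isT).
have -> : f w - f z - d * (w - z) = ((f w - f z) / (w - z) - d) * (w - z) by field.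
by rewrite cabsM ler_wpM2r ?cabs_ge0.
Qed.

Lemma cdiff_lip g z d : cdiff g z d -> exists2 del : R, 0 < del &
  forall w, cabs (w - z) < del -> cabs (g w - g z) <= (cabs d + 1) * cabs (w - z).
Proof.
move=> h; have [del del0 hd] := h 1 ltr01; exists del => // w /hd h1.
rewrite -[X in cabs X](subrK (d * (w - z))) (le_trans (cabsD _ _))// mulrDl -cabsM addrC.
by rewrite lerD2l.
Qed.

Lemma cdiff_ccont g z d : cdiff g z d -> ccont g z.
Proof.
move=> /cdiff_lip[del del0 hd] e e0.
have K0 : 0 < cabs d + 1 by rewrite ltr_wpDl ?cabs_ge0.
exists (Num.min del (e / (cabs d + 1))); first by rewrite lt_min del0 divr_gt0.
move=> w; rewrite lt_min => /andP[w1 w2]; rewrite (le_lt_trans (hd w w1))//.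
by rewrite mulrC -ltr_pdivlMr.
Qed.

Lemma cdiff_comp f g z d d' : cdiff g z d -> cdiff f (g z) d' ->
  cdiff (fun w => f (g w)) z (d' * d).
Proof.
move=> hg hf e e0.
have [a a0 ha] := cdiff_lip hg.
have A0 := cabs_ge0 d; have B0 := cabs_ge0 d'.
pose e1 := e / 2 / (cabs d + 1); pose e2 := e / 2 / (cabs d' + 1).
have e10 : 0 < e1 by rewrite !divr_gt0//; lra.
have e20 : 0 < e2 by rewrite !divr_gt0//; lra.
have [r r0 hr] := hf e1 e10.
have [q q0 hq] := cdiff_ccont hg r0.
have [p p0 hp] := hg e2 e20.
exists (Num.min a (Num.min q p)); first by rewrite !lt_min a0 q0 p0.
move=> w; rewrite !lt_min => /and3P[wa wq wp].
have -> : f (g w) - f (g z) - d' * d * (w - z) =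
  (f (g w) - f (g z) - d' * (g w - g z)) + d' * (g w - g z - d * (w - z)) by ring.
apply: (le_trans (cabsD _ _)); rewrite cabsM (splitr e) mulrDl; apply: lerD.
  apply: (le_trans (hr _ (hq _ wq))).
  apply: (le_trans (ler_wpM2l (ltW e10) (ha _ wa))).
  by rewrite mulrA /e1 divfK// gt_eqF//; lra.
apply: (le_trans (ler_wpM2l B0 (hp _ wp))).
rewrite mulrA ler_wpM2r ?cabs_ge0//.
have E : e2 * (cabs d' + 1) = e / 2 by rewrite /e2 divfK// gt_eqF//; lra.
nra.
Qed.

Lemma cdiffM f g z d d' : cdiff f z d -> cdiff g z d' ->
  cdiff (fun w => f w * g w) z (d * g z + f z * d').
Proof.
move=> hf hg e e0.
have A0 := cabs_ge0 d; have B0 := cabs_ge0 (f z); have G0 := cabs_ge0 (g z).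
pose K := cabs d + cabs (f z) + cabs (g z) + 1; have K0 : 0 < K by rewrite /K; lra.
pose e1 := e / K; have e10 : 0 < e1 by rewrite divr_gt0.
have [a a0 ha] := hf e1 e10; have [b b0 hb] := hg e1 e10.
have [r r0 hr] := cdiff_ccont hg e10; have [q q0 hq] := cdiff_ccont hg ltr01.
exists (Num.min (Num.min a b) (Num.min r q)); first by rewrite !lt_min a0 b0 r0 q0.
move=> w; rewrite !lt_min => /andP[/andP[/ha wa /hb wb] /andP[/hr wr /hq wq]].
have -> : f w * g w - f z * g z - (d * g z + f z * d') * (w - z) =
  (f w - f z - d * (w - z)) * g w + (d * (w - z) * (g w - g z) +
   f z * (g w - g z - d' * (w - z))) by ring.
have gw : cabs (g w) <= cabs (g z) + 1.
  by rewrite -(subrK (g z) (g w)) (le_trans (cabsD _ _))// addrC lerD2l ltW.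
apply: (le_trans (cabsD _ _)); rewrite cabsM.
have h2 := cabsD (d * (w - z) * (g w - g z)) (f z * (g w - g z - d' * (w - z))).
rewrite !cabsM in h2.
set H := cabs (w - z) in wa wb h2 *; have H0 : 0 <= H by exact: cabs_ge0.
have t1 : cabs (f w - f z - d * (w - z)) * cabs (g w) <= e1 * H * (cabs (g z) + 1).
  by apply: ler_pM; rewrite ?cabs_ge0.
have t2 : cabs d * H * cabs (g w - g z) <= cabs d * H * e1.
  by rewrite ler_wpM2l ?mulr_ge0// ltW.
have t3 : cabs (f z) * cabs (g w - g z - d' * (w - z)) <= cabs (f z) * (e1 * H).
  by rewrite ler_wpM2l.
have -> : e * H = e1 * H * (cabs (g z) + 1) + cabs d * H * e1 + cabs (f z) * (e1 * H).
  have -> : e = e1 * K by rewrite /e1 divfK// gt_eqF.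
  by rewrite /K; ring.
lra.
Qed.

Lemma cdiff_linear (c : C) z : cdiff (fun w => c * w) z c.
Proof.
move=> e e0; exists 1 => // w _.
have -> : c * w - c * z - c * (w - z) = 0 by ring.
by rewrite cabs0 mulr_ge0 ?cabs_ge0// ltW.
Qed.

Definition cexp z : C := Complex (expR (complex.Re z)) 0 * cexpi (complex.Im z).

Lemma cexpD z w : cexp (z + w) = cexp z * cexp w.
Proof.
rewrite /cexp ReD ImD expRD cexpiD mulrACA; congr (_ * _).
by apply: eqC => /=; ring.
Qed.

Lemma cexp_polar (s t : R) : cexp (Complex s t) = Complex (expR s) 0 * cexpi t.
Proof. by []. Qed.

Lemma cabs_cexp z : cabs (cexp z) = expR (complex.Re z).
Proof. by rewrite cabs_polar// expR_ge0. Qed.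

Lemma cexp0 : cexp 0 = 1.
Proof. by rewrite /cexp/= expR0 cexpi0 mulr1. Qed.

Lemma real_diff (F : R -> R) (l : R) : is_derive (0 : R) 1 F l -> forall e, 0 < e ->
  exists2 del : R, 0 < del & forall x, `|x| < del -> `|F x - F 0 - l * x| <= e * `|x|.
Proof.
move=> [dF vF] e e0.
have cv : (fun h => h^-1 *: ((F \o shift 0) (h *: (1 : R)) - F 0)) @ (0 : R)^' --> l.
  by rewrite -vF; exact: dF.
move/cvgrPdist_le : cv => /(_ e e0) /nbhs_ballP[del /= del0 hd].
exists del => // x xd; have [->|x0] := eqVneq x 0.
  by rewrite subrr mulr0 subrr normr0 mulr0.
have := hd x; rewrite /ball/= sub0r normrN => /(_ xd x0).
rewrite -[_ *: (1 : R)]/(x * 1) mulr1 addr0 -[_ *: _]/(_ * _) => h.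
have -> : F x - F 0 - l * x = - (l - x^-1 * (F x - F 0)) * x by field.
by rewrite normrM normrN ler_wpM2r.
Qed.

Lemma cdiff_cexp0 : cdiff cexp 0 1.
Proof.
move=> e e0.
(* The three pieces of the error contribute 4, 1 and 1 times [e1 * H], which [e / 7] covers. *)
have [e1 [e10 e11 e1e]] : exists e1 : R, [/\ 0 < e1, e1 <= 1 & e1 <= e / 7].
  exists (Num.min 1 (e / 7)); rewrite lt_min ltr01 divr_gt0// !ge_min !lexx orbT.
  by split.
have [a a0 ha] := real_diff (is_derive_expR 0) e10.
have [b b0 hb] := real_diff (is_derive_cos 0) e10.
have [r r0 hr] := real_diff (is_derive_sin 0) e10.
exists (Num.min (Num.min a b) (Num.min r (e1 / 2))); first by rewrite !lt_min a0 b0 r0 divr_gt0.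
case=> x y; rewrite subr0 !lt_min => /andP[/andP[wa wb] /andP[wr we]].
move: wa wb wr we (Re_le_cabs (Complex x y)) (Im_le_cabs (Complex x y)) (cabs_ge0 (Complex x y)).
move=> /=; move: (cabs (Complex x y)) => H wa wb wr we xH yH H0.
have {}ha := ha x (le_lt_trans xH wa); have {}hb := hb y (le_lt_trans yH wb).
have {}hr := hr y (le_lt_trans yH wr).
rewrite expR0 cos0 sin0 oppr0 mul0r subr0 mul1r in ha hb hr.
rewrite addr0 mul1r in hr.
have ex1 : `|expR x - 1| <= e1.
  rewrite -[X in `|X|](subrK x) (le_trans (ler_normD _ _))//.
  have A : e1 * `|x| <= H by rewrite (le_trans _ xH)// ler_piMl.
  apply: (le_trans (lerD (le_trans ha A) xH)); lra.
have ex2 : `|expR x| <= 2.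
  rewrite -[X in `|X|](subrK 1) (le_trans (ler_normD _ _))// normr1; lra.
have eq : cexp (Complex x y) - cexp 0 - 1 * Complex x y =
  Complex (expR x) 0 * Complex (cos y - 1) (sin y - y) +
  (Complex (expR x - 1) 0 * Complex 0 y + Complex (expR x - 1 - x) 0).
  by rewrite cexp0 cexp_polar; apply: eqC; rewrite ?(ReD,ImD,ReN,ImN,ReM,ImM)/=; ring.
rewrite eq; apply: (le_trans (cabsD _ _)).
have cr (v : R) : cabs (Complex v 0) = `|v|.
  by rewrite /cabs/= expr0n/= addr0 sqrtr_sqr.
have ci (v : R) : cabs (Complex 0 v) = `|v|.
  by rewrite /cabs/= expr0n/= add0r sqrtr_sqr.
have h2 := cabsD (Complex (expR x - 1) 0 * Complex 0 y) (Complex (expR x - 1 - x) 0).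
rewrite cabsM cr; rewrite cabsM !cr ci in h2.
have h3 := cabs_le_ReIm (Complex (cos y - 1) (sin y - y)); rewrite /= in h3.
have t1 : `|expR x| * cabs (Complex (cos y - 1) (sin y - y)) <= 2 * (2 * (e1 * H)).
  apply: ler_pM => //; first exact: cabs_ge0.
  apply: (le_trans h3).
  have A : e1 * `|y| <= e1 * H by rewrite ler_wpM2l// ltW.
  apply: (le_trans (lerD (le_trans hb A) (le_trans hr A))); lra.
have t2 : `|expR x - 1| * `|y| <= e1 * H by apply: ler_pM.
have t3 : e1 * `|x| <= e1 * H by rewrite ler_wpM2l// ltW.
have t4 : e1 * H <= e / 7 * H by rewrite ler_wpM2r.
have t5 : 0 <= e * H by rewrite mulr_ge0// ltW.
apply: (le_trans (lerD t1 (le_trans h2 (lerD t2 (le_trans ha t3))))); lra.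
Qed.

Lemma cdiff_cexp z : cdiff cexp z (cexp z).
Proof.
move=> e e0; have E0 : 0 < cabs (cexp z) by rewrite cabs_cexp expR_gt0.
have [del del0 hd] := cdiff_cexp0 (divr_gt0 e0 E0); exists del => // w wz.
have {}hd := hd (w - z); rewrite subr0 in hd; have {}hd := hd wz.
have -> : cexp w - cexp z - cexp z * (w - z) =
    cexp z * (cexp (w - z) - cexp 0 - 1 * (w - z)).
  have -> : cexp w = cexp z * cexp (w - z) by rewrite -cexpD addrC subrK.
  by rewrite cexp0; ring.
rewrite cabsM; apply: (le_trans (ler_wpM2l (ltW E0) hd)).
by rewrite mulrA [cabs _ * _]mulrC divfK// gt_eqF.
Qed.

Lemma cexpi_period (t : R) n : cexpi (t + n%:R * (2 * pi)) = cexpi t.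
Proof. by rewrite cexpiD /cexpi cos_2pi_nat sin_2pi_nat mulr1. Qed.

Lemma cexpi_reduce (t : R) : exists2 t', 0 <= t' <= 2 * pi & cexpi t = cexpi t'.
Proof.
have pi0 : 0 < 2 * pi :> R by rewrite mulr_gt0// pi_gt0.
pose k := Num.floor (t / (2 * pi)).
have k1 := floor_le_tmp (t / (2 * pi)); have k2 := floorD1_gt (t / (2 * pi)).
rewrite -/k in k1 k2; rewrite intrD in k2.
exists (t - k%:~R * (2 * pi)).
  rewrite ler_pdivlMr// in k1; rewrite ltr_pdivrMr// mulrDl mul1r in k2.
  by apply/andP; split; lra.
case: k {k1 k2} => n.
  by rewrite -[in LHS](subrK (n%:R * (2 * pi)) t) cexpi_period.
by rewrite NegzE mulrNz mulNr opprK; exact/esym/(cexpi_period t n.+1).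
Qed.

End ComplexDerivative.

(** * Cauchy estimates on a circle larger than the unit circle *)

Section GeometricDecay.
Variable R : realType.
Local Notation C := R[i].
Local Notation mu := (@lebesgue_measure R).
Variables (U : set C) (f : C -> C).
Hypotheses (oU : copen U) (dU : cdisc_closure (R := R) `<=` U) (hf : holo_on U f).

(** Compactness in logarithmic coordinates: near each point of [[0, 2 * pi]] some strip
    [0 <= s <= i] stays in [U], and compactness gives a common width. Periodicity covers the other
    [t], and [s <= 0] gives points of the closed disc. *)
Lemma collar : exists2 eta : R, 0 < eta & forall s t, s <= eta -> U (cexp (Complex s t)).
Proof.
have : near_covering (`[0, 2 * pi]%classic : set R).
  by apply/compact_near_coveringP; exact: segment_compact.
move=> /(_ R (nbhs (0 : R)) (fun i t => forall s, 0 <= s <= i -> U (cexp (Complex s t)))).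
case.
  move=> t _.
  have [r r0 hr] : exists2 r : R, 0 < r & cball (cexp (Complex 0 t)) r `<=` U.
    by apply: oU; apply: dU; rewrite /cdisc_closure/= cabs_cexp/= expR0.
  have [del del0 hd] := cdiff_ccont (cdiff_cexp (Complex 0 t)) r0.
  have d2 : 0 < del / 2 by rewrite divr_gt0.
  exists (ball t (del / 2), ball (0 : R) (del / 2)) => /=.
    by split; exact: nbhsx_ballx.
  case=> t' i /= []; rewrite /ball/= sub0r normrN => tt ii s /andP[s0 si].
  apply: hr; apply: hd; apply: (le_lt_trans (cabs_le_ReIm _)).
  rewrite ReD ImD ReN ImN/= subr0 (splitr del) ltrD//.
    by rewrite ger0_norm// (le_lt_trans si)// (le_lt_trans (ler_norm _)).
  by rewrite distrC.
move=> e /= e0 he.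
exists (e / 2); first by rewrite divr_gt0.
move=> s t se; have [s0|s0] := leP s 0.
  apply: dU; rewrite /cdisc_closure/= cabs_cexp/=.
  by rewrite -(expR0 R) ler_expR.
have [t' t'pi tt] := cexpi_reduce t.
have -> : cexp (Complex s t) = cexp (Complex s t') by rewrite !cexp_polar tt.
apply: (he (e / 2)).
- rewrite /ball_/= sub0r normrN ger0_norm; last by rewrite divr_ge0// ltW.
  by rewrite ltr_pdivrMr// ltr_pMr// ltr1n.
- by rewrite /= in_itv.
- by rewrite (ltW s0).
Qed.

Variable fh : nat -> C.
Hypothesis ps : is_ps fh f.

(** In the coordinate [w = log z] an annulus becomes a rectangle, and the mean of [G n] over a
    vertical segment of length [2 * pi] is the Cauchy integral for the coefficient of index [n]. *)
Let G (n : nat) (w : C) : C := f (cexp w) * cexp (- n%:R * w).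

Let cexpX (n : nat) (w : C) : cexp (n%:R * w) = cexp w ^+ n.
Proof.
elim: n => [|n IH]; first by rewrite mul0r cexp0 expr0.
by rewrite exprS -IH -cexpD -[n.+1]addn1 natrD mulrDl mul1r addrC.
Qed.

Let cexp_neq0 (w : C) : cexp w != 0.
Proof.
have : 0 < cabs (cexp w) by rewrite cabs_cexp expR_gt0.
by apply: contraTneq => ->; rewrite cabs0 ltxx.
Qed.

Let cexpN (n : nat) (w : C) : cexp (- n%:R * w) = (cexp w ^+ n)^-1.
Proof.
have n0 : cexp w ^+ n != 0 by rewrite expf_neq0.
by apply: (mulfI n0); rewrite divff// -cexpX -cexpD mulNr subrr cexp0.
Qed.

Let pathC (s t s' t' : R) : cabs (Complex s' t' - Complex s t) <= `|s' - s| + `|t' - t|.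
Proof. exact: cabs_le_ReIm. Qed.

Let G_cdiff n w : U (cexp w) -> exists d, cdiff (G n) w d.
Proof.
move=> Uw; have [d hd] := holo_cdiff hf Uw.
have h1 := cdiff_comp (cdiff_cexp w) hd.
have h2 := cdiff_comp (cdiff_linear (- n%:R) w) (cdiff_cexp (- n%:R * w)).
by eexists; exact: cdiffM h1 h2.
Qed.

Let line_tcont (g : C -> C) s : (forall t, ccont g (Complex s t)) ->
  tcont (fun t => g (Complex s t)).
Proof.
move=> cg t e e0; have [del del0 hd] := cg t e e0; exists del => // t' tt.
by apply: hd; apply: (le_lt_trans (pathC _ _ _ _)); rewrite subrr normr0 add0r.
Qed.

Let G_tcont n s : (forall t, U (cexp (Complex s t))) -> tcont (fun t => G n (Complex s t)).
Proof.
move=> hU; apply: line_tcont => t; have [d hd] := G_cdiff n (hU t).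
exact: cdiff_ccont hd.
Qed.

Let G_period n s : G n (Complex s (2 * pi)) = G n (Complex s 0).
Proof.
have e : cexp (Complex s (2 * pi)) = cexp (Complex s 0).
  by rewrite !cexp_polar -[2 * pi]add0r -[2 * pi]mul1r (cexpi_period 0 1).
by rewrite /G !cexpN e.
Qed.

(** By Cauchy-Riemann the fields (Re G, - Im G) and (Im G, Re G) are divergence free, so [goursat]
    applies to each. Periodicity cancels the sides [t = 0] and [t = 2 * pi], and what remains is the
    equality of the means. *)
Let mean_invariant n (a b : R) : a < b -> (forall s t, s <= b -> U (cexp (Complex s t))) ->
  cmean (fun t => G n (Complex a t)) = cmean (fun t => G n (Complex b t)).
Proof.
move=> ab hU; have pi0 : 0 < 2 * pi :> R by rewrite mulr_gt0// pi_gt0.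
have loc s t : s <= b -> exists d : C, forall e, 0 < e -> exists2 del : R, 0 < del &
    forall s' t', `|s' - s| < del -> `|t' - t| < del ->
    cabs (G n (Complex s' t') - G n (Complex s t) - d * (Complex s' t' - Complex s t))
      <= e * (`|s' - s| + `|t' - t|).
  move=> sb; have [d hd] := G_cdiff n (hU s t sb); exists d => e e0.
  have [del del0 hdel] := hd e e0; exists (del / 2); first by rewrite divr_gt0.
  move=> s' t' h1 h2; have hst := pathC s t s' t'.
  have /hdel h : cabs (Complex s' t' - Complex s t) < del.
    by rewrite (le_lt_trans hst)// (splitr del) ltrD.
  by rewrite (le_trans h)// ler_wpM2l// ltW.
have ReE (x y d h : C) : complex.Re (x - y - d * h) = complex.Re x - complex.Re y -
    (complex.Re d * complex.Re h - complex.Im d * complex.Im h).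
  by rewrite ReD ReN ReM ReD ReN.
have ImE (x y d h : C) : complex.Im (x - y - d * h) = complex.Im x - complex.Im y -
    (complex.Re d * complex.Im h + complex.Im d * complex.Re h).
  by rewrite ImD ImN ImM ImD ImN.
have gen (p q : R -> R -> R) : (forall s, q s (2 * pi) = q s 0) ->
    (forall s, s <= b -> continuous (p s)) ->
    (forall s t, a <= s <= b -> 0 <= t <= 2 * pi ->
      exists al be ga : R, forall e, 0 < e -> exists2 del : R, 0 < del &
      forall s' t', a <= s' <= b -> 0 <= t' <= 2 * pi -> `|s' - s| < del -> `|t' - t| < del ->
      `|p s' t' - p s t - al * (s' - s) - be * (t' - t)| <= e * (`|s' - s| + `|t' - t|) /\
      `|q s' t' - q s t - ga * (s' - s) + al * (t' - t)| <= e * (`|s' - s| + `|t' - t|)) ->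
    rmean (p a) = rmean (p b).
  move=> qper cp hd; have := goursat ab pi0 hd; rewrite /flux.
  have -> : oint a b (fun s => q s (2 * pi) - q s 0) = 0.
    rewrite -[RHS](mul0r (b - a)) -oint_cst ?ltW//.
    by apply: eq_Rintegral => s _; rewrite qper subrr.
  rewrite addr0 /oint RintegralB//; [|by apply: cont_integrable; apply: cp; rewrite ?lexx//; exact: ltW..].
  by move=> /eqP; rewrite subr_eq0 => /eqP h; rewrite /rmean h.
apply: eqC => /=.
  apply: (gen (fun s t => complex.Re (G n (Complex s t))) (fun s t => - complex.Im (G n (Complex s t)))).
  - by move=> s; rewrite G_period.
  - by move=> s sb; apply: tcont_Re; apply: G_tcont => t; exact: hU.
  move=> s t /andP[_ sb] _; have [d hd] := loc s t sb.
  exists (complex.Re d), (- complex.Im d), (- complex.Im d) => e e0.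
  have [del del0 hdel] := hd e e0; exists del => // s' t' _ _ h1 h2.
  have {}hdel := hdel s' t' h1 h2.
  split; apply: le_trans hdel.
    apply: le_trans (Re_le_cabs _); rewrite (ReE, ImE)/=.
    by rewrite le_eqVlt; apply/orP; left; apply/eqP; congr (`| _ |); ring.
  apply: le_trans (Im_le_cabs _); rewrite -normrN (ReE, ImE)/=.
  by rewrite le_eqVlt; apply/orP; left; apply/eqP; congr (`| _ |); ring.
apply: (gen (fun s t => complex.Im (G n (Complex s t))) (fun s t => complex.Re (G n (Complex s t)))).
- by move=> s; rewrite G_period.
- by move=> s sb; apply: tcont_Im; apply: G_tcont => t; exact: hU.
move=> s t /andP[_ sb] _; have [d hd] := loc s t sb.
exists (complex.Im d), (complex.Re d), (complex.Re d) => e e0.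
have [del del0 hdel] := hd e e0; exists del => // s' t' _ _ h1 h2.
have {}hdel := hdel s' t' h1 h2.
split; apply: le_trans hdel.
  apply: le_trans (Im_le_cabs _); rewrite (ReE, ImE)/=.
  by rewrite le_eqVlt; apply/orP; left; apply/eqP; congr (`| _ |); ring.
apply: le_trans (Re_le_cabs _); rewrite (ReE, ImE)/=.
by rewrite le_eqVlt; apply/orP; left; apply/eqP; congr (`| _ |); ring.
Qed.

(** The abscissa -1 corresponds to the circle of radius [expR (-1)], inside the disc, where the
    power series determines the mean. *)
Let coef_mean n : cmean (fun t => G n (Complex (-1) t)) = fh n.
Proof.
pose r : R := expR (-1).
have r0 : 0 < r by exact: expR_gt0.
have r1 : r < 1 by rewrite -(expR0 R) ltr_expR ltrN10.
have cX : dcont (fun z : C => f z * conjc (z ^+ n)).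
  apply: dcontM; first by apply: has_ps_dcont; exists fh.
  exact/dcont_conj/dcontX.
pose c : C := Complex r 0 ^+ (2 * n).
have c0 : c != 0 by rewrite expf_neq0// eq_complex/= eqxx andbT gt_eqF.
transitivity (cm r (fun z => c^-1 * (f z * conjc (z ^+ n)))).
  congr cmean; apply/funext => t; rewrite /G cexpN cexp_polar -/r.
  set z := Complex r 0 * cexpi t.
  have z0 : z ^+ n != 0 by rewrite expf_neq0// /z -cexp_polar cexp_neq0.
  have E : z ^+ n * conjc (z ^+ n) = c.
    rewrite mul_conj cabsX /z cabs_polar ?ltW// /c -(rmorphXn (real_complex R)).
    by rewrite mulnC exprM.
  have y0 : conjc (z ^+ n) != 0 by rewrite conjc_eq0.
  by rewrite -E invfM -[LHS]mulr1 -(divff y0); ring.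
rewrite cmZ// ?ltW// (cm_coef (ltW r0) r1 n ps) -/c.
by rewrite mulrC mulfK.
Qed.

(** Cauchy's estimate on the circle of radius [expR eta], which exceeds one; the 2 in the constant
    is that of [cmean_le]. *)
Lemma geometric_decay : exists K rho : R,
  [/\ 0 <= rho, rho < 1 & forall k, cabs (fh k) <= K * rho ^+ k].
Proof.
have [eta eta0 hU] := collar.
pose u t := cabs (f (cexp (Complex eta t))).
have ab : -1 < eta by rewrite (lt_trans _ eta0)// ltrN10.
have cu : continuous u.
  apply: (@tcont_real _ _ (fun t => f (cexp (Complex eta t)))).
    apply: (line_tcont (g := fun w => f (cexp w))) => t.
    have [d hd] := holo_cdiff hf (hU eta t (lexx _)).
    exact: cdiff_ccont (cdiff_comp (cdiff_cexp _) hd).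
  move=> s t; rewrite /u ler_norml; apply/andP; split.
    rewrite lerNl opprB lerBlDr -[X in cabs X <= _](subrK (f (cexp (Complex eta s)))).
    by rewrite (le_trans (cabsD _ _))// cabsC.
  rewrite lerBlDr -[X in cabs X <= _](subrK (f (cexp (Complex eta t)))).
  by rewrite (le_trans (cabsD _ _)).
exists (2 * rmean u), (expR (- eta)); split; first exact: expR_ge0.
  by rewrite -(expR0 R) ltr_expR oppr_lt0.
move=> n; rewrite -coef_mean (mean_invariant n ab hU).
rewrite -mulrA [rmean u * _]mulrC -rmeanZ//; apply: cmean_le.
- by apply: G_tcont => t; exact: hU.
- by move=> t; apply: cvgMr; exact: cu.
move=> t; rewrite /G cexpN cabsM cabsV cabsX cabs_cexp/= mulrC.
by rewrite expRN -exprVn.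
Qed.

End GeometricDecay.

(** * Matrix series, entry by entry *)

Section MatrixSeries.
Variable R : realType.
Local Notation C := R[i].

Lemma mnorm2_ge0 p q (M : 'M[C]_(p, q)) : 0 <= mnorm2 M.
Proof. by apply: sumr_ge0 => i _; apply: sumr_ge0 => j _; exact: sqr_ge0. Qed.

Lemma entry_le_mnorm2 p q (M : 'M[C]_(p, q)) i j : cabs (M i j) ^+ 2 <= mnorm2 M.
Proof.
rewrite /mnorm2 (bigD1 i)//= (bigD1 j)//= -addrA lerDl.
apply: addr_ge0; first by apply: sumr_ge0 => k _; exact: sqr_ge0.
by apply: sumr_ge0 => k _; apply: sumr_ge0 => l _; exact: sqr_ge0.
Qed.

Lemma sqr_lt_cabs (x : C) (e : R) : 0 < e -> cabs x ^+ 2 < e ^+ 2 -> cabs x < e.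
Proof. by move=> e0; rewrite ltr_pXn2r// nnegrE ?cabs_ge0// ltW. Qed.

Lemma sqr_le_cabs (x : C) (e : R) : 0 <= e -> cabs x ^+ 2 <= e ^+ 2 -> cabs x <= e.
Proof. by move=> e0; rewrite ler_pXn2r// nnegrE ?cabs_ge0. Qed.

Lemma cvg0_sum (I : Type) (s : seq I) (F : I -> nat -> R) :
  (forall i, F i @ \oo --> (0 : R)) ->
  (fun N => \sum_(i <- s) F i N) @ \oo --> (0 : R).
Proof.
move=> h; elim: s => [|i s IH].
  rewrite (_ : (fun N => _) = (fun=> 0)); first exact: cvg_cst.
  by apply/funext => N; rewrite big_nil.
rewrite (_ : (fun N => _) = (fun N => F i N + \sum_(j <- s) F j N)).
  by rewrite -[X in _ --> X]addr0; exact: cvgD (h i) IH.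
by apply/funext => N; rewrite big_cons.
Qed.

Lemma mnorm2_entries p q (u : nat -> 'M[C]_(p, q)) (S : 'M[C]_(p, q)) :
  (fun N => mnorm2 (u N - S)) @ \oo --> (0 : R) <->
  forall i j, tends (fun N => u N i j) (S i j).
Proof.
split=> [/cvg0P h i j e e0|h].
  have [N hN] := h _ (exprn_gt0 2 e0); exists N => m /hN hm.
  apply: sqr_lt_cabs => //; apply: le_lt_trans hm; rewrite ger0_norm ?mnorm2_ge0//.
  by rewrite (le_trans _ (entry_le_mnorm2 _ i j))// !mxE.
rewrite (_ : (fun N => mnorm2 (u N - S)) =
  (fun N => \sum_i \sum_j cabs (u N i j - S i j) ^+ 2)); last first.
  by apply/funext => N; apply: eq_bigr => i _; apply: eq_bigr => j _; rewrite !mxE.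
apply: (@cvg0_sum _ _ (fun i N => \sum_j cabs (u N i j - S i j) ^+ 2)) => i.
apply: (@cvg0_sum _ _ (fun j N => cabs (u N i j - S i j) ^+ 2)) => j.
apply/cvg0P => e e0.
have m0 : 0 < Num.min 1 e by rewrite lt_min ltr01.
have [N hN] := h i j _ m0; exists N => m /hN.
rewrite lt_min => /andP[h1 h2]; rewrite ger0_norm ?sqr_ge0//.
by apply: le_lt_trans h2; rewrite expr2 ler_piMr ?cabs_ge0// ltW.
Qed.

Lemma mx_series_entries p q (u : nat -> 'M[C]_(p, q)) (S : 'M[C]_(p, q)) :
  mx_series_to u S <-> forall i j, tends (fun N => \sum_(k < N) u k i j) (S i j).
Proof.
rewrite /mx_series_to mnorm2_entries; split=> h i j; apply: tends_eq (h i j) => N;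
  by rewrite summxE.
Qed.

Lemma mx_series_ps p q (u : nat -> 'M[C]_(p, q)) (G : C -> 'M[C]_(p, q)) :
  (forall z, cdisc z -> mx_series_to (fun k => z ^+ k *: u k) (G z)) <->
  forall i j, is_ps (fun k => u k i j) (fun z => G z i j).
Proof.
split=> [h i j z Dz|h z Dz].
  have /mx_series_entries/(_ i j) := h z Dz; apply: tends_eq => N.
  by apply: eq_bigr => k _; rewrite mxE mulrC.
apply/mx_series_entries => i j; apply: tends_eq (h i j z Dz) => N.
by apply: eq_bigr => k _; rewrite mxE mulrC.
Qed.

(** [mx_sum] is a choice with default 0; once every entry converges a sum exists, and the choice is
    a genuine sum. *)
Lemma mx_sumE p q (u : nat -> 'M[C]_(p, q)) :
  (forall i j, exists S, tends (fun N => \sum_(k < N) u k i j) S) ->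
  forall i j, tends (fun N => \sum_(k < N) u k i j) (mx_sum u i j).
Proof.
move=> h; suff : mx_series_to u (mx_sum u) by move/mx_series_entries.
apply: (@xgetPex _ 0 [set S | mx_series_to u S]).
have /choice[S hS] : forall x : 'I_p * 'I_q, exists S,
    tends (fun N => \sum_(k < N) u k x.1 x.2) S by move=> x; exact: h.
exists (\matrix_(i, j) S (i, j)); apply/mx_series_entries => i j.
by rewrite mxE; exact: (hS (i, j)).
Qed.

Lemma geom_hardy n (g : C -> 'cV[C]_n) (a : nat -> 'cV[C]_n) (K t : R) :
  0 <= t -> t < 1 -> (forall k i, cabs (a k i 0) <= K * t ^+ k) ->
  (forall i, is_ps (fun k => a k i 0) (fun z => g z i 0)) -> hardy_coefs g a.
Proof.
move=> t0 t1 ha hg; split.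
  by apply/mx_series_ps => i j; rewrite (ord1 j); exact: hg.
apply: (@geom_dominated_cvg _ _ (n%:R * K ^+ 2) t t0 t1) => k.
rewrite ger0_norm ?mnorm2_ge0// /mnorm2.
apply: (@le_trans _ _ (\sum_(i < n) K ^+ 2 * t ^+ k)); last first.
  by rewrite sumr_const card_ord -[_ *+ n]mulr_natl mulrA.
apply: ler_sum => i _; rewrite big_ord1.
apply: (@le_trans _ _ ((K * t ^+ k) ^+ 2)).
  by rewrite lerXn2r ?nnegrE ?cabs_ge0 ?(le_trans (cabs_ge0 _) (ha k i)).
rewrite exprMn ler_wpM2l ?sqr_ge0// expr2 ler_piMr ?exprn_ge0//.
by rewrite exprn_ile1// ltW.
Qed.

End MatrixSeries.

(** * Outer matrix functions: invertibility and power series *)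

Section Outer.
Variables (R : realType) (n : nat).
Local Notation C := R[i].
Variable A : C -> 'M[C]_n.
Hypotheses (holA : mx_holo_on (@cdisc R) A) (outA : outer A).
Variable MA : R.
Hypothesis bndA : forall z, cdisc z -> mnorm2 (A z) <= MA.

Lemma dbounded_A i j : dbounded (fun z => A z i j).
Proof.
exists (1 + MA) => z Dz.
have := le_trans (entry_le_mnorm2 (A z) i j) (bndA Dz).
have := cabs_ge0 (A z i j); set x := cabs _ => x0 h.
have [x1|x1] := leP x 1; nra.
Qed.

(** Outerness is applied to the constant function [y]. The Hardy coefficients of [y - A P] show that
    [A P] has a power series, and their small square sum bounds the error at each point by
    [eval_bound]. *)
Lemma outer_approx_const (y : 'cV[C]_n) (e : R) : 0 < e ->
  exists P : 'cV[{poly C}]_n,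
    (forall i, has_ps (fun z => (A z *m peval P z) i 0)) /\
    forall z, cdisc z -> forall i,
      cabs (y i 0 - (A z *m peval P z) i 0) ^+ 2 * (1 - cabs z ^+ 2) <= e.
Proof.
move=> e0.
have hy : in_hardy (fun=> y).
  exists (fun k => (k == 0%N)%:R *: y).
  apply: (@geom_hardy _ _ _ _ (\sum_i cabs (y i 0)) 2^-1).
  - by rewrite invr_ge0.
  - by rewrite invf_lt1 ?ltr1n.
  - move=> k i; rewrite mxE; case: k => [|k] /=.
      rewrite mul1r expr0 mulr1 (bigD1 i)//= lerDl sumr_ge0// => j _; exact: cabs_ge0.
    rewrite mul0r cabs0 mulr_ge0 ?exprn_ge0 ?invr_ge0// sumr_ge0// => j _; exact: cabs_ge0.
  - move=> i z Dz; have := tendsZ (y i 0) (is_ps_mono 0 Dz).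
    rewrite expr0 mulr1; apply: tends_eq => N.
    by rewrite mulr_sumr; apply: eq_bigr => k _; rewrite mxE; ring.
have [P [b [[hb _] sb]]] := outA hy e0.
move/mx_series_ps : hb => hb; exists P.
have APE i z : (y - A z *m peval P z) i 0 = y i 0 - (A z *m peval P z) i 0 by rewrite !mxE.
have hps i : has_ps (fun z => y i 0 - (A z *m peval P z) i 0).
  apply: (@eq_has_ps _ (fun z => (y - A z *m peval P z) i 0)) => //.
  by exists (fun k => b k i 0); exact: hb.
have bd i : dbounded (fun z => (A z *m peval P z) i 0).
  have h : dbounded (fun z => \sum_j A z i j * (P j 0).[z]).
    elim: (index_enum _) => [|j s [M hM]].
      by exists 0 => z _; rewrite big_nil cabs0.
    have [L hL] := dboundedM (dbounded_A i j) (nice_horner (P j 0)).1.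
    exists (L + M) => z Dz; rewrite big_cons (le_trans (cabsD _ _))//.
    by rewrite lerD ?hM ?hL.
  have [M hM] := h; exists M => z Dz; rewrite mxE.
  apply: le_trans (hM z Dz); rewrite le_eqVlt; apply/orP; left; apply/eqP.
  by congr cabs; apply: eq_bigr => j _; rewrite mxE.
split=> [i|z Dz i].
  apply: (@eq_has_ps _ (fun z => y i 0 + -1 * (y i 0 - (A z *m peval P z) i 0))).
    by move=> z _; ring.
  by apply: has_psD; [exact: has_ps_cst|apply: has_psZ; exact: hps].
apply: (@eval_bound _ (fun z => y i 0 - (A z *m peval P z) i 0) z e 0) => //.
  split; last exact: hps.
  have [M hM] := bd i; exists (cabs (y i 0) + M) => w Dw.
  by rewrite (le_trans (cabsB _ _))// lerD2l hM.
move=> m _; apply: (@parseval_le _ _ (rr_ge0 R m) (rr_lt1 R m) (fun k => b k i 0)).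
  move=> w Dw; rewrite -APE; exact: hb Dw.
move=> N; apply: le_trans (sb N); apply: ler_sum => k _; exact: entry_le_mnorm2.
Qed.

Lemma outer_approx_at (y : 'cV[C]_n) z (d : R) : cdisc z -> 0 < d ->
  exists P : 'cV[{poly C}]_n,
    (forall i, has_ps (fun z => (A z *m peval P z) i 0)) /\
    forall i, cabs (y i 0 - (A z *m peval P z) i 0) <= d.
Proof.
move=> Dz d0; have /cdiscP z1 := Dz.
have w0 : 0 < 1 - cabs z ^+ 2 by rewrite subr_gt0 expr_lt1 ?cabs_ge0.
have e0 : 0 < d ^+ 2 * (1 - cabs z ^+ 2) by rewrite mulr_gt0// exprn_gt0.
have [P [h1 h2]] := outer_approx_const y e0; exists P; split=> // i.
by apply: sqr_le_cabs; [exact: ltW|have := h2 z Dz i; rewrite ler_pM2r].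
Qed.

Lemma sum_cabs_gt0 (v : 'rV[C]_n) : v != 0 -> 0 < \sum_j cabs (v 0 j).
Proof.
move=> v0; have [j vj] : exists j, v 0 j != 0.
  apply/existsP; apply: contraNT v0; rewrite negb_exists => /forallP h.
  apply/eqP/rowP => j; rewrite mxE; apply/eqP; exact: negbNE (h j).
rewrite (bigD1 j)//= ltr_wpDr ?cabs_gt0// sumr_ge0// => i _; exact: cabs_ge0.
Qed.

Lemma not_unitmx_ker (M : 'M[C]_n) : M \notin unitmx ->
  exists2 v : 'rV[C]_n, v != 0 & v *m M = 0.
Proof.
rewrite -row_free_unit -kermx_eq0 => /rowV0Pn[v /sub_kermxP vM v0].
by exists v.
Qed.

(** If [v] is a nonzero row with [v A(z) = 0], then [v] times [adj v - A(z) P(z)] equals [mnorm2 v]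
    for every [P], although [A(z) P(z)] can be brought close to [adj v]. *)
Lemma outer_unitmx z : cdisc z -> A z \in unitmx.
Proof.
move=> Dz; case: (boolP (A z \in unitmx)) => // /not_unitmx_ker[v v0 vA]; exfalso.
have S0 := sum_cabs_gt0 v0; set S := \sum_j _ in S0.
pose N := mnorm2 v.
have N0 : 0 < N.
  rewrite lt_def mnorm2_ge0 andbT; apply: contra_neq v0 => N0.
  apply/rowP => j; rewrite mxE; apply/cabs_eq0/eqP; rewrite -sqrf_eq0.
  by rewrite eq_le sqr_ge0 andbT -N0 entry_le_mnorm2.
(* With entrywise error [N / S / 2] the pairing is at most [N / 2], against its exact value [N]. *)
have [P [_ hP]] := outer_approx_at (adj v) Dz (divr_gt0 (divr_gt0 N0 S0) (ltr0Sn R 1)).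
have : cabs ((v *m (adj v - A z *m peval P z)) 0 0) = N.
  rewrite mulmxBr mulmxA vA mul0mx subr0 mxE.
  have -> : \sum_j v 0 j * adj v j 0 = Complex N 0.
    rewrite /N /mnorm2 big_ord1 (eq_bigr (fun j => Complex (cabs (v 0 j) ^+ 2) 0)).
      by apply: eqC; rewrite ?Re_sum ?Im_sum//= big1.
    by move=> j _; rewrite !mxE mul_conj.
  by rewrite cabs_real// ltW.
rewrite mxE => hN.
have : N <= N / 2.
  rewrite -{1}hN (le_trans (cabs_sum _ _ _))//.
  apply: (@le_trans _ _ (\sum_j cabs (v 0 j) * (N / S / 2))).
    apply: ler_sum => j _; rewrite cabsM ler_wpM2l ?cabs_ge0//.
    by have := hP j; rewrite !mxE.
  rewrite -mulr_suml -/S le_eqVlt; apply/orP; left; apply/eqP; field.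
  by rewrite gt_eqF.
lra.
Qed.

Lemma outer_nice i j : nice (fun z => A z i j).
Proof.
split; first exact: dbounded_A.
have D0 : cdisc (0 : C) by apply/cdiscP; rewrite cabs0.
have n0 : (0 < n)%N by exact: leq_ltn_trans (leq0n i) (ltn_ord i).
have nR : 0 < n%:R :> R by rewrite ltr0n.
(* An error of 1/(2n) per entry keeps [A 0 *m ev 0 Q] so close to the identity that a row [v] in its
   kernel would satisfy [S <= S / 2]. *)
pose d : R := n%:R^-1 / 2.
have d0 : 0 < d by rewrite divr_gt0// invr_gt0.
have /choice[P hP] : forall k : 'I_n, exists P : 'cV[{poly C}]_n,
    (forall i, has_ps (fun z => (A z *m peval P z) i 0)) /\
    forall i, cabs ((delta_mx k 0 : 'cV[C]_n) i 0 - (A 0 *m peval P 0) i 0) <= d.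
  by move=> k; exact: outer_approx_at.
pose Q : 'M[{poly C}]_n := \matrix_(i, k) P k i 0.
pose ev (z : C) : 'M[{poly C}]_n -> 'M[C]_n := map_mx (horner_eval z).
have AQ z i' k : (A z *m ev z Q) i' k = (A z *m peval (P k) z) i' 0.
  by rewrite !mxE; apply: eq_bigr => l _; rewrite !mxE.
have detQ : \det Q != 0.
  suff u : A 0 *m ev 0 Q \in unitmx.
    apply: contraTneq u => dQ; rewrite unitmxE det_mulmx /ev det_map_mx dQ.
    by rewrite rmorph0 mulr0 unitr0.
  case: (boolP (A 0 *m ev 0 Q \in unitmx)) => // /not_unitmx_ker[v v0 vM]; exfalso.
  have S0 := sum_cabs_gt0 v0; set S := \sum_j _ in S0.
  have le k : cabs (v 0 k) <= S * d.
    have -> : v 0 k = (v *m (1%:M - A 0 *m ev 0 Q)) 0 k by rewrite mulmxBr vM subr0 mulmx1.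
    rewrite mxE (le_trans (cabs_sum _ _ _))// /S mulr_suml; apply: ler_sum => l _.
    rewrite cabsM ler_wpM2l ?cabs_ge0//; have := (hP k).2 l.
    rewrite [X in _ -> cabs X <= _]mxE [X in _ -> cabs (_ + X) <= _]mxE AQ.
    by rewrite !mxE eqxx andbT.
  have : S <= S / 2.
    apply: (@le_trans _ _ (\sum_(k < n) S * d)); first by apply: ler_sum => k _.
    rewrite sumr_const card_ord -mulr_natl /d le_eqVlt; apply/orP; left; apply/eqP.
    by field; rewrite gt_eqF.
  lra.
apply: (has_ps_div_poly detQ) => [z Dz|]; first exact: holo_ccont (holA i j) Dz.
(* [A] times [\det Q] equals [A Q] times the adjugate of [Q], whose entries combine power series and
   polynomials. *)
apply: (@eq_has_ps _ (fun z => \sum_k (A z *m peval (P k) z) i 0 * (\adj Q k j).[z])).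
  move=> z _.
  have -> : \sum_k (A z *m peval (P k) z) i 0 * (\adj Q k j).[z] =
      ((A z *m ev z Q) *m ev z (\adj Q)) i j.
    by rewrite [RHS]mxE; apply: eq_bigr => k _; rewrite AQ [ev z _ k j]mxE.
  rewrite -mulmxA /ev -map_mxM mul_mx_adj map_scalar_mx mul_mx_scalar mxE.
  by [].
by apply: has_ps_sum => k; apply: has_psM; [exact: (hP k).1|exact: has_ps_horner].
Qed.

End Outer.

(** * The isometric multiplier and the vectors of kernel combinations *)

Section Isometry.
Variables (R : realType) (n : nat).
Local Notation C := R[i].
Local Notation mu := (@lebesgue_measure R).
Variables (B : C -> 'rV[C]_n) (A : C -> 'M[C]_n).
Hypotheses (nB : forall j, nice (fun z => B z 0 j))
           (nA : forall i j, nice (fun z => A z i j)).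

(** The entries of the product of the adjoint of V with V at the point [z]. *)
Definition gram z (k j : 'I_n) : C :=
  conjc (B z 0 k) * B z 0 j + \sum_i conjc (A z i k) * A z i j.

Hypothesis gram_lim : {ae mu, forall t, forall k j,
  tends (fun m => gram (Complex (rr R m) 0 * cexpi t) k j) (k == j)%:R}.

Implicit Types v w : 'I_n -> C -> C.

(* A function with values in [C (+) C^n], the scalar component being [None]. *)
Definition dot (x y : option 'I_n -> C -> C) z : C :=
  x None z * conjc (y None z) + \sum_i x (Some i) z * conjc (y (Some i) z).

(* The isometric multiplier [(B; A)]. *)
Definition mulV v (o : option 'I_n) z : C :=
  match o with
  | None => \sum_j B z 0 j * v j z
  | Some i => \sum_j A z i j * v j z
  end.

Lemma nice_mulV v o : (forall j, nice (v j)) -> nice (mulV v o).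
Proof. by move=> nv; case: o => [i|]; apply: nice_sum => j; exact: niceM. Qed.

Lemma dcont_dot (x y : option 'I_n -> C -> C) : (forall o, dcont (x o)) -> (forall o, dcont (y o)) -> dcont (dot x y).
Proof.
move=> cx cy; apply: dcontD; first by apply: dcontM => //; exact: dcont_conj.
by apply: dcont_sum => i; apply: dcontM => //; exact: dcont_conj.
Qed.

Lemma dot_mulV v w z : dot (mulV v) (mulV w) z - \sum_j v j z * conjc (w j z) =
  \sum_k \sum_j (v j z * conjc (w k z)) * (gram z k j - (k == j)%:R).
Proof.
have e1 (r : 'I_n -> C) : (\sum_j r j * v j z) * conjc (\sum_k r k * w k z) =
    \sum_k \sum_j (v j z * conjc (w k z)) * (conjc (r k) * r j).
  rewrite conj_sum mulr_sumr; apply: eq_bigr => k _.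
  by rewrite mulr_suml; apply: eq_bigr => j _; rewrite conjM; ring.
rewrite /dot /mulV/= (e1 (B z 0)).
have -> : \sum_i (\sum_j A z i j * v j z) * conjc (\sum_j A z i j * w j z) =
    \sum_i \sum_k \sum_j (v j z * conjc (w k z)) * (conjc (A z i k) * A z i j).
  by apply: eq_bigr => i _; exact: (e1 (A z i)).
rewrite [X in _ + X - _]exchange_big/=.
have -> : \sum_j v j z * conjc (w j z) =
    \sum_k \sum_j (v j z * conjc (w k z)) * (k == j)%:R.
  apply: eq_bigr => k _; rewrite (bigD1 k)//= eqxx mulr1 big1 ?addr0// => j.
  by rewrite eq_sym => /negPf ->; rewrite mulr0.
rewrite -big_split -sumrB/=; apply: eq_bigr => k _.
rewrite [X in _ + X - _]exchange_big/= -big_split -sumrB/=; apply: eq_bigr => j _.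
by rewrite /gram mulrBr mulrDr mulr_sumr.
Qed.

(** By [dot_mulV] the integrand is a finite sum of bounded functions times entries of [gram] minus
    the identity, which tend to zero almost everywhere; dominated convergence concludes. From [v]
    and [w] only their bounds enter this limit. *)
Lemma LM_isometry v w : (forall j, nice (v j)) -> (forall j, nice (w j)) ->
  LM (fun z => dot (mulV v) (mulV w) z - \sum_j v j z * conjc (w j z)) 0.
Proof.
move=> nv nw.
have nV u o : (forall j, nice (u j)) -> dcont (mulV u o).
  by move=> nu; apply: nice_dcont; exact: nice_mulV.
have ch : dcont (fun z => dot (mulV v) (mulV w) z - \sum_j v j z * conjc (w j z)).
  apply: dcontB; first by apply: dcont_dot => o; exact: nV.
  apply: dcont_sum => j; apply: dcontM; first exact: nice_dcont.
  by apply/dcont_conj/nice_dcont.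
have bconj (phi : C -> C) : dbounded phi -> dbounded (fun z => conjc (phi z)).
  by move=> [M hM]; exists M => z Dz; rewrite cabs_conj hM.
have bsum (I : Type) (s : seq I) (F : I -> C -> C) : (forall i, dbounded (F i)) ->
    dbounded (fun z => \sum_(i <- s) F i z).
  move=> h; elim: s => [|i s [M hM]].
    by exists 0 => z _; rewrite big_nil cabs0.
  have [L hL] := h i; exists (L + M) => z Dz.
  by rewrite big_cons (le_trans (cabsD _ _))// lerD ?hL ?hM.
have bvw j k : dbounded (fun z => v j z * conjc (w k z)).
  by apply: dboundedM; [exact: (nv j).1|apply: bconj; exact: (nw k).1].
have bh : dbounded (fun z => dot (mulV v) (mulV w) z - \sum_j v j z * conjc (w j z)).
  have [M hM] : dbounded (fun z => \sum_k \sum_j (v j z * conjc (w k z)) *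
      (gram z k j + - (k == j)%:R)).
    apply: (bsum) => k; apply: (bsum) => j; apply: dboundedM => //.
    apply: dboundedD; last exact: dbounded_cst.
    apply: dboundedD.
      by apply: dboundedM; [apply: bconj; exact: (nB k).1|exact: (nB j).1].
    by apply: (bsum) => i; apply: dboundedM; [apply: bconj; exact: (nA i k).1|exact: (nA i j).1].
  by exists M => z Dz; rewrite dot_mulV hM.
have [M hM] := bh.
have Dm m t := polar_disc (rr_ge0 R m) (rr_lt1 R m) t.
apply: (@cmean_dominated _ (fun m t => (fun z => dot (mulV v) (mulV w) z -
   \sum_j v j z * conjc (w j z)) (Complex (rr R m) 0 * cexpi t)) M).
- by move=> m; apply: dcont_tcont ch; [exact: rr_ge0|exact: rr_lt1].
- by move=> m t; apply: hM; exact: Dm.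
have [N [mN N0 sN]] := gram_lim; exists N; split=> // t /= nt; apply: sN => /= ht.
apply: nt.
apply: (@tends_eq _ (fun m => \sum_k \sum_j
   (v j (Complex (rr R m) 0 * cexpi t) * conjc (w k (Complex (rr R m) 0 * cexpi t))) *
   (gram (Complex (rr R m) 0 * cexpi t) k j - (k == j)%:R))).
  by move=> m; rewrite dot_mulV.
have sum0 (F : 'I_n -> nat -> C) : (forall i, tends (F i) 0) ->
    tends (fun m => \sum_i F i m) 0.
  move=> hF; have := tends_sum (index_enum 'I_n) hF.
  by rewrite big1.
apply: (sum0 (fun k m => \sum_j
   (v j (Complex (rr R m) 0 * cexpi t) * conjc (w k (Complex (rr R m) 0 * cexpi t))) *
   (gram (Complex (rr R m) 0 * cexpi t) k j - (k == j)%:R))) => k.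
apply: (sum0 (fun j m =>
   (v j (Complex (rr R m) 0 * cexpi t) * conjc (w k (Complex (rr R m) 0 * cexpi t))) *
   (gram (Complex (rr R m) 0 * cexpi t) k j - (k == j)%:R))) => j.
have [L hL] := bvw j k.
have h0 := tendsB (ht k j) (tends_cst (k == j)%:R); rewrite subrr in h0.
have L0 : 0 < `|L| + 1 by rewrite ltr_wpDl.
move=> e e0; have [K hK] := h0 _ (divr_gt0 e0 L0); exists K => m /hK.
rewrite !subr0 cabsM => hm.
apply: (@le_lt_trans _ _ ((`|L| + 1) * cabs (gram (Complex (rr R m) 0 * cexpi t) k j - (k == j)%:R))).
  rewrite ler_wpM2r ?cabs_ge0// (le_trans (hL _ (Dm m t)))//.
  by rewrite (le_trans (ler_norm _))// lerDl.
by rewrite mulrC -ltr_pdivlMr.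
Qed.

Lemma LM_dot_mulV v w (a : C) : (forall j, nice (v j)) -> (forall j, nice (w j)) ->
  LM (fun z => \sum_j v j z * conjc (w j z)) a -> LM (dot (mulV v) (mulV w)) a.
Proof.
move=> nv nw h.
have cv : dcont (fun z => \sum_j v j z * conjc (w j z)).
  apply: dcont_sum => j; apply: dcontM; first exact: nice_dcont.
  by apply/dcont_conj/nice_dcont.
have cV : dcont (dot (mulV v) (mulV w)).
  by apply: dcont_dot => o; apply: nice_dcont; exact: nice_mulV.
rewrite -[a]add0r; apply: eq_LM (LM_D _ _ (LM_isometry nv nw) h) => //.
  by move=> z _; rewrite subrK.
exact: dcontB.
Qed.

(* The coefficient [w] such that the kernel combination [s] is the scalar part
   of the projection of [ksum s] orthogonal to the range of [mulV]. *)
Definition wsum (s : seq (C * C)) (j : 'I_n) z : C :=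
  \sum_(x <- s) x.1 * conjc (B x.2 0 j) * sker x.2 z.

Definition kvec (s : seq (C * C)) (o : option 'I_n) z : C :=
  (if o is None then ksum s z else 0) - mulV (wsum s) o z.

Lemma nice_wsum s j : indisc s -> nice (wsum s j).
Proof.
move=> ds.
have -> : wsum s j = ksum [seq (x.1 * conjc (B x.2 0 j), x.2) | x <- s].
  by apply/funext => z; rewrite /wsum /ksum big_map.
by apply: nice_ksum => x /mapP[y ys ->]; exact: (ds y).
Qed.

Lemma nice_kvec s o : indisc s -> nice (kvec s o).
Proof.
move=> ds; apply: niceB; last by apply: nice_mulV => j; exact: nice_wsum.
by case: o => [i|]; [exact: nice_cst|exact: nice_ksum].
Qed.

(** Splitting the numerator of [KB] gives [sker l z] minus [B(z)] times the adjoint of [B(l)] times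
    [sker l z]; summed over [s], the second part is the scalar component of [mulV (wsum s)]. *)
Lemma keval_kvec s z : keval B s z = kvec s None z.
Proof.
rewrite /kvec /keval /ksum /mulV /wsum.
under [X in _ - X]eq_bigr do rewrite mulr_sumr.
rewrite exchange_big/= -sumrB; apply: eq_bigr => x _.
rewrite /KB /sker [conjc x.2 * z]mulrC mulrBl mul1r mulrBr; congr (_ - _).
rewrite mxE mulr_suml mulr_sumr; apply: eq_bigr => j _.
by rewrite !mxE; ring.
Qed.

Lemma LM_ksum (phi : C -> C) s : nice phi -> indisc s ->
  LM (fun z => phi z * conjc (ksum s z)) (\sum_(x <- s) conjc x.1 * phi x.2).
Proof.
move=> nphi; rewrite /ksum; have cphi := nice_dcont nphi.
elim: s => [|x s IH] ds.
  rewrite big_nil; apply: (@eq_LM _ (fun=> 0)).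
    by move=> z _; rewrite big_nil conjc0 mulr0.
  by apply: tends_eq (tends_cst 0) => m; rewrite cm_cst.
have Dx : cdisc x.2 by apply: ds; rewrite inE eqxx.
have ds' : indisc s by move=> y ys; apply: ds; rewrite inE ys orbT.
rewrite big_cons.
have ck : dcont (fun z => phi z * conjc (sker x.2 z)).
  by apply: dcontM => //; apply/dcont_conj/nice_dcont/nice_sker.
have cs : dcont (fun z => phi z * conjc (\sum_(x <- s) x.1 * sker x.2 z)).
  by apply: dcontM => //; apply/dcont_conj/nice_dcont/nice_ksum.
apply: eq_LM (LM_D _ cs (LM_Z _ ck (LM_reproducing nphi Dx)) (IH ds')).
  by move=> z _; rewrite big_cons conjD conjM; ring.
exact: dcontZ.
Qed.

(** The value is also the inner product of the scalar component of [mulV v] with [ksum s]: [wsum s]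
    acts as the adjoint of [mulV] applied to [(ksum s, 0)]. *)
Lemma LM_wsum v s : (forall j, nice (v j)) -> indisc s ->
  LM (fun z => \sum_j v j z * conjc (wsum s j z))
     (\sum_(x <- s) conjc x.1 * mulV v None x.2).
Proof.
move=> nv ds.
have -> : \sum_(x <- s) conjc x.1 * mulV v None x.2 =
    \sum_j \sum_(x <- s) conjc x.1 * (B x.2 0 j * v j x.2).
  by rewrite exchange_big/=; apply: eq_bigr => x _; rewrite /mulV mulr_sumr.
have wE j : wsum s j = ksum [seq (x.1 * conjc (B x.2 0 j), x.2) | x <- s].
  by apply/funext => z; rewrite /wsum /ksum big_map.
apply: LM_sum => j.
  by apply: dcontM; [exact: nice_dcont|apply/dcont_conj/nice_dcont/nice_wsum].
rewrite wE; have := @LM_ksum (v j) [seq (x.1 * conjc (B x.2 0 j), x.2) | x <- s] (nv j).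
rewrite big_map.
under eq_bigr do rewrite /= conjM conjcK -mulrA.
by apply=> x /mapP[y ys ->]; exact: (ds y).
Qed.

Lemma dot_kvec (x : option 'I_n -> C -> C) s z : dot x (kvec s) z =
  x None z * conjc (ksum s z) - dot x (mulV (wsum s)) z.
Proof.
rewrite /dot /kvec conjB mulrBr -addrA opprD -sumrN; congr (_ + (_ + _)).
by apply: eq_bigr => i _; rewrite sub0r conjN mulrN.
Qed.

(** [(ksum s, 0)] and [mulV (wsum s)] have the same inner product with [mulV v], the former by
    reproduction and the latter by isometry. *)
Lemma kvec_orth v s : (forall j, nice (v j)) -> indisc s -> LM (dot (mulV v) (kvec s)) 0.
Proof.
move=> nv ds; have nw j : nice (wsum s j) by exact: nice_wsum.
have h1 := LM_ksum (nice_mulV None nv) ds.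
have h2 := LM_dot_mulV nv nw (LM_wsum nv ds).
rewrite -(subrr (\sum_(x <- s) conjc x.1 * mulV v None x.2)).
apply: eq_LM (LM_B _ _ h1 h2).
- by move=> z _; rewrite dot_kvec.
- apply: dcontM; first exact/nice_dcont/nice_mulV.
  exact/dcont_conj/nice_dcont/nice_ksum.
- by apply: dcont_dot => o; apply: nice_dcont; exact: nice_mulV.
Qed.

Lemma dot_conj (x y : option 'I_n -> C -> C) z : dot x y z = conjc (dot y x z).
Proof.
rewrite /dot conjD conj_sum conjM conjcK mulrC; congr (_ + _).
by apply: eq_bigr => i _; rewrite conjM conjcK mulrC.
Qed.

(** The part [mulV (wsum s)] of [kvec s] is orthogonal to [kvec s], so the squared norm is the
    pairing of [kvec s] with [(ksum s, 0)], which the kernels evaluate. *)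
Lemma kvec_norm s : indisc s ->
  LM (dot (kvec s) (kvec s)) (\sum_(x <- s) conjc x.1 * keval B s x.2).
Proof.
move=> ds; have nw j : nice (wsum s j) by exact: nice_wsum.
have ck o : dcont (kvec s o) by apply/nice_dcont/nice_kvec.
have cw o : dcont (mulV (wsum s) o) by apply/nice_dcont/nice_mulV.
have h1 := LM_ksum (nice_kvec None ds) ds.
have cd : dcont (dot (mulV (wsum s)) (kvec s)) by exact: dcont_dot.
have h2 := LM_conj cd (kvec_orth nw ds).
rewrite conjc0 in h2.
rewrite (eq_bigr (fun x => conjc x.1 * kvec s None x.2)); last first.
  by move=> x _; rewrite keval_kvec.
rewrite -[X in LM _ X]subr0; apply: eq_LM (LM_B _ _ h1 h2).
- by move=> z _; rewrite [in RHS]dot_kvec [in RHS]dot_conj.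
- by apply: dcontM => //; exact/dcont_conj/nice_dcont/nice_ksum.
- exact: dcont_conj.
Qed.

Lemma knorm2E s : knorm2 B s = complex.Re (\sum_(x <- s) conjc x.1 * keval B s x.2).
Proof.
rewrite /knorm2 exchange_big/=; congr complex.Re; apply: eq_bigr => y _.
by rewrite /keval mulr_sumr; apply: eq_bigr => x _; ring.
Qed.

Lemma ksum_kneg (s : seq (C * C)) z : ksum (kneg s) z = - ksum s z.
Proof.
by rewrite /ksum /kneg big_map -sumrN; apply: eq_bigr => x _ /=; rewrite mulNr.
Qed.

Lemma kvec_sub s t o z : kvec (s ++ kneg t) o z = kvec s o z - kvec t o z.
Proof.
have wE j : wsum (s ++ kneg t) j z = wsum s j z - wsum t j z.
  rewrite /wsum big_cat/= /kneg big_map -sumrN; congr (_ + _).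
  by apply: eq_bigr => x _ /=; rewrite !mulNr.
have VE : mulV (wsum (s ++ kneg t)) o z = mulV (wsum s) o z - mulV (wsum t) o z.
  by case: o => [i|]; rewrite /mulV -sumrB; apply: eq_bigr => j _; rewrite wE mulrBr.
rewrite /kvec VE; case: o {VE} => [i|]; first by ring.
by rewrite ksum_cat ksum_kneg; ring.
Qed.

Lemma indisc_kneg (s : seq (C * C)) : indisc s -> indisc (kneg s).
Proof. by move=> ds x /mapP[y ys ->]; exact: (ds y). Qed.

End Isometry.

(** * The vector F built from Taylor coefficients: orthogonality and norm *)

Section CoefficientPart.
Variables (R : realType) (n : nat).
Local Notation C := R[i].
Variables (c : nat -> 'rV[C]_n) (Cf : 'I_n -> C -> C) (f : C -> C) (fh : nat -> C).
Variables (K rho : R).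
Hypotheses (rho0 : 0 <= rho) (rho1 : rho < 1).
Hypothesis decay : forall k, cabs (fh k) <= K * rho ^+ k.
Hypothesis psf : is_ps fh f.
Hypothesis psC : forall i, is_ps (fun j => c j 0 i) (Cf i).

Let t := ratio rho.
Let t0 : 0 <= t. Proof. exact: ratio_ge0. Qed.
Let t1 : t < 1. Proof. exact: ratio_lt1. Qed.
Let rho_t : rho <= t.
Proof. by rewrite /t /ratio ler_pdivlMr ?ler_piMr//; have := rho0; have := rho1; lra. Qed.
Let K0 : 0 <= K.
Proof. by have := le_trans (cabs_ge0 _) (decay 0%N); rewrite expr0 mulr1. Qed.

(** At the midpoint [s] of [rho] and 1 the entries of [c j] are at most a multiple of [s ^- j]. Part
    of the decay of [fh] pays for this growth, leaving the ratio [t = rho / s] in [j] and the full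
    [rho] in [k]. *)
Lemma term_bound : exists2 L : R, 0 <= L & forall i j k,
  cabs (fh (j + k)%N * conjc (c j 0 i)) <= L * rho ^+ k * t ^+ j.
Proof.
have s0 : 0 < (1 + rho) / 2 by have := rho0; lra.
have /choice[M hM] : forall i, exists M : R, forall j,
    cabs (c j 0 i) * ((1 + rho) / 2) ^+ j <= M.
  by move=> i; apply: (ps_subexp (psC i)); [exact: ltW|have := rho1; lra].
have M0 i : 0 <= M i.
  by apply: le_trans (hM i 0%N); rewrite expr0 mulr1 cabs_ge0.
exists (\sum_i K * M i); first by apply: sumr_ge0 => i _; rewrite mulr_ge0.
move=> i j k; rewrite cabsM cabs_conj.
apply: (@le_trans _ _ (K * M i * rho ^+ k * t ^+ j)); last first.
  rewrite !ler_wpM2r ?exprn_ge0// (bigD1 i)//= lerDl sumr_ge0// => l _.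
  by rewrite mulr_ge0.
apply: (@le_trans _ _ (K * rho ^+ (j + k) * cabs (c j 0 i))).
  by rewrite ler_wpM2r ?cabs_ge0.
have -> : rho ^+ (j + k) = rho ^+ k * (t ^+ j * ((1 + rho) / 2) ^+ j).
  by rewrite exprD -exprMn /t /ratio divfK ?gt_eqF// mulrC.
have -> : K * (rho ^+ k * (t ^+ j * ((1 + rho) / 2) ^+ j)) * cabs (c j 0 i) =
   (K * rho ^+ k * t ^+ j) * (cabs (c j 0 i) * ((1 + rho) / 2) ^+ j) by ring.
have -> : K * M i * rho ^+ k * t ^+ j = (K * rho ^+ k * t ^+ j) * M i by ring.
by rewrite ler_wpM2l// !mulr_ge0// exprn_ge0.
Qed.

Let L := sval (cid2 term_bound).
Let L0 : 0 <= L. Proof. by rewrite /L; case: cid2. Qed.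
Let hL i j k : cabs (fh (j + k)%N * conjc (c j 0 i)) <= L * rho ^+ k * t ^+ j.
Proof. by rewrite /L; case: cid2 => x /= _ h; exact: h. Qed.

Definition gcoef k : 'cV[C]_n := mx_sum (fun j => fh (j + k)%N *: adj (c j)).

Lemma gcoef_tends k i :
  tends (fun N => \sum_(j < N) fh (j + k)%N * conjc (c j 0 i)) (gcoef k i 0).
Proof.
have h : forall i' (l : 'I_1), exists S,
    tends (fun N => \sum_(j < N) (fh (j + k)%N *: adj (c j)) i' l) S.
  move=> i' l; apply: (@geom_series _ (fun j => (fh (j + k)%N *: adj (c j)) i' l) (L * rho ^+ k) t t0 t1) => j.
  by rewrite !mxE (ord1 l); exact: hL.
apply: tends_eq (mx_sumE h i 0) => N.
by apply: eq_bigr => j _; rewrite !mxE.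
Qed.

Lemma gcoef_tail k i N :
  cabs (gcoef k i 0 - \sum_(j < N) fh (j + k)%N * conjc (c j 0 i)) <=
  L * rho ^+ k * t ^+ N / (1 - t).
Proof.
apply: (@geom_tail _ (fun j => fh (j + k)%N * conjc (c j 0 i)) _ t _ t0 t1 _ (gcoef_tends k i)) => j.
exact: hL.
Qed.

Let Lt := L / (1 - t).
Let Lt0 : 0 <= Lt. Proof. by rewrite divr_ge0// subr_ge0 ltW. Qed.

Lemma gcoef_bound k i : cabs (gcoef k i 0) <= Lt * rho ^+ k.
Proof. by have := gcoef_tail k i 0; rewrite big_ord0 subr0 expr0 mulr1 mulrAC. Qed.

Lemma abs_series_cvg k : (0 < n)%N ->
  cvgn (series (fun j => mnorm (fh (j + k)%N *: adj (c j)))).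
Proof.
move=> n0; apply: (@geom_dominated_cvg _ _ (n%:R * (L * rho ^+ k)) t t0 t1) => j.
rewrite ger0_norm ?sqrtr_ge0//.
have b0 : 0 <= L * rho ^+ k * t ^+ j by rewrite !mulr_ge0// exprn_ge0.
have -> : n%:R * (L * rho ^+ k) * t ^+ j = n%:R * (L * rho ^+ k * t ^+ j) by ring.
have hb i := hL i j k.
set b := L * rho ^+ k * t ^+ j in b0 hb *.
have nb : 0 <= n%:R * b by rewrite mulr_ge0.
suff h : mnorm2 (fh (j + k)%N *: adj (c j)) <= (n%:R * b) ^+ 2.
  by apply: (le_trans (ler_wsqrtr h)); rewrite sqrtr_sqr ger0_norm.
apply: (@le_trans _ _ (\sum_(i < n) b ^+ 2)).
  by apply: ler_sum => i _; rewrite big_ord1 !mxE lerXn2r ?nnegrE ?cabs_ge0.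
rewrite sumr_const card_ord -[_ *+ n]mulr_natl [(n%:R * b) ^+ 2]exprMn ler_wpM2r ?sqr_ge0//.
by rewrite -natrX ler_nat -{1}[n]muln1 leq_mul2l n0 orbT.
Qed.

Lemma geom_nice (a : nat -> C) phi (M : R) : (forall k, cabs (a k) <= M * rho ^+ k) ->
  is_ps a phi -> nice phi /\ forall N z, cdisc z ->
  cabs (phi z - \sum_(k < N) a k * z ^+ k) <= M * rho ^+ N / (1 - rho).
Proof.
move=> ha hp.
have tail N z : cdisc z -> cabs (phi z - \sum_(k < N) a k * z ^+ k) <= M * rho ^+ N / (1 - rho).
  move=> Dz; apply: (@geom_tail _ (fun k => a k * z ^+ k)) => // [k|]; last exact: hp.
  have /cdiscP z1 := Dz; apply: le_trans (ha k).
  by rewrite cabsM cabsX ler_piMr ?cabs_ge0// exprn_ile1 ?cabs_ge0// ltW.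
split=> //; split; last by exists a.
exists (M / (1 - rho)) => z Dz.
by have := tail 0%N z Dz; rewrite big_ord0 subr0 expr0 mulr1.
Qed.

Lemma gcoef_fun : exists G : 'I_n -> C -> C,
  forall i, is_ps (fun k => - gcoef k i 0) (G i).
Proof.
have /choice[G hG] : forall i, exists phi, is_ps (fun k => - gcoef k i 0) phi.
  move=> i; apply: subexp_has_sum => r r0 r1; exists Lt => k; rewrite cabsN.
  apply: (@le_trans _ _ (Lt * rho ^+ k * r ^+ k)).
    by rewrite ler_wpM2r ?gcoef_bound// exprn_ge0.
  rewrite -mulrA ler_piMr// mulr_ile1 ?exprn_ge0//; by rewrite exprn_ile1// ltW.
by exists G.
Qed.

Lemma is_ps_sum (I : Type) (s : seq I) (a : I -> nat -> C) (F : I -> C -> C) :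
  (forall i, is_ps (a i) (F i)) ->
  is_ps (fun k => \sum_(i <- s) a i k) (fun z => \sum_(i <- s) F i z).
Proof.
move=> h z Dz; apply: tends_eq (tends_sum s (fun i => h i z Dz)) => N.
by rewrite exchange_big/=; apply: eq_bigr => k _; rewrite mulr_suml.
Qed.

Lemma LM_poly (a b : nat -> C) phi J : is_ps a phi ->
  LM (fun z => phi z * conjc (\sum_(k < J) b k * z ^+ k)) (\sum_(k < J) conjc (b k) * a k).
Proof.
move=> ha; have cphi : dcont phi by apply: has_ps_dcont; exists a.
have cX k : dcont (fun z => phi z * conjc (z ^+ k)).
  by apply: dcontM => //; exact/dcont_conj/dcontX.
apply: (@eq_LM _ (fun z => \sum_(k < J) conjc (b k) * (phi z * conjc (z ^+ k)))).
  move=> z _; rewrite conj_sum mulr_sumr; apply: eq_bigr => k _.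
  by rewrite conjM; ring.
apply: LM_sum => k; first exact: dcontZ.
by apply: LM_Z => //; exact: LM_coef.
Qed.

(** The transpose of multiplication by [w] is correlation with [w]. The truncated identity is exact
    because both sides run over [j + m < J]. *)
Lemma weighted_conv (y w F : nat -> C) J :
  \sum_(k < J) F k * conv y w k = \sum_(m < J) y m * \sum_(j < J - m) w j * F (j + m)%N.
Proof.
elim: J => [|J IH]; first by rewrite !big_ord0.
rewrite big_ord_recr IH /= /conv [X in _ + _ * X]big_ord_recr/= [RHS]big_ord_recr/=.
rewrite mulrDr addrA subSnn subnn big_ord1; congr (_ + _); last by rewrite add0n; ring.
rewrite mulr_sumr -big_split; apply: eq_bigr => i _ /=.
rewrite subSn 1?ltnW// big_ord_recr/= mulrDr subnK 1?ltnW//; ring.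
Qed.

Variables (B : C -> 'rV[C]_n) (A : C -> 'M[C]_n).
Hypotheses (nB : forall j, nice (fun z => B z 0 j))
           (nA : forall i j, nice (fun z => A z i j)).
Hypothesis BCA : forall z j, cdisc z -> B z 0 j = \sum_i Cf i z * A z i j.
Variable G : 'I_n -> C -> C.
Hypothesis psG : forall i, is_ps (fun k => - gcoef k i 0) (G i).

Definition Fvec (o : option 'I_n) : C -> C := if o is Some i then G i else f.

Lemma nice_Fvec o : nice (Fvec o).
Proof.
case: o => [i|] /=; last exact: (geom_nice decay psf).1.
apply: (geom_nice (M := Lt) _ (psG i)).1 => k; rewrite cabsN; exact: gcoef_bound.
Qed.

(** The inner sum stops at [J - m], so that only coefficients of [f] of index below [J] occur; this
    matches the truncation of [f] and makes the truncated pairing vanish. *)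
Let gJ J (i : 'I_n) z : C :=
  \sum_(m < J) - (\sum_(j < J - m) fh (j + m)%N * conjc (c j 0 i)) * z ^+ m.

(** One constant for three errors: the tail of [f], the tail of [G], and the cut of the inner
    sums. *)
Let Q : R := K / (1 - rho) + Lt / (1 - rho) + Lt.

(** Cutting the inner sum of index [m] costs at most [Lt * rho ^+ m * t ^+ (J - m)], hence at most
    [Lt * t ^+ J] as [rho <= t]; there are [J] such indices. *)
Lemma G_trunc J i z : cdisc z ->
  cabs (G i z - gJ J i z) <= Q * t ^+ J + Q * (J%:R * t ^+ J).
Proof.
move=> Dz; have /cdiscP z1 := Dz.
have r0' : 0 < 1 - rho by rewrite subr_gt0.
have KK : 0 <= K / (1 - rho) by rewrite divr_ge0// ltW.
have LL : 0 <= Lt / (1 - rho) by rewrite divr_ge0// ltW.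
have tJ : 0 <= t ^+ J by rewrite exprn_ge0.
have hg k : cabs (- gcoef k i 0) <= Lt * rho ^+ k by rewrite cabsN gcoef_bound.
apply: (le_trans (cabs_tri (\sum_(m < J) - gcoef m i 0 * z ^+ m) _ _)); apply: lerD.
  apply: (le_trans ((geom_nice hg (psG i)).2 J z Dz)).
  have -> : Lt * rho ^+ J / (1 - rho) = Lt / (1 - rho) * rho ^+ J by ring.
  apply: ler_pM => //; first by rewrite exprn_ge0.
    by rewrite /Q; have := Lt0; lra.
  by rewrite lerXn2r// nnegrE.
rewrite /gJ -sumrB (le_trans (cabs_sum _ _ _))//.
have -> : Q * (J%:R * t ^+ J) = \sum_(m < J) Q * t ^+ J.
  by rewrite sumr_const card_ord -[RHS]mulr_natl; ring.
apply: ler_sum => m _; rewrite -mulrBl cabsM -opprD cabsN.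
have mJ : (m <= J)%N by exact: ltnW.
apply: (@le_trans _ _ (Lt * t ^+ J)); last by rewrite ler_wpM2r// /Q; have := Lt0; lra.
apply: (@le_trans _ _ (L * rho ^+ m * t ^+ (J - m) / (1 - t))).
  apply: le_trans (gcoef_tail m i (J - m)); rewrite ler_piMr ?cabs_ge0//.
  by rewrite cabsX exprn_ile1 ?cabs_ge0// ltW.
have -> : t ^+ J = t ^+ m * t ^+ (J - m) by rewrite -exprD subnKC.
have -> : L * rho ^+ m * t ^+ (J - m) / (1 - t) = Lt * (rho ^+ m * t ^+ (J - m)).
  by rewrite /Lt; ring.
by rewrite ler_wpM2l// ler_wpM2r ?exprn_ge0// lerXn2r// nnegrE.
Qed.

(** The relation [phi = \sum_i psi i * Cf i] makes the pairing cancel formally, but [Cf] may be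
    unbounded. For each [J] the truncated pairing involves finitely many coefficients and is exactly
    zero, and the truncations converge uniformly on the disc, so [LM_near] applies. *)
Lemma Fvec_orth (v : 'I_n -> C -> C) : (forall j, nice (v j)) ->
  LM (dot (mulV B A v) Fvec) 0.
Proof.
move=> nv; have nV o := nice_mulV nB nA o nv.
pose phi := mulV B A v None; pose psi i := mulV B A v (Some i).
have cphi : dcont phi by exact/nice_dcont/nV.
have cpsi i : dcont (psi i) by exact/nice_dcont/nV.
have /choice[y hy] : forall i, exists y, is_ps y (psi i) by move=> i; exact: (nV (Some i)).2.
pose x k := \sum_i conv (y i) (fun j => c j 0 i) k.
have hx : is_ps x phi.
  have h : is_ps x (fun z => \sum_i psi i z * Cf i z).
    by apply: is_ps_sum => i; apply: is_psM; [exact: hy|exact: psC].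
  move=> z Dz; have := h z Dz; congr (tends _ _).
  rewrite /phi /mulV; under [RHS]eq_bigr => j _ do rewrite BCA// mulr_suml.
  rewrite exchange_big/=; apply: eq_bigr => i _.
  by rewrite /psi /mulV mulr_suml; apply: eq_bigr => j _; ring.
have /choice[M hM] : forall i, exists M : R, forall z, cdisc z -> cabs (psi i z) <= M.
  by move=> i; exact: (nV (Some i)).1.
have [Mp hMp] : dbounded phi by exact: (nV None).1.
pose fJ J z := \sum_(k < J) fh k * z ^+ k.
have cfJ J : dcont (fJ J) by apply: dcont_sum => k; exact/dcontZ/dcontX.
have cgJ J i : dcont (gJ J i) by apply: dcont_sum => k; exact/dcontZ/dcontX.
pose E J := Q * t ^+ J + Q * (J%:R * t ^+ J).
have E0 : E @ \oo --> (0 : R).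
  rewrite -[X in _ --> X](addr0 0); apply: cvgD.
    exact: geom_cvg0.
  exact: mul_geom_cvg0.
have D0 : cdisc (0 : C) by apply/cdiscP; rewrite cabs0.
have Mp0 : 0 <= Mp by exact: le_trans (cabs_ge0 _) (hMp 0 D0).
have M0 i : 0 <= M i by exact: le_trans (cabs_ge0 _) (hM i 0 D0).
apply: (@LM_near _ _ _
   (fun J z => phi z * conjc (fJ J z) + \sum_i psi i z * conjc (gJ J i z))
   (fun J => (Mp + \sum_i M i) * E J) (fun=> 0)).
- by apply: dcont_dot => o; apply: nice_dcont; [exact: nV|exact: nice_Fvec].
- move=> J; apply: dcontD; first by apply: dcontM => //; exact: dcont_conj.
  by apply: dcont_sum => i; apply: dcontM => //; exact: dcont_conj.
- move=> J z Dz; rewrite /dot /= -/phi.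
  have -> : mulV B A v None z * conjc (f z) + \sum_i mulV B A v (Some i) z * conjc (G i z) -
     (phi z * conjc (fJ J z) + \sum_i psi i z * conjc (gJ J i z)) =
     phi z * conjc (f z - fJ J z) + \sum_i psi i z * conjc (G i z - gJ J i z).
    under [X in _ = _ + X]eq_bigr do rewrite conjB mulrBr.
    by rewrite sumrB conjB mulrBr /phi /psi; ring.
  apply: (le_trans (cabsD _ _)); rewrite mulrDl; apply: lerD.
    rewrite cabsM cabs_conj; apply: ler_pM; rewrite ?cabs_ge0 ?hMp//.
    apply: (le_trans ((geom_nice decay psf).2 J z Dz)).
    have r0' : 0 < 1 - rho by rewrite subr_gt0.
    have KK : 0 <= K / (1 - rho) by rewrite divr_ge0// ltW.
    have LL : 0 <= Lt / (1 - rho) by rewrite divr_ge0// ltW.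
    have tJ : 0 <= t ^+ J by rewrite exprn_ge0.
    have Q0 : 0 <= Q by rewrite /Q; have := Lt0; lra.
    have QJ : 0 <= Q * (J%:R * t ^+ J) by rewrite !mulr_ge0.
    apply: (@le_trans _ _ (Q * t ^+ J)); last by rewrite /E lerDl.
    have -> : K * rho ^+ J / (1 - rho) = K / (1 - rho) * rho ^+ J by ring.
    apply: ler_pM => //; first by rewrite exprn_ge0.
      by rewrite /Q; have := Lt0; lra.
    by rewrite lerXn2r// nnegrE.
  rewrite (le_trans (cabs_sum _ _ _))// mulr_suml; apply: ler_sum => i _.
  rewrite cabsM cabs_conj; apply: ler_pM; rewrite ?cabs_ge0 ?hM//.
  exact: G_trunc.
- rewrite -[X in _ --> X](mulr0 (Mp + \sum_i M i)); exact: cvgMr.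
- move=> J.
  have h1 := LM_poly fh J hx.
  have h2 i := LM_poly (fun m => - \sum_(j < J - m) fh (j + m)%N * conjc (c j 0 i)) J (hy i).
  have cc i : dcont (fun z => psi i z * conjc (gJ J i z)).
    by apply: dcontM => //; exact: dcont_conj.
  have := LM_D (dcontM cphi (dcont_conj (cfJ J))) (dcont_sum (index_enum 'I_n) cc)
    h1 (LM_sum (index_enum 'I_n) cc h2).
  (* The coefficients [x k] are convolutions; [weighted_conv] moves the [c j] onto [fh] and yields
     the opposite of the second sum. *)
  rewrite (_ : \sum_(k < J) conjc (fh k) * x k + _ = 0) //.
  under eq_bigr do rewrite /x mulr_sumr.
  rewrite exchange_big/= -big_split/= big1// => i _.
  rewrite (weighted_conv (y i) (fun j => c j 0 i) (fun k => conjc (fh k)) J) -big_split/= big1// => m _.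
  rewrite conjN conj_sum mulNr mulrC -mulrBl.
  rewrite (_ : _ - _ = 0) ?mul0r//; apply/eqP; rewrite subr_eq0; apply/eqP.
  by apply: eq_bigr => j _; rewrite conjM conjcK mulrC.
- exact: tends_cst.
Qed.

Lemma Fvec_norm : exists v1 v2 : R,
  [/\ series (fun k => cabs (fh k) ^+ 2) @ \oo --> v1,
      series (fun k => mnorm2 (gcoef k)) @ \oo --> v2 &
      LM (dot Fvec Fvec) (Complex (v1 + v2) 0)].
Proof.
have sqc (a : nat -> C) (M : R) : (forall k, cabs (a k) <= M * rho ^+ k) ->
    cvgn (series (fun k => cabs (a k) ^+ 2)).
  move=> ha; apply: (@geom_dominated_cvg _ _ (M ^+ 2) rho) => // k.
  rewrite ger0_norm ?sqr_ge0//.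
  apply: (@le_trans _ _ ((M * rho ^+ k) ^+ 2)).
    by rewrite lerXn2r ?nnegrE ?cabs_ge0// (le_trans (cabs_ge0 _) (ha k)).
  rewrite exprMn ler_wpM2l ?sqr_ge0// expr2 ler_piMr ?exprn_ge0//.
  by rewrite exprn_ile1// ltW.
have c1 := sqc _ _ decay.
have c2 i : cvgn (series (fun k => cabs (- gcoef k i 0) ^+ 2)).
  by apply: (sqc _ Lt) => k; rewrite cabsN; exact: gcoef_bound.
pose v1 := limn (series (fun k => cabs (fh k) ^+ 2)).
pose w i := limn (series (fun k => cabs (- gcoef k i 0) ^+ 2)).
exists v1, (\sum_i w i); split=> //.
  apply/cvg_sub0.
  rewrite (_ : (fun m => _) = (fun m => \sum_i
     (series (fun k => cabs (- gcoef k i 0) ^+ 2) m - w i))).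
    apply: (@cvg0_sum _ _ _ (fun i m => series (fun k => cabs (- gcoef k i 0) ^+ 2) m - w i)).
    by move=> i; apply/(cvg_sub0 (series (fun k => cabs (- gcoef k i 0) ^+ 2)) (w i)).1; exact: (c2 i).
  apply/funext => m; rewrite sumrB; congr (_ - _).
  rewrite /series/= exchange_big/=; apply: eq_bigr => k _.
  by apply: eq_bigr => i _; rewrite big_ord1 cabsN.
have h1 := LM_sq psf c1.
have h2 i := LM_sq (psG i) (c2 i).
have cs i : dcont (sq (G i)) by apply: dcont_sq; exact: nice_dcont (nice_Fvec (Some i)).
have := LM_D (dcont_sq (nice_dcont (nice_Fvec None))) (dcont_sum (index_enum 'I_n) cs)
  h1 (LM_sum (index_enum 'I_n) cs h2).
congr (LM _ _); apply: eqC; rewrite ?ReD ?ImD ?Re_sum ?Im_sum//=.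
by rewrite big1 ?addr0.
Qed.

End CoefficientPart.

(** * Approximation of F by kernel vectors and the resulting norm in H(B) *)

Section Approximation.
Variables (R : realType) (n : nat).
Local Notation C := R[i].
Implicit Types x y u w p q : option 'I_n -> C -> C.

Lemma Re_dot x z : complex.Re (dot x x z) =
  cabs (x None z) ^+ 2 + \sum_i cabs (x (Some i) z) ^+ 2.
Proof.
rewrite /dot ReD Re_sum mul_conj; congr (_ + _).
by apply: eq_bigr => i _; rewrite mul_conj.
Qed.

Lemma Re_dot_ge0 x z : 0 <= complex.Re (dot x x z).
Proof.
by rewrite Re_dot addr_ge0 ?sqr_ge0// sumr_ge0// => i _; exact: sqr_ge0.
Qed.

(** A triangle inequality without square roots: for moduli [x] and [y], the right side exceeds
    [(x + y) ^+ 2] by [(d * x - y) ^+ 2 / d]. A small [d] keeps the weight of [a] near one. *)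
Lemma cabs_sqrD_weight (a b : C) (d : R) : 0 < d ->
  cabs (a + b) ^+ 2 <= (1 + d) * cabs a ^+ 2 + (1 + d^-1) * cabs b ^+ 2.
Proof.
move=> d0; apply: (@le_trans _ _ ((cabs a + cabs b) ^+ 2)).
  by rewrite lerXn2r ?nnegrE ?addr_ge0 ?cabs_ge0// cabsD.
move: (cabs a) (cabs b) => {}a {}b.
rewrite -subr_ge0 (_ : _ - _ = d^-1 * (d * a - b) ^+ 2).
  by rewrite mulr_ge0 ?sqr_ge0// invr_ge0 ltW.
by field; rewrite gt_eqF.
Qed.

Lemma Re_dotD x p q z (d : R) : 0 < d -> (forall o, x o z = p o z + q o z) ->
  complex.Re (dot x x z) <=
  (1 + d) * complex.Re (dot p p z) + (1 + d^-1) * complex.Re (dot q q z).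
Proof.
move=> d0 h; rewrite !Re_dot !mulrDr addrACA; apply: lerD.
  by rewrite h cabs_sqrD_weight.
rewrite !mulr_sumr -big_split/=; apply: ler_sum => i _.
by rewrite h cabs_sqrD_weight.
Qed.

Lemma dot_opp_add x u w z : (forall o, x o z = - (u o z + w o z)) ->
  dot x x z = dot u u z + dot w u z + conjc (dot w u z) + dot w w z.
Proof.
move=> h; rewrite -[conjc (dot w u z)]dot_conj /dot.
have e o : x o z * conjc (x o z) = u o z * conjc (u o z) + w o z * conjc (u o z) +
    u o z * conjc (w o z) + w o z * conjc (w o z) by rewrite h conjN conjD; ring.
rewrite e; under eq_bigr do rewrite e.
by rewrite !big_split/=; ring.
Qed.

(** Only an eventual bound is recorded, as this is what [kvec_approx] yields for the errors and what
    [eval_bound] accepts. *)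
Definition ev_le x (e : R) : Prop := exists N, forall m, (N <= m)%N ->
  complex.Re (cm (rr R m) (dot x x)) <= e.

Lemma cm_dotD x p q (d : R) m : 0 < d ->
  (forall o, dcont (x o)) -> (forall o, dcont (p o)) -> (forall o, dcont (q o)) ->
  (forall z, cdisc z -> forall o, x o z = p o z + q o z) ->
  complex.Re (cm (rr R m) (dot x x)) <=
  (1 + d) * complex.Re (cm (rr R m) (dot p p)) +
  (1 + d^-1) * complex.Re (cm (rr R m) (dot q q)).
Proof.
move=> d0 cx cp cq h; have r0 := rr_ge0 R m; have r1 := rr_lt1 R m.
have dx := dcont_dot cx cx; have dp := dcont_dot cp cp; have dq := dcont_dot cq cq.
have reZ (a : R) (y : C) : a * complex.Re y = complex.Re (Complex a 0 * y).
  by rewrite ReM/= mul0r subr0.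
rewrite !reZ -!cmZ// -ReD -cmD//; [|exact: dcontZ..].
apply: cm_Re_le => //; first by apply: dcontD; exact: dcontZ.
by move=> z Dz; apply: (le_trans (Re_dotD d0 (h z Dz))); rewrite !reZ -ReD.
Qed.

Lemma LM_dot_le x p q (a : C) (d P Q : R) : 0 < d ->
  (forall o, dcont (x o)) -> (forall o, dcont (p o)) -> (forall o, dcont (q o)) ->
  (forall z, cdisc z -> forall o, x o z = p o z + q o z) ->
  LM (dot x x) a -> ev_le p P -> ev_le q Q ->
  complex.Re a <= (1 + d) * P + (1 + d^-1) * Q.
Proof.
move=> d0 cx cp cq h ha [N1 h1] [N2 h2].
apply: (tends_Re_le_ev (N := maxn N1 N2) _ ha) => m; rewrite geq_max => /andP[/h1 m1 /h2 m2].
apply: (le_trans (cm_dotD m d0 cx cp cq h)).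
by rewrite lerD// ler_wpM2l// addr_ge0// ?invr_ge0 ltW.
Qed.

Lemma LM_ev_le x (V e : R) : 0 < e -> LM (dot x x) (Complex V 0) -> ev_le x (V + e).
Proof.
move=> e0 h; have [N hN] := h e e0; exists N => m /hN.
move=> /(le_lt_trans (Re_le_cabs _)) /(le_lt_trans (ler_norm _)).
by rewrite ReD ReN/= ltrBlDl => /ltW.
Qed.

Lemma LM_dot_real x (a : C) : (forall o, dcont (x o)) -> LM (dot x x) a ->
  a = Complex (complex.Re a) 0.
Proof.
move=> cx h; apply: (tends_unique h).
apply: tends_ReIm; first exact: (tends_Re h).
rewrite (_ : (fun m => _) = (fun=> 0)); first exact: cvg_cst.
apply/funext => m; rewrite /cm/= -[RHS]rmean_cst; congr rmean; apply/funext => t.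
rewrite /dot ImD Im_sum mul_conj/= big1 ?addr0// => i _.
by rewrite mul_conj.
Qed.

Variables (B : C -> 'rV[C]_n) (A : C -> 'M[C]_n).
Hypotheses (nB : forall j, nice (fun z => B z 0 j))
           (nA : forall i j, nice (fun z => A z i j)).
Hypothesis gram_lim : {ae (@lebesgue_measure R), forall t, forall k j,
  tends (fun m => gram B A (Complex (rr R m) 0 * cexpi t) k j) (k == j)%:R}.
Variable F : option 'I_n -> C -> C.
Hypothesis nF : forall o, nice (F o).
Hypothesis F_orth : forall v : 'I_n -> C -> C, (forall j, nice (v j)) ->
  LM (dot (mulV B A v) F) 0.
Hypothesis outA : outer A.
Hypothesis F_hardy : in_hardy (fun z => \col_i F (Some i) z).

Definition err s (o : option 'I_n) z : C := kvec B A s o z - F o z.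

Lemma nice_err s o : indisc s -> nice (err s o).
Proof. by move=> ds; apply: niceB => //; exact: nice_kvec. Qed.

(* [err s + mulV v] is the negative of the error of approximating [F] by
   [(ksum s, 0) + mulV P], and [err s] is orthogonal to the range of [mulV]. *)
Lemma kvec_approx (e : R) : 0 < e -> exists2 s, indisc s & ev_le (err s) e.
Proof.
move=> e0; have n1 : 0 < n%:R + 1 :> R by rewrite ltr_wpDl.
(* One [e / 4] is shared by the [n] vector components, another goes to the scalar one, and the cross
   term adds less than [2 * (e / 8)]. Adding 1 to [n%:R] keeps the divisor positive. *)
pose e1 := e / 4 / (n%:R + 1); have e10 : 0 < e1 by rewrite !divr_gt0.
have [P [b [[hb _] sb]]] := outA F_hardy e10.
move/mx_series_ps : hb => hb.
pose v0 (j : 'I_n) z := (P j 0).[z].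
have nv0 j : nice (v0 j) by exact: nice_horner.
have nh : nice (fun z => F None z - mulV B A v0 None z).
  by apply: niceB => //; exact: nice_mulV.
have e4 : 0 < e / 4 by rewrite divr_gt0.
have [s ds hs] := kernel_approx nh e4; exists s => //.
pose v (j : 'I_n) z := v0 j z + wsum B s j z.
have nv j : nice (v j) by apply: niceD => //; exact: nice_wsum.
pose E (o : option 'I_n) z : C :=
  if o is Some i then F (Some i) z - mulV B A v0 (Some i) z
  else F None z - mulV B A v0 None z - ksum s z.
have vE o z : mulV B A v o z = mulV B A v0 o z + mulV B A (wsum B s) o z.
  by case: o => [i|]; rewrite /mulV -big_split; apply: eq_bigr => j _; rewrite /v mulrDr.
have EE z o : E o z = - (err s o z + mulV B A v o z).
  by rewrite vE /err /kvec; case: o => [i|] /=; ring.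
have nE o : nice (E o).
  case: o => [i|] /=; first by apply: niceB => //; exact: nice_mulV.
  by apply: niceB => //; exact: nice_ksum.
have cE o := nice_dcont (nE o).
have cu o : dcont (err s o) by apply/nice_dcont/nice_err.
have cV o : dcont (mulV B A v o) by apply/nice_dcont/nice_mulV.
have ck o : dcont (kvec B A s o) by apply/nice_dcont/nice_kvec.
have cF o := nice_dcont (nF o).
have orth : LM (dot (mulV B A v) (err s)) 0.
  rewrite -(subrr 0).
  apply: eq_LM (LM_B _ _ (kvec_orth nB nA gram_lim nv ds) (F_orth nv)).
  - move=> z _; rewrite /dot /err conjB mulrBr.
    under [X in _ = _ + X]eq_bigr do rewrite conjB mulrBr.
    by rewrite sumrB; ring.
  - exact: dcont_dot.
  - exact: dcont_dot.
have e8 : 0 < e / 8 by rewrite divr_gt0.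
have [N hN] := orth _ e8; exists N => m /hN.
rewrite subr0 => /(le_lt_trans (Re_le_cabs _)) hm.
have r0 := rr_ge0 R m; have r1 := rr_lt1 R m.
have dwu := dcont_dot cV cu; have dE := dcont_dot cE cE.
have reL (a a' : C) : complex.Re (a + Complex (-2) 0 * a') = complex.Re a - 2 * complex.Re a'.
  by rewrite ReD ReM/= mul0r subr0 mulNr.
have reS (a a' a'' : C) : complex.Re (a + a' + conjc a' + a'') =
    complex.Re a + 2 * complex.Re a' + complex.Re a''.
  by rewrite !ReD Re_conj; ring.
(* [E] is the negative of [err s + mulV v]. Expanding its square and dropping the nonnegative square
   of [mulV v] leaves the square of [err s] and a small cross term. *)
have step1 : complex.Re (cm (rr R m) (dot (err s) (err s))) <=
    complex.Re (cm (rr R m) (dot E E)) - 2 * complex.Re (cm (rr R m) (dot (mulV B A v) (err s))).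
  have -> : complex.Re (cm (rr R m) (dot E E)) -
      2 * complex.Re (cm (rr R m) (dot (mulV B A v) (err s))) =
      complex.Re (cm (rr R m) (fun z => dot E E z + Complex (-2) 0 * dot (mulV B A v) (err s) z)).
    rewrite cmD//; last exact: dcontZ.
    by rewrite cmZ// reL.
  apply: cm_Re_le => //; [exact: dcont_dot|by apply: dcontD => //; exact: dcontZ|].
  move=> z Dz; rewrite reL (dot_opp_add (EE z)) reS.
  have := Re_dot_ge0 (mulV B A v) z.
  move: (complex.Re (dot (mulV B A v) (mulV B A v) z)) => y y0; lra.
have step2 : complex.Re (cm (rr R m) (dot E E)) =
    complex.Re (cm (rr R m) (sq (E None))) + \sum_i complex.Re (cm (rr R m) (sq (E (Some i)))).
  have cs i : dcont (sq (E (Some i))) by exact: dcont_sq.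
  rewrite -Re_sum -ReD -cm_sum// -cmD//; first exact: dcont_sq.
  exact: dcont_sum.
have step3 i : complex.Re (cm (rr R m) (sq (E (Some i)))) <= e1.
  apply: (@parseval_le _ _ r0 r1 (fun k => b k i 0)).
    move=> z Dz; have := hb i 0 z Dz; congr (tends _ _).
    rewrite !mxE /E /mulV; congr (_ - _); apply: eq_bigr => j _.
    by rewrite mxE.
  move=> K; apply: le_trans (sb K); apply: ler_sum => k _; exact: entry_le_mnorm2.
have step4 : \sum_i complex.Re (cm (rr R m) (sq (E (Some i)))) <= e / 4.
  apply: (@le_trans _ _ (\sum_(i < n) e1)); first by apply: ler_sum => i _.
  rewrite sumr_const card_ord -[_ *+ n]mulr_natl.
  apply: (@le_trans _ _ ((n%:R + 1) * e1)).
    by rewrite ler_wpM2r ?(ltW e10)// lerDl.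
  by rewrite mulrC divfK// gt_eqF.
have step5 := hs m.
move: step1 hm; rewrite step2 ltr_norml => step1 /andP[hm1 hm2].
apply: (le_trans step1).
apply: (@le_trans _ _ (e / 4 + e / 4 - 2 * complex.Re (cm (rr R m) (dot (mulV B A v) (err s))))).
  by rewrite lerD2r; apply: lerD; [exact: step5|exact: step4].
move: hm1; move: (complex.Re _) => y; lra.
Qed.

Lemma cm_sq_le_dot x o m : (forall o, dcont (x o)) ->
  complex.Re (cm (rr R m) (sq (x o))) <= complex.Re (cm (rr R m) (dot x x)).
Proof.
move=> cx; apply: cm_Re_le; [exact: rr_ge0|exact: rr_lt1|exact: dcont_sq|exact: dcont_dot|].
move=> z _; rewrite Re_sq Re_dot; case: o => [i|]; last first.
  by rewrite lerDl sumr_ge0// => i _; exact: sqr_ge0.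
rewrite (bigD1 i)//= addrCA lerDl addr_ge0 ?sqr_ge0// sumr_ge0// => j _; exact: sqr_ge0.
Qed.

Lemma HB_norm2_approx (V : R) : LM (dot F F) (Complex V 0) -> HB_norm2 B (F None) V.
Proof.
move=> hV.
pose ep (m : nat) : R := (m.+1)%:R^-1.
have ep0 m : 0 < ep m by rewrite invr_gt0.
have ep_lim (e : R) : 0 < e -> exists N, forall m, (N <= m)%N -> ep m < e.
  move=> e0; have /cvg0P/(_ e e0)[N hN] := @cvg_harmonic R.
  by exists N => m /hN; apply: le_lt_trans; exact: ler_norm.
have /choice[s hs] : forall m, exists s, indisc s /\ ev_le (err s) (ep m).
  by move=> m; have [s d h] := kvec_approx (ep0 m); exists s.
have ds m := (hs m).1.
have cu m o : dcont (err (s m) o) by apply/nice_dcont/nice_err/ds.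
have ck m o : dcont (kvec B A (s m) o) by apply/nice_dcont/nice_kvec/ds.
have cF o := nice_dcont (nF o).
have hk m := kvec_norm nB nA gram_lim (ds m).
have evN x e : ev_le x e -> (forall o, dcont (x o)) -> ev_le (fun o z => - x o z) e.
  move=> [N hN] cx; exists N => m /hN; congr (complex.Re _ <= _).
  apply: eq_cm; [exact: rr_ge0|exact: rr_lt1|].
  by move=> z _; rewrite /dot; congr (_ + _); [rewrite conjN; ring|];
    apply: eq_bigr => i _; rewrite conjN; ring.
exists s; split; first exact: ds.
split.
  (* The difference of two kernel vectors is the difference of their errors; [LM_dot_le] with
     [d = 1] bounds its squared norm by [2 * ep m + 2 * ep l], below [e / 2]. *)
  move=> e e0; have [N hN] := ep_lim (e / 8) (divr_gt0 e0 (ltr0Sn R 7)).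
  exists N => m l /hN hm /hN hl; rewrite knorm2E.
  have dml : indisc (s m ++ kneg (s l)) by apply: indisc_cat => //; exact: indisc_kneg.
  have := @LM_dot_le (kvec B A (s m ++ kneg (s l))) (err (s m)) (fun o z => - err (s l) o z)
    _ 1 (ep m) (ep l) ltr01 _ (cu m) _ _ (kvec_norm nB nA gram_lim dml) (hs m).2 (evN _ _ (hs l).2 (cu l)).
  rewrite invr1 => h; apply: (le_lt_trans (h _ _ _)).
  - by move=> o; apply/nice_dcont/nice_kvec.
  - by move=> o; exact: dcontN.
  - by move=> z _ o; rewrite kvec_sub /err; ring.
  - move: (ep m) (ep l) hm hl => a b hm hl; lra.
split.
  (* The mean square of the error controls its value at [z], up to the factor [1 - cabs z ^+ 2] of
     [eval_bound]. *)
  move=> z Dz; apply/cvg_tends => e e0; have /cdiscP z1 := Dz.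
  have w0 : 0 < 1 - cabs z ^+ 2 by rewrite subr_gt0 expr_lt1 ?cabs_ge0.
  have [N hN] := ep_lim (e ^+ 2 * (1 - cabs z ^+ 2)) (mulr_gt0 (exprn_gt0 2 e0) w0).
  exists N => m /hN hm; rewrite (keval_kvec _ A); apply: sqr_lt_cabs => //.
  rewrite -(ltr_pM2r w0); apply: le_lt_trans hm.
  have [K hK] := (hs m).2.
  apply: (@eval_bound _ (err (s m) None) z (ep m) K) => //; first exact/nice_err/ds.
  by move=> k /hK; apply: le_trans; exact: cm_sq_le_dot.
apply/cvg_sub0/cvg0P => e e0.
have V0 : 0 <= V.
  rewrite -[V]/(complex.Re (Complex V 0)) -oppr_le0 -ReN.
  apply: (@tends_Re_le _ (fun m => - cm (rr R m) (dot F F))); last exact: tendsN.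
  move=> m; rewrite ReN oppr_le0.
  have := @cm_Re_le _ _ (rr_ge0 R m) (rr_lt1 R m) (fun=> 0) (dot F F) (@dcont_cst _ 0) (dcont_dot cF cF).
  by rewrite cm_cst; apply=> z _; exact: Re_dot_ge0.
(* [i1] and [i2] compare the squared norms of the kernel vector and of [F] in both directions, with
   weight [1 + d]. First [d] is chosen to make [d * V] small, then the approximation error is taken
   small against [1 + d^-1]. *)
have [d [d0 d1 dV]] : exists d : R, [/\ 0 < d, d <= 1 & 2 * d * V <= e / 4].
  have V1 : 0 < 8 * (V + 1) by lra.
  exists (Num.min 1 (e / (8 * (V + 1)))); split.
  - by rewrite lt_min ltr01 divr_gt0.
  - by rewrite ge_min lexx.
  apply: (@le_trans _ _ (2 * (e / (8 * (V + 1))) * V)).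
    by rewrite ler_wpM2r// ler_wpM2l// ge_min lexx orbT.
  have -> : 2 * (e / (8 * (V + 1))) * V = e / 4 * (V / (V + 1)) by field; lra.
  rewrite ler_piMr//; first by rewrite divr_ge0// ltW.
  by rewrite ler_pdivrMr; lra.
pose g := d^-1; have g0 : 0 < g by rewrite invr_gt0.
have T0 : 0 < e / 4 / (3 + g) by rewrite !divr_gt0//; lra.
have [N hN] := ep_lim _ T0; exists N => m /hN hm.
have kreal := LM_dot_real (ck m) (hk m).
set X := knorm2 B (s m).
have XE : X = complex.Re (\sum_(x <- s m) conjc x.1 * keval B (s m) x.2) by rewrite /X knorm2E.
have i1 : X <= (1 + d) * (V + ep m) + (1 + g) * ep m.
  rewrite XE; apply: (LM_dot_le d0 (ck m) cF (cu m) _ (hk m) (LM_ev_le (ep0 m) hV) (hs m).2).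
  by move=> z _ o; rewrite /err; ring.
have i2 : V <= (1 + d) * (X + ep m) + (1 + g) * ep m.
  have hX : LM (dot (kvec B A (s m)) (kvec B A (s m))) (Complex X 0) by rewrite XE -kreal.
  have := LM_dot_le d0 cF (ck m) (fun o => dcontN (cu m o)) _ hV (LM_ev_le (ep0 m) hX)
     (evN _ _ (hs m).2 (cu m)).
  by apply=> z _ o; rewrite /err; ring.
rewrite ltr_pdivlMr in hm; last by lra.
move: (ep m) (ep0 m) hm i1 i2 => q q0 hm i1 i2.
have dq : d * q <= q by rewrite ler_piMl// ltW.
have T : (1 + d) * q + (1 + g) * q <= e / 4.
  have -> : (1 + d) * q + (1 + g) * q = q * (3 + g) - (q - d * q) by ring.
  lra.
have dd : d * ((1 + d) * q + (1 + g) * q) <= e / 4.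
  by apply: le_trans T; rewrite ler_piMl// addr_ge0// mulr_ge0// ?addr_ge0// ltW.
have j1 : X <= V + d * V + e / 4 by lra.
have dX : d * X <= d * (V + d * V + e / 4) by rewrite ler_wpM2l// ltW.
have j2 : V <= X + d * X + e / 4 by lra.
have d2V : d * (d * V) <= d * V by rewrite ler_piMl// mulr_ge0// ltW.
have de : d * (e / 4) <= e / 4 by rewrite ler_piMl// divr_ge0// ltW.
rewrite ltr_norml; apply/andP; split; lra.
Qed.

End Approximation.

(** * Boundary values of the Gram matrix *)

Section BoundaryGram.
Variables (R : realType) (n : nat).
Local Notation C := R[i].

Lemma tendsM (u v : nat -> C) a b : tends u a -> tends v b ->
  tends (fun m => u m * v m) (a * b).
Proof.
move=> hu hv; have [M hM] := tends_bound hu.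
have M0 : 0 <= M by exact: le_trans (cabs_ge0 _) (hM 0%N).
have h1 : tends (fun m => u m * (v m - b)) 0.
  move=> e e0; have M1 : 0 < M + 1 by rewrite ltr_wpDl.
  have [N hN] := hv _ (divr_gt0 e0 M1); exists N => m /hN h.
  rewrite subr0 cabsM; apply: (@le_lt_trans _ _ ((M + 1) * cabs (v m - b))).
    by rewrite ler_wpM2r ?cabs_ge0// (le_trans (hM m))// lerDl.
  by rewrite mulrC -ltr_pdivlMr.
have := tendsD h1 (tendsZ b hu); rewrite add0r [b * a]mulrC.
by apply: tends_eq => m; ring.
Qed.

Lemma radial_tends p q (G : C -> 'M[C]_(p, q)) t b : radial_limit G t b ->
  forall i j, tends (fun m => G (Complex (rr R m) 0 * cexpi t) i j) (b i j).
Proof.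
move=> h; apply/mnorm2_entries.
by move/cvg_at_leftP : h; apply; split; [exact: rr_lt1|exact: rr_cvg].
Qed.

Lemma gram_boundary (B : C -> 'rV[C]_n) (A : C -> 'M[C]_n) bB bA t :
  radial_limit B t bB -> radial_limit A t bA -> adj bB *m bB + adj bA *m bA = 1%:M ->
  forall k j, tends (fun m => gram B A (Complex (rr R m) 0 * cexpi t) k j) (k == j)%:R.
Proof.
move=> /radial_tends hB /radial_tends hA h k j.
have -> : (k == j)%:R = conjc (bB 0 k) * bB 0 j + \sum_i conjc (bA i k) * bA i j :> C.
  have := congr1 (fun M : 'M[C]_n => M k j) h; rewrite !mxE big_ord1 => <-.
  by rewrite !mxE; congr (_ + _); apply: eq_bigr => i _; rewrite !mxE.
apply: tendsD; first by apply: tendsM => //; apply: tends_conj.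
by apply: tends_sum => i; apply: tendsM => //; apply: tends_conj.
Qed.

End BoundaryGram.

Theorem theorem2p3 (R : realType) (n : nat) (n_gt0 : (0 < n)%N)
  (B : R[i] -> 'rV[R[i]]_n) (bB : R -> 'rV[R[i]]_n)
  (A : R[i] -> 'M[R[i]]_n) (bA : R -> 'M[R[i]]_n)
  (c : nat -> 'rV[R[i]]_n) (f : R[i] -> R[i]) (fh : nat -> R[i]) :
  (* B in S(C^n, C) *)
  mx_holo_on (@cdisc R) B ->
  (forall z, cdisc z -> mnorm2 (B z) <= 1) ->
  (* bB is the a.e. boundary function of B *)
  {ae (@lebesgue_measure R), forall t, radial_limit B t (bB t)} ->
  (* log(1 - B B^* ) in L^1(T) *)
  {ae (@lebesgue_measure R), forall t, 0 < 1 - mnorm2 (bB t)} ->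
  (@lebesgue_measure R).-integrable `[0, 2 * pi]
     (fun t => (ln (1 - mnorm2 (bB t)))%:E) ->
  (* A bounded holomorphic and outer, with boundary function bA *)
  mx_holo_on (@cdisc R) A ->
  (exists M : R, forall z, cdisc z -> mnorm2 (A z) <= M) ->
  outer A ->
  {ae (@lebesgue_measure R), forall t, radial_limit A t (bA t)} ->
  {ae (@lebesgue_measure R), forall t,
     adj (bB t) *m bB t + adj (bA t) *m bA t = 1%:M} ->
  (* B(z) A(z)^{-1} = sum_j c_j z^j on D *)
  (forall z, cdisc z -> mx_series_to (fun j => z ^+ j *: c j) (B z *m invmx (A z))) ->
  (* f holomorphic in a neighborhood of the closed disc, with Taylor coefficients fh *)
  (exists U : set R[i], [/\ copen U, cdisc_closure (R:=R) `<=` U & holo_on U f]) ->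
  (forall z, cdisc z -> c_series_to (fun j => fh j * z ^+ j) (f z)) ->
  (forall k, cvgn (series (fun j => mnorm (fh (j + k)%N *: adj (c j))))) /\
  in_HB B f /\
  exists v1 v2 : R,
    [/\ series (fun k => cabs (fh k) ^+ 2) @ \oo --> v1,
        series (fun k => mnorm2 (mx_sum (fun j => fh (j + k)%N *: adj (c j)))) @ \oo --> v2
      & HB_norm2 B f (v1 + v2)].

Proof.
move=> holB bndB limB _ _ holA [MA bndA] outA limA bdry serC [U [oU dU hf]] serf.
have unitA z : cdisc z -> A z \in unitmx by move=> Dz; exact: outer_unitmx bndA _ Dz.
have nA i j : nice (fun z => A z i j) by exact: outer_nice holA outA _ bndA i j.
pose Cf (i : 'I_n) z := (B z *m invmx (A z)) 0 i.
have psC i : is_ps (fun j => c j 0 i) (Cf i).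
  by move/mx_series_ps : serC; exact.
have BCA z j : cdisc z -> B z 0 j = \sum_i Cf i z * A z i j.
  move=> Dz; have {1}-> : B z = B z *m invmx (A z) *m A z by rewrite mulmxKV// unitA.
  by rewrite mxE.
(* [B] gets its power series as the product of the series of the [c j] with that of [A], both
   available by now. *)
have nB j : nice (fun z => B z 0 j).
  split.
    exists 1 => z Dz; apply: sqr_le_cabs; rewrite ?expr1n//.
    exact: le_trans (entry_le_mnorm2 _ _ _) (bndB z Dz).
  apply: (@eq_has_ps _ (fun z => \sum_i Cf i z * A z i j)) => [z Dz|]; first by rewrite BCA.
  apply: has_ps_sum => i; apply: has_psM; last exact: (nA i j).2.
  by exists (fun j => c j 0 i).
have gram_lim : {ae (@lebesgue_measure R), forall t, forall k j,
    tends (fun m => gram B A (Complex (rr R m) 0 * cexpi t) k j) (k == j)%:R}.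
  have [N1 [mN1 N10 s1]] := limB; have [N2 [mN2 N20 s2]] := limA.
  have [N3 [mN3 N30 s3]] := bdry.
  exists (N1 `|` N2 `|` N3); split.
  - by apply: measurableU => //; exact: measurableU.
  - by rewrite !measureU0//; exact: measurableU.
  move=> t /= nt; apply: contrapT => nN; apply: nt.
  move=> k j; apply: (@gram_boundary _ _ B A (bB t) (bA t)).
  - by apply: contrapT => h; apply: nN; left; left; apply: s1.
  - by apply: contrapT => h; apply: nN; left; right; apply: s2.
  - by apply: contrapT => h; apply: nN; right; apply: s3.
have psf : is_ps fh f by move=> z Dz; apply/cvg_tends; exact: serf.
have [K [rho [rho0 rho1 decay]]] := geometric_decay oU dU hf psf.
have [G psG] := gcoef_fun rho0 rho1 decay psC.
have nF := nice_Fvec rho0 rho1 decay psf psC psG.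
have Forth := Fvec_orth rho0 rho1 decay psf psC nB nA BCA psG.
have [v1 [v2 [hv1 hv2 hF]]] := Fvec_norm rho0 rho1 decay psf psC psG.
(* Outerness will be applied to the vector part of [F]; geometric decay of its coefficients puts it
   in the Hardy space. *)
have hardyF : in_hardy (fun z => \col_i Fvec f G (Some i) z).
  exists (fun k => - gcoef c fh k).
  apply: (geom_hardy rho0 rho1) => [k i|i].
    by rewrite mxE cabsN; exact: (gcoef_bound rho0 rho1 decay psC).
  move=> z Dz; have := psG i z Dz; rewrite mxE; apply: tends_eq => N.
  by apply: eq_bigr => k _; rewrite mxE.
have HB := HB_norm2_approx nB nA gram_lim nF Forth outA hardyF hF.
split; first by move=> k; exact: (abs_series_cvg rho0 rho1 decay psC).
by split; [exists (v1 + v2)|exists v1, v2].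
Qed.
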